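(* Let $\gamma\in(0,1)$ be fixed, let $k\in\frac12\mathbb{Z}_+$ be a nonnegative integer or half-integer, and let $\alpha,\beta\in\mathbb{Z}_+$ satisfy $\alpha+\beta=2k$. For $R>0$ denote by $Q_R$ the rectangle $$Q_R=\{z=x+iy\in\Pi:\ x\in(-R,R),\ y\in(R^{-1},R)\}.$$ Suppose that the measure $\mu$ on $\Pi$ satisfies $$\lim_{R\to\infty}\ \sup_{z\in\Pi\setminus Q_R}\left\{|\mu|(D(z,\gamma))\,(\operatorname{Im}z)^{-2(k+1)}\,\Gamma(k+1)^2\,\gamma^{-2k}\right\}=0.$$ Then the Toeplitz operator $T_{\partial^{\alpha}\bar\partial^{\beta}\mu}$ is compact in $\mathcal{A}_1$.
   Context: $\Pi=\{z\in\mathbb{C}:\operatorname{Im}z>0\}$. $\mathcal{A}_1=\mathcal{A}^2(\Pi)$ is the Bergman space of analytic functions on $\Pi$ that are square integrable with respect to Lebesgue area measure, with the $L^2$ scalar product $\langle\cdot,\cdot\rangle$. $D(z,\gamma)=\{w\in\Pi:\left|\frac{z-w}{z-\overline{w}}\right|<\gamma\}$ is the pseudo-hyperbolic disk. $\mathbb{Z}_+=\{0,1,2,\dots\}$. A measure on $\Pi$ is a regular complex Borel measure that is locally finite (its variation $|\mu|$ is finite on compact subsets of $\Pi$, but the total variation need not be finite). The Toeplitz operator $T_{\partial^{\alpha}\bar\partial^{\beta}\mu}$ in $\mathcal{A}_1$ is the operator defined by the sesquilinear form $$\langle T_{\partial^{\alpha}\bar\partial^{\beta}\mu}f,g\rangle=(\partial^{\alpha}\bar\partial^{\beta}\mu,f\bar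 g):=(-1)^{\alpha+\beta}\int_\Pi\partial^{\alpha}f\,\overline{\partial^{\beta}g}\,d\mu,\qquad f,g\in\mathcal{A}_1,$$ where $\partial=\partial/\partial z$ and $\bar\partial=\partial/\partial\bar z$. *)

(* Defs.v *)
From HB Require Import structures.
From mathcomp Require Import all_boot all_order all_algebra.
From mathcomp Require Import all_classical all_reals all_analysis.
From mathcomp Require Import complex.

Set Implicit Arguments.
Unset Strict Implicit.
Unset Printing Implicit Defensive.

Import Order.TTheory GRing.Theory Num.Theory.
Import numFieldNormedType.Exports.

Local Open Scope classical_set_scope.
Local Open Scope ring_scope.
Local Open Scope complex_scope.

(* [Num.Theory] also exports an [Re] and an [Im], valued in the complex field. *)
Local Notation Re := complex.Re.
Local Notation Im := complex.Im.

(* Borel sets, measures and compact sets live on the real plane [R * R] (product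
   sigma-algebra and product topology); analytic functions live on [R[i]^o],
   which carries the topology of [R[i]] seen as a normed field.  [cplx]
   identifies the two: [(x, y)] stands for [x + iy]. *)
Definition cplx (R : realType) (p : R * R) : R[i]^o := p.1 +i* p.2.

Definition halfplane (R : realType) : set (R * R) := [set p | 0 < p.2].
Arguments halfplane : clear implicits.

Definition area (R : realType) : set (R * R) -> \bar R :=
  (@lebesgue_measure R \x @lebesgue_measure R)%E.
Arguments area : clear implicits.

Definition pseudohyperbolic_disk (R : realType) (z : R * R) (gamma : R) :
    set (R * R) :=
  [set w | halfplane R w /\
    Normc.normc ((cplx z - cplx w) / (cplx z - (cplx w)^*)) < gamma].

Definition rectangle (R : realType) (r : R) : set (R * R) :=
  [set p | (- r < p.1 < r) /\ (r^-1 < p.2 < r)].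

Definition gamma_function (R : realType) (x : R) : R :=
  \int[lebesgue_measure]_(t in [set t : R | 0 < t]) (t `^ (x - 1) * expR (- t)).

(* A locally finite complex measure on the half-plane need not assign a complex number to every Borel set.  It is a
   function on the Borel sets contained in some compact subset of the
   half-plane; its values on the other sets are irrelevant. *)

Definition relcompact_borel (R : realType) (A : set (R * R)) : Prop :=
  measurable A /\
  exists K : set (R * R), [/\ compact K, K `<=` halfplane R & A `<=` K].

(* Finite disjoint families of subsets give the same supremum as the countable
   partitions of [A]; members of [B] beyond [n] may be empty. *)
Definition cvariation (R : realType) (mu : set (R * R) -> R[i]) (A : set (R * R)) :
    \bar R :=
  ereal_sup [set s | exists (n : nat) (B : nat -> set (R * R)),
    [/\ trivIset setT B,
        forall i, relcompact_borel (B i) /\ B i `<=` A &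
        s = (\sum_(i < n) Normc.normc (mu (B i)))%:E]].

Record complex_measure (R : realType) (mu : set (R * R) -> R[i]) : Prop := {
  cmeasure_sigma_additive : forall F : nat -> set (R * R),
    (forall i, measurable (F i)) -> trivIset setT F ->
    relcompact_borel (\bigcup_i F i) ->
    (fun n => \sum_(i < n) mu (F i) : R[i]^o) @ \oo
      --> (mu (\bigcup_i F i) : R[i]^o) ;
  cmeasure_locally_finite : forall K : set (R * R),
    compact K -> K `<=` halfplane R -> (cvariation mu K < +oo)%E ;
  cmeasure_outer_regular : forall A : set (R * R),
    measurable A -> A `<=` halfplane R ->
    cvariation mu A = ereal_inf [set cvariation mu U | U in
      [set U | [/\ open U, A `<=` U & U `<=` halfplane R]]] ;
  cmeasure_inner_regular : forall A : set (R * R),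
    measurable A -> A `<=` halfplane R ->
    cvariation mu A = ereal_sup [set cvariation mu K | K in
      [set K | compact K /\ K `<=` A]] }.

(* Positive part in the Jordan decomposition of a locally finite signed measure;
   the negative part of [nu] is the positive part of [- nu]. *)
Definition jordan_part (R : realType) (nu : set (R * R) -> R) (A : set (R * R)) :
    \bar R :=
  ereal_sup [set (nu B)%:E | B in [set B | relcompact_borel B /\ B `<=` A]].

Definition signed_integral (R : realType) (nu : set (R * R) -> R)
    (h : R * R -> R) : R :=
  fine (\int[jordan_part nu]_(p in halfplane R) (h p)%:E) -
  fine (\int[jordan_part (fun B => - nu B)]_(p in halfplane R) (h p)%:E).

Definition cmeasure_integral (R : realType) (mu : set (R * R) -> R[i])
    (h : R * R -> R[i]) : R[i] :=
  let re_mu B := Re (mu B) in let im_mu B := Im (mu B) in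
  let re_h p := Re (h p) in let im_h p := Im (h p) in
  (signed_integral re_mu re_h - signed_integral im_mu im_h) +i*
  (signed_integral re_mu im_h + signed_integral im_mu re_h).

Definition cmeasure_integrable (R : realType) (mu : set (R * R) -> R[i])
    (h : R * R -> R[i]) : Prop :=
  (cvariation mu).-integrable (halfplane R) (fun p => (Re (h p))%:E) /\
  (cvariation mu).-integrable (halfplane R) (fun p => (Im (h p))%:E).

Definition analytic_at (R : realType) (f : R[i]^o -> R[i]^o) (z0 : R[i]^o) : Prop :=
  exists (a : nat -> R[i]^o) (r : R), 0 < r /\
    forall z : R[i]^o, Normc.normc (z - z0) < r ->
      (fun n => \sum_(j < n) a j * (z - z0) ^+ j : R[i]^o) @ \oo --> f z.

(* A function on the half-plane is represented by its extension by zero, so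
   that Leibniz equality of elements of the space is equality on the
   half-plane. *)
Definition bergman (R : realType) (f : R[i]^o -> R[i]^o) : Prop :=
  [/\ forall z : R[i]^o, 0 < Im z -> analytic_at f z,
      forall z : R[i]^o, Im z <= 0 -> f z = 0 &
      (\int[area R]_(p in halfplane R) ((Normc.normc (f (cplx p))) ^+ 2)%:E
        < +oo)%E].

Definition bergman_inner (R : realType) (f g : R[i]^o -> R[i]^o) : R[i] :=
  let h p : R[i] := f (cplx p) * (g (cplx p))^* in
  fine (\int[area R]_(p in halfplane R) (Re (h p))%:E) +i*
  fine (\int[area R]_(p in halfplane R) (Im (h p))%:E).

Definition bergman_norm (R : realType) (f : R[i]^o -> R[i]^o) : R :=
  Num.sqrt (Re (bergman_inner f f)).

Definition compact_operator (R : realType)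
    (T : (R[i]^o -> R[i]^o) -> (R[i]^o -> R[i]^o)) : Prop :=
  [/\ forall f, bergman f -> bergman (T f),
      forall (a : R[i]^o) f g, bergman f -> bergman g ->
        T (a *: f + g) = a *: T f + T g &
      forall u : nat -> R[i]^o -> R[i]^o,
        (forall n, bergman (u n)) ->
        (exists M : R, forall n, bergman_norm (u n) <= M) ->
        exists (phi : nat -> nat) (l : R[i]^o -> R[i]^o),
          [/\ {homo phi : m n / (m < n)%N}, bergman l &
              (fun n => bergman_norm (T (u (phi n)) - l)) @ \oo --> (0 : R)]].

(* On analytic functions the operator [d/dz] is the complex derivative. *)
Definition toeplitz_integrand (R : realType) (alpha beta : nat)
    (f g : R[i]^o -> R[i]^o) (p : R * R) : R[i] :=
  derive1n alpha f (cplx p) * (derive1n beta g (cplx p))^*.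

Definition toeplitz_form (R : realType) (alpha beta : nat)
    (mu : set (R * R) -> R[i]) (f g : R[i]^o -> R[i]^o) : R[i] :=
  (-1) ^+ (alpha + beta) *
  cmeasure_integral mu (toeplitz_integrand alpha beta f g).

Definition toeplitz_operator (R : realType) (alpha beta : nat)
    (mu : set (R * R) -> R[i])
    (T : (R[i]^o -> R[i]^o) -> (R[i]^o -> R[i]^o)) : Prop :=
  (forall f, bergman f -> bergman (T f)) /\
  (forall f g, bergman f -> bergman g ->
     cmeasure_integrable mu (toeplitz_integrand alpha beta f g) /\
     bergman_inner (T f) g = toeplitz_form alpha beta mu f g).

(* Main.v *)
Require Import Defs.
From HB Require Import structures.
From mathcomp Require Import all_boot all_order all_algebra.
From mathcomp Require Import all_classical all_reals all_analysis.
From mathcomp Require Import measurable_realfun.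
From mathcomp Require Import complex.
From mathcomp Require Import ring lra.

(** Write N = alpha + beta = 2k, y = Im z, v = Im w, and D(w) for the
pseudohyperbolic disk of radius gamma.  The operator is compact because its
form is controlled by a weighted area integral of |f|^2 whose weight tends to
zero at the boundary of the half-plane and at infinity.

The Euclidean disc of radius gamma y about z lies in D(z), so the area mean
value property gives y^(2n+2) |f^(n)(z)|^2 <= C int_D(z) |f|^2 dA.  Dividing by
y^(N+2), integrating against |mu| and exchanging the integrals (Tonelli) yields
the Carleson embedding [carleson_embedding]
  int |f^(n)|^2 y^(2n-N) d|mu| <= C int |f|^2 rho dA,
where rho(w) is the integral of y^(-N-2) d|mu|(z) over the z with w in D(z).
Heights are comparable in a pseudohyperbolic disk, whence
rho(w) <= C v^(-N-2) |mu|(D(w)) [carleson_density_le].  The hypothesis on mu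
says precisely that the right-hand side is small off a large rectangle; local
finiteness bounds it on the rectangle [carleson_density_small,
carleson_density_bounded].

The weights y^(2 alpha - N) and y^(2 beta - N) are inverse to each other, so
the arithmetic-geometric inequality bounds |f^(alpha)| |g^(beta)| by the two
weighted squares [toeplitz_integrand_le].  Hence the form is bounded, the
operator T exists by Riesz representation [bergman_riesz], and testing the form
against g = T f gives |T f|^2 <= C int |f|^2 rho dA [toeplitz_sq_le].

A bounded sequence of the Bergman space has a subsequence that converges
pointwise to an element of the space [bergman_montel].  If v_n denotes the
difference with the limit, then int |v_n|^2 rho dA tends to 0: off a large
rectangle rho is small, and on the rectangle v_n is bounded and tends to 0
pointwise [density_energy_cvg0].  So T v_n tends to 0 in norm
[toeplitz_compact].

The function theory needed is the mean value estimate for derivatives, local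
equicontinuity, and the stability of analyticity under locally bounded
pointwise limits.  All three come from one formula [cauchy_formula]: Cauchy's
formula averaged over the circles |w - z0| = r with a weight supported in an
annulus.  There area integrals replace contour integrals, and Cauchy's theorem
becomes the vanishing of the integral of a derivative with compact support
[annular_green], which is Fubini's theorem and the fundamental theorem of
calculus. *)

Set Implicit Arguments.
Unset Strict Implicit.
Unset Printing Implicit Defensive.

Import Order.TTheory GRing.Theory Num.Theory.
Import numFieldNormedType.Exports.

Local Open Scope classical_set_scope.
Local Open Scope ring_scope.
Local Open Scope complex_scope.

Local Notation Re := complex.Re.
Local Notation Im := complex.Im.
Local Notation normc := Normc.normc.

(** * Modulus, real and imaginary parts, limits in R[i] *)

Section ComplexModulus.
Variable R : realType.
Implicit Types (x y : R) (z w : R[i]).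

Lemma normr_normc z : `|z| = (normc z)%:C.
Proof. by []. Qed.

Lemma normc_sqr z : normc z ^+ 2 = Re z ^+ 2 + Im z ^+ 2.
Proof.
by case: z => a b /=; rewrite sqr_sqrtr // addr_ge0 // sqr_ge0.
Qed.

Lemma normc_ge0 z : 0 <= normc z.
Proof. by case: z => a b /=; rewrite sqrtr_ge0. Qed.
Hint Resolve normc_ge0 : core.

Lemma normcD z w : normc (z + w) <= normc z + normc w.
Proof. exact: le_normcD. Qed.

Lemma normcNe z : normc (- z) = normc z.
Proof. exact: normcN. Qed.

Lemma normcBC z w : normc (z - w) = normc (w - z).
Proof. by rewrite -normcNe opprB. Qed.

Lemma normcB z w : normc (z - w) <= normc z + normc w.
Proof. by rewrite -(normcNe w); exact: normcD. Qed.

Lemma normc_B_ge z w : normc z - normc w <= normc (z - w).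
Proof. by rewrite lerBlDr; have := normcD (z - w) w; rewrite subrK. Qed.

Lemma normcX z n : normc (z ^+ n) = normc z ^+ n.
Proof.
elim: n => [|n ih]; first by rewrite !expr0 Normc.normc1.
by rewrite !exprS Normc.normcM ih.
Qed.

Lemma normc_real x : normc (x%:C) = `|x|.
Proof. by rewrite /= expr0n /= addr0 sqrtr_sqr. Qed.

Lemma normc_i x : normc (x *i) = `|x|.
Proof. by rewrite /= expr0n /= add0r sqrtr_sqr. Qed.

Lemma normc_gt0 z : z != 0 -> 0 < normc z.
Proof.
move=> z0; rewrite lt_neqAle normc_ge0 andbT eq_sym.
by apply: contra z0 => /eqP/Normc.eq0_normc ->.
Qed.

Lemma normc_eq0 z : (normc z == 0) = (z == 0).
Proof.
apply/idP/idP => [/eqP/Normc.eq0_normc ->//|/eqP ->].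
by rewrite Normc.normc0.
Qed.

Lemma Re_le_normc z : `|Re z| <= normc z.
Proof.
rewrite -(ler_sqr) ?nnegrE // normc_sqr real_normK ?num_real //.
by rewrite lerDl sqr_ge0.
Qed.

Lemma Im_le_normc z : `|Im z| <= normc z.
Proof.
rewrite -(ler_sqr) ?nnegrE // normc_sqr real_normK ?num_real //.
by rewrite lerDr sqr_ge0.
Qed.

Lemma normc_le_ReIm z : normc z <= `|Re z| + `|Im z|.
Proof.
rewrite -(ler_sqr) ?nnegrE ?addr_ge0 // normc_sqr sqrrD !real_normK ?num_real //.
by rewrite lerD2r lerDl mulrn_wge0 // mulr_ge0.
Qed.

Lemma normc_conj z : normc (z^*) = normc z.
Proof. by case: z => a b /=; rewrite sqrrN. Qed.

Lemma normc_sum I (s : seq I) (P : pred I) (F : I -> R[i]) :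
  normc (\sum_(i <- s | P i) F i) <= \sum_(i <- s | P i) normc (F i).
Proof.
elim/big_rec2: _ => [|i y1 y2 _ h]; first by rewrite Normc.normc0.
by apply: le_trans (normcD _ _) _; rewrite lerD2l.
Qed.

Lemma ReD z w : Re (z + w) = Re z + Re w. Proof. by case: z; case: w. Qed.
Lemma ImD z w : Im (z + w) = Im z + Im w. Proof. by case: z; case: w. Qed.
Lemma ReN z : Re (- z) = - Re z. Proof. by case: z. Qed.
Lemma ImN z : Im (- z) = - Im z. Proof. by case: z. Qed.
Lemma ReB z w : Re (z - w) = Re z - Re w. Proof. by rewrite ReD ReN. Qed.
Lemma ImB z w : Im (z - w) = Im z - Im w. Proof. by rewrite ImD ImN. Qed.
Lemma ReM z w : Re (z * w) = Re z * Re w - Im z * Im w.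
Proof. by case: z; case: w. Qed.
Lemma ImM z w : Im (z * w) = Re z * Im w + Im z * Re w.
Proof. by case: z; case: w. Qed.
Lemma Re_conj z : Re (z^*) = Re z. Proof. by case: z. Qed.
Lemma Im_conj z : Im (z^*) = - Im z. Proof. by case: z. Qed.
Lemma complex_eqP z w : Re z = Re w -> Im z = Im w -> z = w.
Proof. by case: z; case: w => a b c d /= -> ->. Qed.
Lemma mulc_conj z : z * z^* = (normc z ^+ 2)%:C.
Proof.
rewrite normc_sqr; apply: complex_eqP; rewrite ?ReM ?ImM Re_conj Im_conj /=; ring.
Qed.

Lemma conjcM z w : (z * w)^* = z^* * w^*.
Proof. by apply: complex_eqP; rewrite ?(ReM, ImM, Re_conj, Im_conj); ring. Qed.

Lemma conjc_realE x : (x%:C)^* = x%:C :> R[i].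
Proof. by apply: complex_eqP; rewrite ?Re_conj ?Im_conj //= oppr0. Qed.

(** Turns negative powers into conjugates of positive ones, so that identities
    for holomorphic integrands reach the moments of w^(-j). *)
Lemma real_div_conj (k : R) w : w != 0 ->
  k%:C / w = ((k / normc w ^+ 2)%:C * w)^*.
Proof.
move=> w0; have n0 : normc w ^+ 2 != 0 by rewrite expf_neq0 // gt_eqF // normc_gt0.
apply: (mulIf w0); rewrite mulfVK // conjcM.
rewrite [X in X * _ * _](conjc_realE (k / normc w ^+ 2)) -mulrA [_^* * _]mulrC mulc_conj.
by rewrite -rmorphM divfK.
Qed.

Lemma sum_Re I (s : seq I) (P : pred I) (F : I -> R[i]) :
  Re (\sum_(i <- s | P i) F i) = \sum_(i <- s | P i) Re (F i).
Proof. by elim/big_rec2: _ => // i y1 y2 _ <-; rewrite ReD. Qed.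
Lemma sum_Im I (s : seq I) (P : pred I) (F : I -> R[i]) :
  Im (\sum_(i <- s | P i) F i) = \sum_(i <- s | P i) Im (F i).
Proof. by elim/big_rec2: _ => // i y1 y2 _ <-; rewrite ImD. Qed.

Section cvg.
Context {T : Type} {F : set_system T} {FF : Filter F}.

(** The norm of R[i] as a number field takes its values in R[i]; this lemma and
    the next ones pass between limits for that norm and limits of the
    real-valued modulus. *)
Lemma cvgC_normcP (f : T -> R[i]^o) (l : R[i]^o) :
  (f @ F --> l) <-> (forall e : R, 0 < e -> \forall t \near F, normc (f t - l) < e).
Proof.
split=> [/cvgrPdist_lt h e e0|h].
  have := h e%:C; rewrite ltcR => /(_ e0); apply: filterS => t.
  by rewrite normr_normc ltcR normcBC.
apply/cvgrPdist_lt => e e0.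
have e1 : e = (Re e)%:C.
  by move: e0; case: e => a b; rewrite ltcE /= => /andP[/eqP -> _].
move: e0; rewrite e1 ltcR => e0; have := h _ e0; apply: filterS => t.
by rewrite normr_normc ltcR normcBC.
Qed.

Lemma cvgC_normc0P (f : T -> R[i]^o) (l : R[i]^o) :
  (f @ F --> l) <-> (normc (f t - l) @[t --> F] --> (0 : R)).
Proof.
rewrite cvgC_normcP; split=> h.
  apply/cvgrPdist_lt => e /h; apply: filterS => t.
  by rewrite sub0r normrN ger0_norm.
move=> e e0; move/cvgrPdist_lt : h => /(_ _ e0); apply: filterS => t.
by rewrite sub0r normrN ger0_norm.
Qed.

Lemma cvgC_ReP (f : T -> R[i]^o) (l : R[i]^o) : f @ F --> l ->
  Re (f t) @[t --> F] --> Re l.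
Proof.
move=> /cvgC_normcP h; apply/cvgrPdist_lt => e /h; apply: filterS => t.
by apply: le_lt_trans; rewrite distrC -ReB Re_le_normc.
Qed.

Lemma cvgC_ImP (f : T -> R[i]^o) (l : R[i]^o) : f @ F --> l ->
  Im (f t) @[t --> F] --> Im l.
Proof.
move=> /cvgC_normcP h; apply/cvgrPdist_lt => e /h; apply: filterS => t.
by apply: le_lt_trans; rewrite distrC -ImB Im_le_normc.
Qed.

Lemma cvgC_ReIm (f : T -> R[i]^o) (a b : R) :
  Re (f t) @[t --> F] --> a -> Im (f t) @[t --> F] --> b ->
  f @ F --> (a +i* b : R[i]^o).
Proof.
move=> /cvgrPdist_lt ha /cvgrPdist_lt hb; apply/cvgC_normcP => e e0.
have e2 : 0 < e / 2 by rewrite divr_gt0.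
move: (ha _ e2) (hb _ e2); apply: filterS2 => t h1 h2.
apply: le_lt_trans (normc_le_ReIm _) _.
rewrite ReB ImB /= (distrC (Re _)) (distrC (Im _)) (splitr e).
exact: ltrD.
Qed.

Lemma cvgC_normc (f : T -> R[i]^o) (l : R[i]^o) : f @ F --> l ->
  normc (f t) @[t --> F] --> normc l.
Proof.
move=> /cvgC_normcP h; apply/cvgrPdist_lt => e /h; apply: filterS => t.
apply: le_lt_trans; rewrite ler_norml; apply/andP; split.
  by rewrite -lerN2 opprK opprB; exact: normc_B_ge.
by rewrite normcBC; exact: normc_B_ge.
Qed.

Lemma cvgC_mull (f : T -> R[i]) (l c : R[i]) :
  (f : T -> R[i]^o) @ F --> (l : R[i]^o) ->
  (fun t => c * f t : R[i]^o) @ F --> (c * l : R[i]^o).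
Proof.
move=> /cvgC_normcP h; apply/cvgC_normcP => e e0.
have c0 : 0 < normc c + 1 by rewrite ltr_wpDl.
have := h (e / (normc c + 1)); rewrite divr_gt0 // => /(_ isT).
apply: filterS => t; rewrite ltr_pdivlMr // => H.
rewrite -mulrBr Normc.normcM; apply: le_lt_trans H.
by rewrite mulrC ler_wpM2l // lerDl.
Qed.

Lemma cvgC_mulr (f : T -> R[i]) (l c : R[i]) :
  (f : T -> R[i]^o) @ F --> (l : R[i]^o) ->
  (fun t => f t * c : R[i]^o) @ F --> (l * c : R[i]^o).
Proof.
move=> h; rewrite mulrC.
by rewrite (_ : (fun t => _) = (fun t => c * f t)); [exact: cvgC_mull|apply/funext => t; rewrite mulrC].
Qed.

Lemma cvgC_add (f g : T -> R[i]) (l m : R[i]) :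
  (f : T -> R[i]^o) @ F --> (l : R[i]^o) -> (g : T -> R[i]^o) @ F --> (m : R[i]^o) ->
  (fun t => f t + g t : R[i]^o) @ F --> (l + m : R[i]^o).
Proof.
move=> /cvgC_normcP h1 /cvgC_normcP h2; apply/cvgC_normcP => e e0.
have e2 : 0 < e / 2 by rewrite divr_gt0.
move: (h1 _ e2) (h2 _ e2); apply: filterS2 => t H1 H2.
rewrite opprD addrACA (splitr e); apply: le_lt_trans (normcD _ _) _.
exact: ltrD.
Qed.

Lemma cvgC_sub (f g : T -> R[i]) (l m : R[i]) :
  (f : T -> R[i]^o) @ F --> (l : R[i]^o) -> (g : T -> R[i]^o) @ F --> (m : R[i]^o) ->
  (fun t => f t - g t : R[i]^o) @ F --> (l - m : R[i]^o).
Proof.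
move=> /cvgC_normcP h1 /cvgC_normcP h2; apply/cvgC_normcP => e e0.
have e2 : 0 < e / 2 by rewrite divr_gt0.
move: (h1 _ e2) (h2 _ e2); apply: filterS2 => t H1 H2.
rewrite (_ : _ - _ = (f t - l) - (g t - m)); last by ring.
rewrite (splitr e).
apply: le_lt_trans (normcB _ _) _; exact: ltrD.
Qed.

End cvg.

Lemma cvgC_shiftS (u : nat -> R[i]) (l : R[i]) :
  (u : nat -> R[i]^o) @ \oo --> (l : R[i]^o) ->
  (fun n => u n.+1 : R[i]^o) @ \oo --> (l : R[i]^o).
Proof. by move=> h; rewrite (cvg_shiftS (u : nat -> R[i]^o)). Qed.

Lemma cvgC_unique (u : nat -> R[i]^o) (l l' : R[i]^o) :
  u @ \oo --> l -> u @ \oo --> l' -> l = l'.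
Proof.
move=> h h'; apply: complex_eqP.
- have h1 : Re (u t) @[t --> \oo] --> Re l by exact: cvgC_ReP.
  have h2 : Re (u t) @[t --> \oo] --> Re l' by exact: cvgC_ReP.
  exact: cvg_unique h1 h2.
- have h1 : Im (u t) @[t --> \oo] --> Im l by exact: cvgC_ImP.
  have h2 : Im (u t) @[t --> \oo] --> Im l' by exact: cvgC_ImP.
  exact: cvg_unique h1 h2.
Qed.

Lemma cvgC_le (u : nat -> R[i]^o) (l : R[i]^o) (B : R) :
  u @ \oo --> l -> (\forall n \near \oo, normc (u n) <= B) -> normc l <= B.
Proof.
move=> h hB.
have h1 : normc (u t) @[t --> \oo] --> normc l by exact: cvgC_normc.
rewrite -(cvg_lim _ h1) //.
by apply: limr_le => //; apply/cvg_ex; eexists; exact: h1.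
Qed.

Lemma geometric_sum_le (q : R) n : 0 <= q < 1 ->
  \sum_(j < n) q ^+ j <= (1 - q)^-1.
Proof.
move=> /andP[q0 q1]; have q1' : 0 < 1 - q by rewrite subr_gt0.
rewrite -[leRHS]mul1r ler_pdivlMr // mulrC.
by rewrite -opprB mulNr -subrX1 opprB lerBlDr lerDl exprn_ge0.
Qed.

Lemma geometric_majorant_cvg (a : nat -> R[i]) (M q : R) : 0 <= q < 1 ->
  (forall j, normc (a j) <= M * q ^+ j) ->
  exists l : R[i], (fun n => \sum_(j < n) a j : R[i]^o) @ \oo --> (l : R[i]^o).
Proof.
move=> q01 aM.
have geo : cvgn (series (fun j => M * q ^+ j)).
  by apply: is_cvg_geometric_series; case/andP: q01 => q0; rewrite ger0_norm.
have P (u : nat -> R) : (forall j, `|u j| <= normc (a j)) -> cvgn (series u).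
  move=> ua; apply: normed_cvg => /=.
  apply: series_le_cvg geo => //= j.
    exact: le_trans (aM j).
  by apply: le_trans (aM j).
have /cvg_ex[/= lr hr] := P (fun j => Re (a j)) (fun j => Re_le_normc (a j)).
have /cvg_ex[/= li hi] := P (fun j => Im (a j)) (fun j => Im_le_normc (a j)).
exists (lr +i* li); apply: cvgC_ReIm.
- rewrite (_ : (fun t => _) = series (fun j => Re (a j))) //.
  by apply/funext => n; rewrite sum_Re /series /= big_mkord.
- rewrite (_ : (fun t => _) = series (fun j => Im (a j))) //.
  by apply/funext => n; rewrite sum_Im /series /= big_mkord.
Qed.

End ComplexModulus.
#[export] Hint Extern 0 (is_true _) =>
  lazymatch goal with
  | |- is_true (@Order.le _ _ _ (@Normc.normc _ _)) => exact: normc_ge0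
  end : core.
#[global] Arguments Normc.normc {R} x : simpl never.

(** * Power series and complex derivatives *)

Section PowerSeries.
Variable R : realType.
Implicit Types (f g : R[i] -> R[i]) (z w h : R[i]).

Definition cderiv f z d := forall e : R, 0 < e ->
  exists2 dl : R, 0 < dl & forall h, normc h < dl ->
    normc (f (z + h) - f z - d * h) <= e * normc h.

Definition power_series_on f z0 (r : R) (a : nat -> R[i]) :=
  forall z, normc (z - z0) < r ->
    (fun n => \sum_(j < n) a j * (z - z0) ^+ j : R[i]^o) @ \oo --> (f z : R[i]^o).

Lemma natr_pred_exp (K : comNzRingType) (x : K) j : j%:R * (x * x ^+ j.-1) = j%:R * x ^+ j.
Proof. by case: j => [|j]; rewrite ?mul0r // -exprS. Qed.

(** Both remainders satisfy the same recursion in j, with factors w + h and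
    |w| + rho; the ratio (|h| / rho)^2 therefore propagates.  Summed over j, the
    right-hand side involves only a power series evaluated at |w| + rho, so it
    bounds the Taylor remainder of the series by a multiple of |h|^2. *)
Lemma monomial_taylor (w h : R[i]) (rho : R) j : 0 < rho -> normc h <= rho ->
  normc ((w + h) ^+ j - w ^+ j - j%:R * w ^+ j.-1 * h) <=
  (normc h / rho) ^+ 2 *
    ((normc w + rho) ^+ j - normc w ^+ j - j%:R * normc w ^+ j.-1 * rho).
Proof.
move=> rho0 hrho; have rhoN : rho != 0 by rewrite gt_eqF.
elim: j => [|j ih].
  by rewrite !expr0 !mul0r !subr0 !subrr Normc.normc0 mulr0.
have -> : (w + h) ^+ j.+1 - w ^+ j.+1 - j.+1%:R * w ^+ j.+1.-1 * h =
   (w + h) * ((w + h) ^+ j - w ^+ j - j%:R * w ^+ j.-1 * h) +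
   j%:R * w ^+ j.-1 * h ^+ 2.
  have := natr_pred_exp w j; set x := w ^+ j.-1 => E.
  have {}E : j%:R * x * w = j%:R * w ^+ j by rewrite -E; ring.
  rewrite /= !exprS -natr1; ring: E.
apply: le_trans (normcD _ _) _; rewrite !Normc.normcM !normcX.
set X := normc h / rho.
have hX : normc h = X * rho by rewrite /X divfK.
have -> : (normc w + rho) ^+ j.+1 - normc w ^+ j.+1 - j.+1%:R * normc w ^+ j.+1.-1 * rho =
   (normc w + rho) * ((normc w + rho) ^+ j - normc w ^+ j - j%:R * normc w ^+ j.-1 * rho) +
   j%:R * normc w ^+ j.-1 * rho ^+ 2.
  have := natr_pred_exp (normc w) j; set x := normc w ^+ j.-1 => E.
  have {}E : j%:R * x * normc w = j%:R * normc w ^+ j by rewrite -E; ring.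
  rewrite /= !exprS -natr1; ring: E.
have -> : normc (j%:R : R[i]) = j%:R.
  by rewrite -(rmorph_nat (real_complex R)) normc_real normr_nat.
rewrite mulrDr lerD //; last first.
  by rewrite hX; set y := j%:R * _; rewrite le_eqVlt; apply/orP; left; apply/eqP; ring.
rewrite mulrCA; apply: ler_pM => //.
by apply: le_trans (normcD _ _) _; rewrite lerD2l.
Qed.

Lemma natr_expr_le (x rho : R) j : 0 <= x -> 0 < rho ->
  j.+1%:R * x ^+ j * rho <= (x + rho) ^+ j.+1.
Proof.
move=> x0 rho0; elim: j => [|j ih]; first by rewrite expr0 expr1 !mul1r lerDr.
rewrite [leRHS]exprS [leRHS]mulrDl -natr1.
have xj : 0 <= x ^+ j by rewrite exprn_ge0.
have H1 : x * (j.+1%:R * x ^+ j * rho) <= x * (x + rho) ^+ j.+1 by rewrite ler_wpM2l.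
have H2 : rho * x ^+ j.+1 <= rho * (x + rho) ^+ j.+1.
  by rewrite ler_pM2l // lerXn2r ?nnegrE ?addr_ge0 ?lerDl // ltW.
apply: le_trans (lerD H1 H2); rewrite le_eqVlt; apply/orP; left.
apply/eqP; rewrite exprS; ring.
Qed.

(** The terms of the convergent series at the point z0 + t are bounded. *)
Lemma power_series_coef_bound f z0 r a (t : R) : power_series_on f z0 r a ->
  0 <= t < r -> exists2 M : R, 0 <= M & forall j, normc (a j) * t ^+ j <= M.
Proof.
move=> fa /andP[t0 tr].
have /fa fz : normc (z0 + t%:C - z0) < r by rewrite addrC addKr normc_real ger0_norm.
move/cvgC_normcP : fz => /(_ _ ltr01)[N _ NP].
have NP' n : (N <= n)%N -> normc (a n) * t ^+ n <= 2.
  move=> Nn; have := NP n Nn; have := NP n.+1 (leqW Nn) => /=.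
  rewrite big_ord_recr /=; set S := \sum_(_ < _) _.
  set x := z0 + t%:C - z0; have xt : normc x = t by rewrite /x addrC addKr normc_real ger0_norm.
  rewrite -[in t ^+ n]xt -normcX -Normc.normcM => h1 h2.
  have -> : a n * x ^+ n = (S + a n * x ^+ n - f (z0 + t%:C)) - (S - f (z0 + t%:C)) by ring.
  apply: le_trans (normcB _ _) _.
  by have := ltrD h1 h2; lra.
exists (2 + \sum_(j < N) normc (a j) * t ^+ j).
  by rewrite addr_ge0 // sumr_ge0 // => j _; apply: mulr_ge0; [exact: normc_ge0|exact: exprn_ge0].
move=> j; case: (leqP N j) => Nj.
  apply: le_trans (NP' _ Nj) _; rewrite lerDl.
  by rewrite sumr_ge0 // => i _; apply: mulr_ge0; [exact: normc_ge0|exact: exprn_ge0].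
rewrite (bigD1 (Ordinal Nj)) //= addrCA lerDl addr_ge0 //.
by rewrite sumr_ge0 // => i _; apply: mulr_ge0; [exact: normc_ge0|exact: exprn_ge0].
Qed.

(** For |w| + rho < t < r the coefficients are O(t^(-j)), so the majorants of
    [monomial_taylor] form a convergent geometric series. *)
Lemma power_series_cderiv f z0 r a z : power_series_on f z0 r a ->
  normc (z - z0) < r -> exists2 d : R[i],
    (fun n => \sum_(j < n) (j.+1%:R * a j.+1) * (z - z0) ^+ j : R[i]^o) @ \oo --> (d : R[i]^o)
    & cderiv f z d.
Proof.
move=> fa; set w := z - z0 => wr.
(* Two nested radii |w| < W < t < r leave room for a geometric ratio q < 1. *)
pose rho := (r - normc w) / 4; have rho0 : 0 < rho by rewrite /rho; lra.
pose W := normc w + rho; pose t := normc w + 2 * rho.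
have w0 := normc_ge0 w.
have W0 : 0 < W by rewrite /W; lra.
have Wt : W < t by rewrite /W /t; lra.
have t0 : 0 < t by apply: lt_trans Wt.
have tr : t < r by rewrite /t /rho; lra.
have [M M0 aM] : exists2 M : R, 0 <= M & forall j, normc (a j) * t ^+ j <= M.
  by apply: power_series_coef_bound fa _; rewrite ltW.
pose q := W / t.
have q01 : 0 <= q < 1 by rewrite /q divr_ge0 ?ltW //= ltr_pdivrMr // mul1r.
have aW j : normc (a j) * W ^+ j <= M * q ^+ j.
  rewrite /q expr_div_n mulrA ler_pdivlMr ?exprn_gt0 // mulrAC.
  by rewrite ler_wpM2r // exprn_ge0 // ltW.
have dW j : normc ((j.+1%:R * a j.+1) * w ^+ j) <= M / rho * q * q ^+ j.
  rewrite !Normc.normcM normcX.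
  have -> : normc (j.+1%:R : R[i]) = j.+1%:R.
    by rewrite -(rmorph_nat (real_complex R)) normc_real normr_nat.
  have -> : M / rho * q * q ^+ j = M * q ^+ j.+1 / rho by rewrite exprS; ring.
  rewrite ler_pdivlMr //.
  apply: le_trans (aW j.+1).
  have -> : j.+1%:R * normc (a j.+1) * normc w ^+ j * rho = normc (a j.+1) * (j.+1%:R * normc w ^+ j * rho) by ring.
  by rewrite ler_wpM2l //; exact: natr_expr_le.
have [d dl] := geometric_majorant_cvg q01 dW.
exists d => // e e0.
pose C := M / (rho ^+ 2 * (1 - q)).
have q1 : 0 < 1 - q by case/andP: q01 => _ q1; rewrite subr_gt0.
have C0 : 0 <= C by rewrite /C divr_ge0 // mulr_ge0 ?sqr_ge0 // ltW.
exists (Num.min rho (e / (C + 1))).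
  by rewrite lt_min rho0 /= divr_gt0 // ltr_wpDl.
move=> h; rewrite lt_min => /andP[hrho hC].
suff H : normc (f (z + h) - f z - d * h) <= C * normc h ^+ 2.
  apply: le_trans H _; rewrite expr2 mulrA ler_wpM2r //.
  move: hC; rewrite ltr_pdivlMr ?ltr_wpDl // mulrDr mulr1 mulrC => hC.
  by have := normc_ge0 h; lra.
have zw : z = z0 + w by rewrite /w addrC subrK.
have hz1 : normc (z + h - z0) < r.
  rewrite (_ : z + h - z0 = w + h); last by rewrite zw; ring.
  by apply: le_lt_trans (normcD _ _) _; move: hrho; rewrite /rho; lra.
have L1 := fa _ hz1; have L2 := fa _ wr.
have L3 : (fun n => \sum_(j < n) (j.+1%:R * a j.+1) * w ^+ j * h : R[i]^o) @ \oo --> (d * h : R[i]^o).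
  have -> : (fun n => \sum_(j < n) (j.+1%:R * a j.+1) * w ^+ j * h : R[i]^o) =
    (fun n => (\sum_(j < n) (j.+1%:R * a j.+1) * w ^+ j) * h).
    by apply/funext => n; rewrite mulr_suml.
  exact: cvgC_mulr dl.
apply: (cvgC_le (cvgC_sub (cvgC_sub (cvgC_shiftS L1) (cvgC_shiftS L2)) L3)); near=> n => /=.
rewrite (_ : _ - _ = \sum_(j < n.+1) a j * ((w + h) ^+ j - w ^+ j - j%:R * w ^+ j.-1 * h)); last first.
  rewrite (_ : z + h - z0 = w + h); last by rewrite zw; ring.
  have -> : \sum_(j < n) (j.+1%:R * a j.+1) * w ^+ j * h =
     \sum_(j < n.+1) a j * (j%:R * w ^+ j.-1 * h).
    rewrite [RHS]big_ord_recl /= mul0r mul0r mulr0 add0r.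
    by apply: eq_bigr => j _; rewrite /bump /=; ring.
  rewrite -/w -!sumrB; apply: eq_bigr => j _; ring.
apply: le_trans (normc_sum _ _ _) _.
apply: (@le_trans _ _ (\sum_(j < n.+1) (normc h / rho) ^+ 2 * (M * q ^+ j))).
  apply: ler_sum => j _; rewrite Normc.normcM.
  have := monomial_taylor w j rho0 (ltW hrho).
  set D := _ - _ - _ => H.
  apply: le_trans (ler_wpM2l (normc_ge0 _) H) _.
  rewrite mulrCA ler_wpM2l ?sqr_ge0 //; apply: le_trans (aW j).
  rewrite ler_wpM2l // -/W -addrA gerDl -opprD oppr_le0 addr_ge0 ?exprn_ge0 //.
  apply: mulr_ge0; last exact: ltW.
  by apply: mulr_ge0 => //; exact: exprn_ge0.
rewrite -mulr_sumr -mulr_sumr.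
apply: (@le_trans _ _ ((normc h / rho) ^+ 2 * (M * (1 - q)^-1))).
  by rewrite ler_wpM2l ?sqr_ge0 // ler_wpM2l // geometric_sum_le.
rewrite /C le_eqVlt; apply/orP; left; apply/eqP.
by field; rewrite !gt_eqF.
Unshelve. all: by end_near.
Qed.

Lemma cderiv_derive1 (f : R[i] -> R[i]) z d : cderiv f z d ->
  derive1 (f : R[i]^o -> R[i]^o) z = d.
Proof.
move=> fd; rewrite /derive1; apply: cvg_lim; first exact: norm_hausdorff.
apply/cvgC_normcP => e e0.
have [dl dl0 H] := fd (e / 2) ltac:(by rewrite divr_gt0).
have : (0 : R[i]) < dl%:C by rewrite ltcR.
move=> dl0'; near=> h.
have h0 : h != 0 by near: h; exact: nbhs_dnbhs_neq.
have hd : normc h < dl.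
  rewrite -ltcR -[X in X < _]normr_normc; near: h.
  apply: dnbhs0_lt => //.
have h0' : 0 < normc h by exact: normc_gt0.
have := H _ hd; rewrite -ler_pdivrMr // => H'.
apply: (@le_lt_trans _ _ (e / 2)); last by lra.
apply: le_trans H'; rewrite ler_pdivlMr // -Normc.normcM.
rewrite (_ : _ * h = f (z + h) - f z - d * h) //.
rewrite /GRing.scale /= (addrC h z) mulrBl mulrAC mulVf // mul1r //.
Unshelve. all: by end_near.
Qed.

Lemma power_series_derive1 (f : R[i]^o -> R[i]^o) z0 r a : power_series_on f z0 r a ->
  power_series_on (derive1 f) z0 r (fun j => j.+1%:R * a j.+1).
Proof.
move=> fa z zr; have [d dl fd] := power_series_cderiv fa zr.
by rewrite (cderiv_derive1 fd).
Qed.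

Lemma power_series_derive1n (f : R[i]^o -> R[i]^o) z0 r a n : power_series_on f z0 r a ->
  power_series_on (derive1n n f) z0 r (fun j => ((j + n) ^_ n)%:R * a (j + n)%N).
Proof.
move=> fa; elim: n => [|n ih].
  rewrite (_ : (fun j => _) = a) //; apply/funext => j.
  by rewrite addn0 ffactn0 mul1r.
rewrite derive1nS; have := power_series_derive1 ih.
congr power_series_on; apply/funext => j.
rewrite mulrA -natrM addSnnS; congr (_%:R * _).
by rewrite ffactnSr mulnC; congr (_ * _)%N; rewrite -addSnnS addnK.
Qed.

Lemma power_series_center f z0 r a : 0 < r -> power_series_on f z0 r a -> f z0 = a 0%N.
Proof.
move=> r0 fa; have /fa : normc (z0 - z0) < r by rewrite subrr Normc.normc0.
move=> /cvgC_shiftS h; apply: (cvgC_unique h).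
rewrite (_ : (fun n => _) = (fun=> a 0%N)); first exact: cvg_cst.
apply/funext => n; rewrite subrr big_ord_recl expr0 mulr1 big1 ?addr0 // => j _.
by rewrite exprS mul0r mulr0.
Qed.

Lemma analytic_derive1n (f : R[i]^o -> R[i]^o) z0 n :
  analytic_at f z0 -> analytic_at (derive1n n f) z0.
Proof.
move=> [a [r [r0 fa]]]; exists (fun j => ((j + n) ^_ n)%:R * a (j + n)%N), r.
by split; [exact: r0|exact: power_series_derive1n fa].
Qed.

Lemma analytic_cderiv (f : R[i]^o -> R[i]^o) z0 :
  analytic_at f z0 -> cderiv f z0 (derive1 f z0).
Proof.
move=> [a [r [r0 fa]]].
have z0r : normc (z0 - z0) < r by rewrite subrr Normc.normc0.
have [d _ fd] := power_series_cderiv fa z0r.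
by rewrite (cderiv_derive1 fd).
Qed.

End PowerSeries.

(** * Area measure, iterated integrals *)

Section AreaMeasure.
Variable R : realType.

Let lebesgue2 : {measure set (measurableTypeR R * measurableTypeR R) -> \bar R} :=
  ((@lebesgue_measure R \x @lebesgue_measure R)%E).
Lemma area_set0 : area R set0 = 0%E.
Proof. exact: (measure0 lebesgue2). Qed.
Lemma area_ge0 A : (0 <= area R A)%E.
Proof. exact: (measure_ge0 lebesgue2). Qed.
Lemma area_sigma_additive : semi_sigma_additive (area R).
Proof. exact: (@measure_semi_sigma_additive _ _ _ lebesgue2). Qed.
HB.instance Definition _ := isMeasure.Build _ _ _ (area R)
  area_set0 area_ge0 area_sigma_additive.
Lemma area_box (a b c d : R) : a <= b -> c <= d ->
  area R (`[a, b] `*` `[c, d]) = ((b - a) * (d - c))%:E.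
Proof.
move=> ab cd; rewrite /area product_measure1E; [|exact: measurable_itv..].
have h (x y : R) : x <= y -> @lebesgue_measure R `[x, y]%classic = (y - x)%:E.
  move=> xy; rewrite lebesgue_measure_itv /= lte_fin.
  by move: xy; rewrite le_eqVlt => /orP[/eqP ->|->//]; rewrite ltxx subrr.
by rewrite EFinM; congr (_ * _)%E; exact: h.
Qed.
Lemma area_sigma_finite : sigma_finite setT (area R).
Proof.
exists (fun n : nat => (`[- n%:R, n%:R] `*` `[- n%:R, n%:R])%classic).
  apply/seteqP; split => // -[x y] _.
  pose n := Num.truncn (Num.max `|x| `|y|).
  have hn := truncnS_gt (Num.max `|x| `|y|).
  exists n.+1 => //; split => /=; rewrite in_itv /= -ler_norml ltW //.
    by apply: le_lt_trans hn; rewrite le_max lexx.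
  by apply: le_lt_trans hn; rewrite le_max lexx orbT.
move=> n; split; first by apply: measurableX; exact: measurable_itv.
by rewrite area_box ?ltry // ge0_cp.
Qed.
HB.instance Definition _ := Measure_isSigmaFinite.Build _ _ _ (area R) area_sigma_finite.

Lemma rational_box_between (U : set (R * R)) p : open U -> U p ->
  exists q : rat * rat * (rat * rat),
    let B := `]ratr q.1.1, ratr q.1.2[%classic `*` `]ratr q.2.1, ratr q.2.2[%classic in
    B p /\ B `<=` U.
Proof.
move=> oU Up; have /nbhs_ballP[e /= e0 eU] := open_nbhs_nbhs (conj oU Up).
case: p Up eU => x y Up eU.
have [|q1 h1] := @rat_in_itvoo R (x - e) x; first by rewrite gtrBl.
have [|q2 h2] := @rat_in_itvoo R x (x + e); first by rewrite ltrDl.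
have [|q3 h3] := @rat_in_itvoo R (y - e) y; first by rewrite gtrBl.
have [|q4 h4] := @rat_in_itvoo R y (y + e); first by rewrite ltrDl.
move: h1 h2 h3 h4; rewrite !in_itv /= => /andP[a1 a2] /andP[b1 b2] /andP[c1 c2] /andP[d1 d2].
exists ((q1, q2), (q3, q4)) => /=; split.
  by split; rewrite /= in_itv /= ?a2 ?b1 ?c2 ?d1.
move=> [u v] [/=]; rewrite !in_itv /= => /andP[u1 u2] /andP[v1 v2].
apply: eU; split; rewrite /ball /= ltr_distlC; apply/andP; split; lra.
Qed.

(** The rational boxes contained in an open set cover it, and there are
    countably many of them. *)
Lemma open_measurable_plane (U : set (R * R)) : open U -> measurable U.
Proof.
move=> oU.
pose B (q : rat * rat * (rat * rat)) : set (R * R) :=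
  `]ratr q.1.1, ratr q.1.2[%classic `*` `]ratr q.2.1, ratr q.2.2[%classic.
have -> : U = \bigcup_q (if `[< B q `<=` U >] then B q else set0).
  apply/seteqP; split => [p Up|p [q _]].
    by have [q [Bp BU]] := rational_box_between oU Up; exists q => //; rewrite asboolT.
  by case: ifPn => // /asboolP BU Bp; exact: BU.
apply: countable_bigcupT_measurable => // q; case: ifP => // _.
by apply: measurableX; exact: measurable_itv.
Qed.

Lemma open_continuous_measurable_plane (D : set (R * R)) (f : R * R -> R) :
  open D -> {in D, continuous f} -> measurable_fun D f.
Proof.
move=> oD; rewrite -(continuous_open_subspace f oD) => /continuousP cf.
apply: (measurability _ (RGenOpens.measurableE R)).
move=> _ [_ [a [b ->] <-]].
have /open_subspaceP [V oV VD] := cf _ (@interval_open R (BRight a) (BLeft b) isT isT).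
by rewrite setIC -VD; apply: measurableI; apply: open_measurable_plane.
Qed.

Lemma continuous_measurable_plane (f : R * R -> R) :
  continuous f -> measurable_fun setT f.
Proof.
by move=> cf; apply: open_continuous_measurable_plane => //; exact: openT.
Qed.


Definition box (M : R) : set (R * R) := `[- M, M] `*` `[- M, M].

Lemma measurable_box M : measurable (box M).
Proof. by apply: measurableX; exact: measurable_itv. Qed.

Lemma area_box_lty M : (area R (box M) < +oo)%E.
Proof.
case: (leP 0 M) => M0.
  have MM : - M <= M by rewrite ge0_cp.
  by rewrite /box area_box // ltry.
rewrite (_ : box M = set0) ?measure0 ?ltry //.
apply/seteqP; split => // -[x y] [/=]; rewrite in_itv /= => /andP[h1 h2]; lra.
Qed.

Lemma boxP M (p : R * R) : box M p <-> `|p.1| <= M /\ `|p.2| <= M.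
Proof. by rewrite /box /setX /= !in_itv /= -!ler_norml; split=> -[]. Qed.

Lemma bounded_supp_integrable (f : R * R -> R) (M B : R) :
  measurable_fun setT f -> (forall p, `|f p| <= B) ->
  (forall p, ~ box M p -> f p = 0) ->
  (area R).-integrable setT (EFin \o f).
Proof.
move=> mf fB f0; have mb := measurable_box M.
rewrite (_ : EFin \o f = (EFin \o f) \_ (box M)).
  apply/(integrable_mkcond _ _).1 => //.
  apply: measurable_bounded_integrable => //.
  - exact: area_box_lty.
  - exact: measurable_funTS.
  - exists B; split; first by rewrite num_real.
    move=> x Bx p _; exact: le_trans (fB p) (ltW Bx).
apply/funext => p; rewrite patchE; case: ifPn => //.
by rewrite notin_setE /= => /f0 ->.
Qed.

Lemma bounded_supp_integrable2 (f : R * R -> R) (M B : R) :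
  measurable_fun setT f -> (forall p, `|f p| <= B) ->
  (forall p, ~ box M p -> f p = 0) ->
  lebesgue2.-integrable setT (EFin \o f).
Proof.
move=> mf fB f0; have mb := measurable_box M.
rewrite (_ : EFin \o f = (EFin \o f) \_ (box M)).
  apply/(integrable_mkcond _ _).1 => //.
  apply: measurable_bounded_integrable => //.
  - exact: area_box_lty.
  - by apply: measurable_funTS; exact: mf.
  - exists B; split; first by rewrite num_real.
    move=> x Bx p _; exact: le_trans (fB p) (ltW Bx).
apply/funext => p; rewrite patchE; case: ifPn => //.
by rewrite notin_setE /= => /f0 ->.
Qed.

(** The Lebesgue measure lives on a copy of R with its own measurable
    structure; Fubini's theorem holds for the product of the copies and is
    transported along the identity. *)
Lemma integral_area_lebesgue2 (f : R * R -> R) : measurable_fun setT f ->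
  lebesgue2.-integrable setT (EFin \o f) ->
  (\int[area R]_p (f p)%:E = \int[lebesgue2]_p (f p)%:E)%E.
Proof.
move=> mf intf.
pose phi (p : measurableTypeR R * measurableTypeR R) : R * R := p.
have mphi : measurable_fun setT phi by move=> _ A mA; rewrite setTI.
have mf' := (measurable_EFinP _ _).2 mf.
exact: (@integral_pushforward _ _ _ _ _ phi mphi lebesgue2 setT _ mf' intf measurableT).
Qed.

(** The fundamental theorem of calculus on an interval at whose ends u
    vanishes. *)
Lemma integral_derivative_compact_supp (u u' : R -> R) (M : R) :
  (forall x : R, is_derive x (1 : R) u (u' x)) -> continuous u' ->
  (forall x, M <= `|x| -> u x = 0 /\ u' x = 0) ->
  (\int[@lebesgue_measure R]_x (u' x)%:E = 0)%E.
Proof.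
move=> du cu u0.
pose N : R := `|M| + 1; have N0 : - N < N by rewrite /N; have := normr_ge0 M; lra.
have MN : M <= `|N| by apply: le_trans (ler_norm N); apply: le_trans (ler_norm M) _; rewrite /N lerDl.
have MN' : M <= `|- N| by rewrite normrN.
have -> : (fun x => (u' x)%:E) = (fun x => (u' x)%:E) \_ `[- N, N].
  apply/funext => x; rewrite patchE; case: ifPn => //.
  rewrite notin_setE /= in_itv /= => /negP; rewrite -ler_norml -ltNge => h.
  rewrite (u0 x _).2 //; apply: le_trans (ltW h).
  by apply: le_trans (ler_norm M) _; rewrite /N lerDl.
rewrite -integral_mkcond.
rewrite (@continuous_FTC2 _ u' u) //.
- by rewrite (u0 _ MN).1 (u0 _ MN').1 sube0.
- exact: continuous_subspaceT.
- have cu0 : continuous u.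
    by move=> x; apply/differentiable_continuous/derivable1_diffP; case: (du x).
  split; first by move=> x _; case: (du x).
  + by apply: cvg_at_right_filter; exact: cu0.
  + by apply: cvg_at_left_filter; exact: cu0.
- by move=> x _; rewrite derive1E; exact: derive_val.
Qed.

Definition compactly_supported (f : R * R -> R) :=
  exists M, forall p, ~ box M p -> f p = 0.

Lemma continuous_supp_bounded (f : R * R -> R) M : continuous f ->
  (forall p, ~ box M p -> f p = 0) -> exists B, forall p, `|f p| <= B.
Proof.
move=> cf f0.
have cK : compact (box M) by apply: compact_setX; exact: segment_compact.
have : bounded_set (f @` box M).
  by apply: compact_bounded; apply: continuous_compact => //; exact: continuous_subspaceT.
move=> [N [_ /(_ (N + 1)) H]]; exists (`|N| + 1) => p.
case: (pselect (box M p)) => bp; last by rewrite f0 // normr0 addr_ge0.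
have /= := H _ (f p) _; rewrite ltrDl ltr01 => h.
apply: (le_trans (h isT _)); first by exists p.
by rewrite lerD2r ler_norm.
Qed.

Lemma pair_continuous_l (y : R) : continuous (fun t : R => (t, y)).
Proof. move=> x; exact: (cvg_pair (@cvg_id _ (nbhs x)) (@cvg_cst _ y _ (nbhs x) _)). Qed.

Lemma pair_continuous_r (x : R) : continuous (fun t : R => (x, t)).
Proof. move=> y; exact: (cvg_pair (@cvg_cst _ x _ (nbhs y) _) (@cvg_id _ (nbhs y))). Qed.

(** Fubini's theorem, and the one-dimensional statement on horizontal lines. *)
Lemma integral_dx_compact_supp (U U' : R * R -> R) :
  (forall x y : R, is_derive x (1 : R) (fun t => U (t, y)) (U' (x, y))) -> continuous U' ->
  compactly_supported U -> compactly_supported U' ->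
  (\int[area R]_p (U' p)%:E = 0)%E.
Proof.
move=> dU cU [M1 U0] [M2 U0'].
have [B U'B] := continuous_supp_bounded cU U0'.
have mU := continuous_measurable_plane cU.
transitivity (\int[@lebesgue_measure R]_y \int[@lebesgue_measure R]_x (U' (x, y))%:E)%E.
  rewrite integral_area_lebesgue2 //; last exact: bounded_supp_integrable2 mU U'B U0'.
  symmetry; apply: (@integral21_prod_meas1 _ _ _ _ _ (@lebesgue_measure R) (@lebesgue_measure R)).
  exact: bounded_supp_integrable2 mU U'B U0'.
rewrite (eq_integral (fun=> 0%E)) ?integral0 // => y _.
apply: (@integral_derivative_compact_supp (fun t => U (t, y)) (fun t => U' (t, y)) (`|M1| + `|M2| + 1)) => //.
- move=> x; exact: (continuous_comp (@pair_continuous_l y x) (cU _)).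
- move=> x Mx; have h0 := ler_norm M1; have h1 := ler_norm M2.
  have h2 := normr_ge0 M1; have h3 := normr_ge0 M2.
  by split; [apply: U0|apply: U0'] => /boxP[/= h _]; lra.
Qed.

Lemma integral_dy_compact_supp (U U' : R * R -> R) :
  (forall x y : R, is_derive y (1 : R) (fun t => U (x, t)) (U' (x, y))) -> continuous U' ->
  compactly_supported U -> compactly_supported U' ->
  (\int[area R]_p (U' p)%:E = 0)%E.
Proof.
move=> dU cU [M1 U0] [M2 U0'].
have [B U'B] := continuous_supp_bounded cU U0'.
have mU := continuous_measurable_plane cU.
transitivity (\int[@lebesgue_measure R]_x \int[@lebesgue_measure R]_y (U' (x, y))%:E)%E.
  rewrite integral_area_lebesgue2 //; last exact: bounded_supp_integrable2 mU U'B U0'.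
  symmetry; apply: (@integral12_prod_meas1 _ _ _ _ _ (@lebesgue_measure R) (@lebesgue_measure R)).
  exact: bounded_supp_integrable2 mU U'B U0'.
rewrite (eq_integral (fun=> 0%E)) ?integral0 // => x _.
apply: (@integral_derivative_compact_supp (fun t => U (x, t)) (fun t => U' (x, t)) (`|M1| + `|M2| + 1)) => //.
- move=> y; exact: (continuous_comp (@pair_continuous_r x y) (cU _)).
- move=> y Mx; have h0 := ler_norm M1; have h1 := ler_norm M2.
  have h2 := normr_ge0 M1; have h3 := normr_ge0 M2.
  by split; [apply: U0|apply: U0'] => /boxP[/= _ h]; lra.
Qed.

End AreaMeasure.

(** * Integrals of complex-valued functions *)

Section ComplexIntegral.
Context d (T : measurableType d) (R : realType).
Variables (mu : {measure set T -> \bar R}) (D : set T).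
Hypothesis mD : measurable D.
Implicit Types (f g h : T -> R[i]) (c : R[i]).

Definition cintegral h : R[i] :=
  (\int[mu]_(x in D) Re (h x)) +i* (\int[mu]_(x in D) Im (h x)).

Definition cintegrable h : Prop :=
  mu.-integrable D (fun x => (Re (h x))%:E) /\
  mu.-integrable D (fun x => (Im (h x))%:E).

Definition cmeasurable h : Prop :=
  measurable_fun D (fun x => Re (h x)) /\ measurable_fun D (fun x => Im (h x)).

Lemma cmeasurable_normc h : cmeasurable h -> measurable_fun D (fun x => normc (h x)).
Proof.
move=> [h1 h2].
rewrite (_ : (fun x => _) = (fun x => Num.sqrt (Re (h x) ^+ 2 + Im (h x) ^+ 2))); last first.
  by apply/funext => x; case: (h x).
apply: (measurableT_comp (@continuous_measurable_fun R _ (@sqrt_continuous R))).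
by apply: measurable_funD; apply: measurable_funX.
Qed.

Lemma cmeasurableM f g : cmeasurable f -> cmeasurable g ->
  cmeasurable (fun x => f x * g x).
Proof.
move=> [f1 f2] [g1 g2]; split.
- under eq_fun do rewrite ReM.
  by apply: measurable_funB; apply: measurable_funM.
- under eq_fun do rewrite ImM.
  by apply: measurable_funD; apply: measurable_funM.
Qed.

Lemma cmeasurableD f g : cmeasurable f -> cmeasurable g ->
  cmeasurable (fun x => f x + g x).
Proof.
move=> [f1 f2] [g1 g2]; split.
- by under eq_fun do rewrite ReD; exact: measurable_funD.
- by under eq_fun do rewrite ImD; exact: measurable_funD.
Qed.

Lemma cmeasurable_cst c : cmeasurable (fun=> c).
Proof. by split; exact: measurable_cst. Qed.

Lemma cmeasurableB f g : cmeasurable f -> cmeasurable g ->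
  cmeasurable (fun x => f x - g x).
Proof.
move=> [f1 f2] [g1 g2]; split.
- by under eq_fun do rewrite ReB; exact: measurable_funB.
- by under eq_fun do rewrite ImB; exact: measurable_funB.
Qed.

Lemma cmeasurable_conj f : cmeasurable f -> cmeasurable (fun x => (f x)^*).
Proof.
move=> [f1 f2]; split.
- by under eq_fun do rewrite Re_conj.
- by under eq_fun do rewrite Im_conj; exact: measurable_funN.
Qed.

Lemma cintegrable_measurable h : cintegrable h -> cmeasurable h.
Proof.
by move=> [h1 h2]; split; apply/measurable_EFinP; [move: h1|move: h2] => /measurable_int.
Qed.

Lemma cintegrable_normc h : cintegrable h -> mu.-integrable D (fun x => (normc (h x))%:E).
Proof.
move=> ih; have mh := cmeasurable_normc (cintegrable_measurable ih).
case: ih => h1 h2.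
apply: (le_integrable mD _ _ (integrableD mD (integrable_abse h1) (integrable_abse h2))).
  exact/measurable_EFinP.
move=> x Dx /=; rewrite lee_fin ger0_norm //.
exact: le_trans (normc_le_ReIm _) (ler_norm _).
Qed.

Lemma cintegrable_dominated h (g : T -> R) : cmeasurable h ->
  mu.-integrable D (EFin \o g) -> (forall x, D x -> normc (h x) <= g x) -> cintegrable h.
Proof.
move=> [h1 h2] ig hg; split; apply: le_integrable ig => //.
- exact/measurable_EFinP.
- move=> x Dx /=; rewrite lee_fin; apply: le_trans (Re_le_normc _) _.
  by apply: le_trans (hg _ Dx) (ler_norm _).
- exact/measurable_EFinP.
- move=> x Dx /=; rewrite lee_fin; apply: le_trans (Im_le_normc _) _.
  by apply: le_trans (hg _ Dx) (ler_norm _).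
Qed.

Lemma cintegrableD f g : cintegrable f -> cintegrable g ->
  cintegrable (fun x => f x + g x).
Proof.
move=> [f1 f2] [g1 g2]; split.
- by under eq_fun do rewrite ReD EFinD; exact: integrableD.
- by under eq_fun do rewrite ImD EFinD; exact: integrableD.
Qed.

Lemma cintegrableZ c f : cintegrable f -> cintegrable (fun x => c * f x).
Proof.
move=> [f1 f2]; split.
- under eq_fun do rewrite ReM EFinB !EFinM.
  by apply: integrableB => //; exact: integrableZl.
- under eq_fun do rewrite ImM EFinD !EFinM.
  by apply: integrableD => //; exact: integrableZl.
Qed.

Lemma cintegralD f g : cintegrable f -> cintegrable g ->
  cintegral (fun x => f x + g x) = cintegral f + cintegral g.
Proof.
move=> [f1 f2] [g1 g2]; rewrite /cintegral; apply: complex_eqP => /=.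
- under eq_Rintegral do rewrite ReD; rewrite RintegralD //.
- under eq_Rintegral do rewrite ImD; rewrite RintegralD //.
Qed.

Lemma cintegralZ c f : cintegrable f ->
  cintegral (fun x => c * f x) = c * cintegral f.
Proof.
move=> [f1 f2]; rewrite /cintegral.
have Z (a : R) (k : T -> R) : mu.-integrable D (EFin \o k) ->
  mu.-integrable D (EFin \o (fun x => a * k x)) by move=> ik; exact: (integrableZl mD a ik).
apply: complex_eqP; rewrite ?ReM ?ImM /=.
- under eq_Rintegral do rewrite ReM; rewrite RintegralB //; [|exact: Z..].
  by rewrite !RintegralZl.
- under eq_Rintegral do rewrite ImM; rewrite RintegralD //; [|exact: Z..].
  by rewrite !RintegralZl.
Qed.

Lemma cintegrableN f : cintegrable f -> cintegrable (fun x => - f x).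
Proof. by move=> h; under eq_fun do rewrite -mulN1r; exact: cintegrableZ. Qed.

Lemma cintegralB f g : cintegrable f -> cintegrable g ->
  cintegral (fun x => f x - g x) = cintegral f - cintegral g.
Proof.
move=> h1 h2; rewrite cintegralD //; last exact: cintegrableN.
congr (_ + _); rewrite -mulN1r -cintegralZ //; congr cintegral.
by apply/funext => x; rewrite mulN1r.
Qed.

Lemma cintegrable_sum (F : nat -> T -> R[i]) n : (forall i, cintegrable (F i)) ->
  cintegrable (fun x => \sum_(i < n) F i x).
Proof.
move=> iF; elim: n => [|n ih].
  under eq_fun do rewrite big_ord0.
  by split; exact: integrable0.
by under eq_fun do rewrite big_ord_recr /=; exact: cintegrableD.
Qed.

Lemma cintegral_sum (F : nat -> T -> R[i]) n : (forall i, cintegrable (F i)) ->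
  cintegral (fun x => \sum_(i < n) F i x) = \sum_(i < n) cintegral (F i).
Proof.
move=> iF; elim: n => [|n ih].
  rewrite big_ord0; under [X in cintegral X]eq_fun do rewrite big_ord0.
  rewrite /cintegral /= /Rintegral !integral0 //.
under [X in cintegral X]eq_fun do rewrite big_ord_recr /=.
by rewrite cintegralD ?ih ?big_ord_recr //; exact: cintegrable_sum.
Qed.

Lemma cintegral_conj f : cintegrable f ->
  cintegral (fun x => (f x)^*) = (cintegral f)^*.
Proof.
move=> [f1 f2]; apply: complex_eqP; rewrite ?Re_conj ?Im_conj /=.
- by under eq_Rintegral do rewrite Re_conj.
- under eq_Rintegral do rewrite Im_conj -mulN1r.
  by rewrite RintegralZl // mulN1r.
Qed.

(** Rotate the integral onto the positive real axis by a unimodular constant,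
    then compare real parts. *)
Lemma normc_cintegral_le h : cintegrable h ->
  normc (cintegral h) <= \int[mu]_(x in D) normc (h x).
Proof.
move=> ih; have [->|I0] := eqVneq (cintegral h) 0.
  by rewrite Normc.normc0; apply: Rintegral_ge0 => x _; exact: normc_ge0.
have nI := normc_gt0 I0.
pose c := (cintegral h)^* / (normc (cintegral h))%:C.
have cI : c * cintegral h = (normc (cintegral h))%:C.
  rewrite /c mulrAC [_ * cintegral h]mulrC mulc_conj expr2 rmorphM mulfK //.
  by rewrite -(rmorph0 (real_complex R)) (inj_eq (@complexI R)) gt_eqF.
have nc : normc c = 1.
  rewrite /c Normc.normcM Normc.normcV normc_conj normc_real ger0_norm // divff //.
  by rewrite gt_eqF.
have <- : Re (c * cintegral h) = normc (cintegral h) by rewrite cI.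
rewrite -cintegralZ //=; apply: le_Rintegral => //.
- by case: (cintegrableZ c ih).
- exact: cintegrable_normc.
- move=> x _; rewrite -[leRHS]mul1r -nc -Normc.normcM.
  exact: le_trans (ler_norm _) (Re_le_normc _).
Qed.

Lemma eq_cintegral f g : (forall x, D x -> f x = g x) -> cintegral f = cintegral g.
Proof.
move=> fg; rewrite /cintegral; congr (_ +i* _); apply: eq_Rintegral => x;
  by rewrite inE => /fg ->.
Qed.

Lemma cmeasurable_cvg (u : nat -> T -> R[i]) h : (forall n, cmeasurable (u n)) ->
  (forall x, D x -> (fun n => u n x : R[i]^o) @ \oo --> (h x : R[i]^o)) -> cmeasurable h.
Proof.
move=> mu_ uh; split.
- apply: (@measurable_fun_cvg _ _ _ D (fun n x => Re (u n x))) => //.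
    by move=> n; case: (mu_ n).
  by move=> x Dx; apply: cvgC_ReP; exact: uh.
- apply: (@measurable_fun_cvg _ _ _ D (fun n x => Im (u n x))) => //.
    by move=> n; case: (mu_ n).
  by move=> x Dx; apply: cvgC_ImP; exact: uh.
Qed.

Lemma cintegral_dominated_cvg (u : nat -> T -> R[i]) h (g : T -> R) :
  (forall n, cmeasurable (u n)) -> mu.-integrable D (EFin \o g) ->
  (forall n x, D x -> normc (u n x) <= g x) ->
  (forall x, D x -> (fun n => u n x : R[i]^o) @ \oo --> (h x : R[i]^o)) ->
  (fun n => cintegral (u n) : R[i]^o) @ \oo --> (cintegral h : R[i]^o).
Proof.
move=> mu_ ig ug uh.
have ih : cintegrable h.
  apply: cintegrable_dominated ig _; first exact: cmeasurable_cvg mu_ uh.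
  move=> x Dx; apply: (cvgC_le (uh x Dx)); apply: nearW => n; exact: ug.
apply: cvgC_ReIm => /=.
- apply: fine_cvg; rewrite fineK; last by apply: integrable_fin_num => //; case: ih.
  apply: (@dominated_cvg _ _ _ mu D mD _ _ (EFin \o g)) => //.
  + by move=> n; apply/measurable_EFinP; case: (mu_ n).
  + move=> x Dx; apply: cvg_EFin; first by apply: nearW.
    by apply: cvgC_ReP; exact: uh.
  + by move=> n x Dx; rewrite lee_fin; exact: le_trans (Re_le_normc _) (ug _ _ Dx).
- apply: fine_cvg; rewrite fineK; last by apply: integrable_fin_num => //; case: ih.
  apply: (@dominated_cvg _ _ _ mu D mD _ _ (EFin \o g)) => //.
  + by move=> n; apply/measurable_EFinP; case: (mu_ n).
  + move=> x Dx; apply: cvg_EFin; first by apply: nearW.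
    by apply: cvgC_ImP; exact: uh.
  + by move=> n x Dx; rewrite lee_fin; exact: le_trans (Im_le_normc _) (ug _ _ Dx).
Qed.

End ComplexIntegral.

(** * Partial derivatives of holomorphic functions *)

Section ComplexDerivative.
Variable R : realType.
Implicit Types (f g q : R[i] -> R[i]) (z w h d : R[i]).

Lemma is_derive_eps (g : R -> R) (x c : R) :
  (forall e : R, 0 < e -> exists2 dl : R, 0 < dl &
     forall h : R, `|h| < dl -> `|g (x + h) - g x - c * h| <= e * `|h|) ->
  is_derive x (1 : R) g c.
Proof.
move=> H.
have L : (fun h : R => h^-1 *: ((g \o shift x) (h *: (1 : R)) - g x)) @ 0^' --> c.
  apply/cvgrPdist_le => e e0; have [dl dl0 Hd] := H e e0.
  near=> h.
  have h0 : h != 0 by near: h; exact: nbhs_dnbhs_neq.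
  have hd : `|h| < dl by near: h; apply: dnbhs0_lt.
  have := Hd h hd; rewrite -ler_pdivrMr ?normr_gt0 // -normf_div.
  rewrite distrC /= /GRing.scale /= mulr1 [h + x]addrC.
  by rewrite [_ / h]mulrBl mulfK // mulrC.
apply: DeriveDef; first by apply/cvg_ex; exists c.
by apply: cvg_lim L; exact: Rhausdorff.
Unshelve. all: by end_near.
Qed.

Definition ccont g z := forall e : R, 0 < e ->
  exists2 dl : R, 0 < dl & forall h, normc h < dl -> normc (g (z + h) - g z) < e.

Lemma cderiv_ccont f z d : cderiv f z d -> ccont f z.
Proof.
move=> fd e e0; have [dl dl0 H] := fd 1 ltr01.
have D0 : 0 < 1 + normc d by rewrite ltr_wpDr.
exists (Num.min dl (e / (1 + normc d))).
  by rewrite lt_min dl0 divr_gt0.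
move=> h; rewrite lt_min => /andP[/H h1]; rewrite ltr_pdivlMr // => h2.
rewrite -[f (z + h) - f z](subrK (d * h)).
apply: le_lt_trans (normcD _ _) _; apply: le_lt_trans h2.
rewrite mulrDr mulr1 Normc.normcM [normc d * _]mulrC; rewrite mul1r in h1.
by rewrite lerD2r.
Qed.

Lemma cplx_normc_le (p q : R * R) :
  normc (cplx p - cplx q) <= `|p.1 - q.1| + `|p.2 - q.2|.
Proof. by apply: le_trans (normc_le_ReIm _) _. Qed.

Lemma ccont_cvg g (p : R * R) : ccont g (cplx p) ->
  (fun p' : R * R => g (cplx p') : R[i]^o) @ p --> (g (cplx p) : R[i]^o).
Proof.
move=> gc; apply/cvgC_normcP => e /gc[dl dl0 H].
have d2 : 0 < dl / 2 by rewrite divr_gt0.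
exists (ball p.1 (dl / 2), ball p.2 (dl / 2)).
  by split; exact: nbhsx_ballx.
move=> p' [] /= b1 b2.
have := H ((cplx p' : R[i]) - cplx p); rewrite [X in g X](_ : _ = cplx p'); last first.
  by rewrite addrC subrK.
apply.
apply: le_lt_trans (cplx_normc_le _ _) _; rewrite (splitr dl).
by apply: ltrD; rewrite distrC.
Qed.

Lemma ccont_continuous_Re g (p : R * R) : ccont g (cplx p) ->
  {for p, continuous (fun p' : R * R => Re (g (cplx p')))}.
Proof. by move=> gc; apply: cvgC_ReP; exact: ccont_cvg. Qed.

Lemma ccont_continuous_Im g (p : R * R) : ccont g (cplx p) ->
  {for p, continuous (fun p' : R * R => Im (g (cplx p')))}.
Proof. by move=> gc; apply: cvgC_ImP; exact: ccont_cvg. Qed.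

Lemma cderiv_dx f (p : R * R) d : cderiv f (cplx p) d ->
  is_derive p.1 (1 : R) (fun t => Re (f (t +i* p.2))) (Re d) /\
  is_derive p.1 (1 : R) (fun t => Im (f (t +i* p.2))) (Im d).
Proof.
move=> fd; split; apply: is_derive_eps => e e0; have [dl dl0 H] := fd e e0;
  exists dl => // h hd; have := H h%:C; rewrite normc_real => /(_ hd).
- move=> {}H; apply: le_trans H.
  rewrite (_ : _ + h%:C = (p.1 + h) +i* p.2); last by apply: complex_eqP; rewrite ?ReD ?ImD //= addr0.
  by apply: le_trans _ (Re_le_normc _); rewrite !ReB ReM /= mulr0 subr0.
- move=> {}H; apply: le_trans H.
  rewrite (_ : _ + h%:C = (p.1 + h) +i* p.2); last by apply: complex_eqP; rewrite ?ReD ?ImD //= addr0.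
  by apply: le_trans _ (Im_le_normc _); rewrite !ImB ImM /= mulr0 add0r.
Qed.

Lemma cderiv_dy f (p : R * R) d : cderiv f (cplx p) d ->
  is_derive p.2 (1 : R) (fun t => Re (f (p.1 +i* t))) (- Im d) /\
  is_derive p.2 (1 : R) (fun t => Im (f (p.1 +i* t))) (Re d).
Proof.
move=> fd; split; apply: is_derive_eps => e e0; have [dl dl0 H] := fd e e0;
  exists dl => // h hd; have := H (h *i); rewrite normc_i => /(_ hd).
- move=> {}H; apply: le_trans H.
  rewrite (_ : _ + h *i = p.1 +i* (p.2 + h)); last by apply: complex_eqP; rewrite ?ReD ?ImD //= addr0.
  by apply: le_trans _ (Re_le_normc _); rewrite !ReB ReM /= mulr0 sub0r mulNr.
- move=> {}H; apply: le_trans H.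
  rewrite (_ : _ + h *i = p.1 +i* (p.2 + h)); last by apply: complex_eqP; rewrite ?ReD ?ImD //= addr0.
  by apply: le_trans _ (Im_le_normc _); rewrite !ImB ImM /= mulr0 addr0.
Qed.

Lemma cderivB f g z d e : cderiv f z d -> cderiv g z e ->
  cderiv (fun w => f w - g w) z (d - e).
Proof.
move=> fd ge x x0; have x2 : 0 < x / 2 by rewrite divr_gt0.
have [d1 d10 H1] := fd _ x2; have [d2 d20 H2] := ge _ x2.
exists (Num.min d1 d2); first by rewrite lt_min d10.
move=> h; rewrite lt_min => /andP[/H1 h1 /H2 h2].
rewrite (_ : _ - _ = (f (z + h) - f z - d * h) - (g (z + h) - g z - e * h)); last by ring.
by apply: le_trans (normcB _ _) _; rewrite (splitr x) mulrDl lerD.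
Qed.

Lemma cderiv_cst (c z : R[i]) : cderiv (fun=> c) z 0.
Proof.
move=> e e0; exists 1 => // h _; rewrite mul0r subrr subr0 Normc.normc0.
by rewrite mulr_ge0 // ltW.
Qed.

Lemma cderiv_quad f z d (rho C : R) : 0 < rho ->
  (forall h, normc h < rho -> normc (f (z + h) - f z - d * h) <= C * normc h ^+ 2) ->
  cderiv f z d.
Proof.
move=> rho0 H e e0; have C0 : 0 < `|C| + 1 by rewrite ltr_wpDl.
exists (Num.min rho (e / (`|C| + 1))); first by rewrite lt_min rho0 divr_gt0.
move=> h; rewrite lt_min => /andP[/H h1]; rewrite ltr_pdivlMr // => h2.
apply: le_trans h1 _; rewrite expr2 mulrA ler_wpM2r //.
have h0 := normc_ge0 h.
apply: le_trans (ler_wpM2r h0 (ler_norm C)) _; lra.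
Qed.

Lemma cderiv_monomial z0 z j :
  cderiv (fun w => (w - z0) ^+ j) z (j%:R * (z - z0) ^+ j.-1).
Proof.
apply: (@cderiv_quad _ _ _ 1 ((normc (z - z0) + 1) ^+ j)) => // h h1.
have := @monomial_taylor _ (z - z0) h 1 j ltr01 (ltW h1).
rewrite (_ : z - z0 + h = z + h - z0) => [H|]; last by ring.
apply: le_trans H _.
rewrite divr1 mulr1 mulrC ler_wpM2r ?exprn_ge0 //.
by rewrite -addrA gerDl -opprD oppr_le0 addr_ge0 ?mulr_ge0 ?exprn_ge0.
Qed.

Lemma cderiv_quotient f z w d : cderiv f w d -> w != z ->
  cderiv (fun u => f u / (u - z)) w ((d - f w / (w - z)) / (w - z)).
Proof.
move=> fd wz; set D := w - z; have D0 : D != 0 by rewrite subr_eq0.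
have nD : 0 < normc D by exact: normc_gt0.
move=> e e0.
have e1 : 0 < e * normc D / 4 by rewrite divr_gt0 // mulr_gt0.
have [dl dl0 H] := fd _ e1.
set K := normc (f w - d * D).
have K0 : 0 < K + 1 by rewrite ltr_wpDl // /K.
exists (Num.min dl (Num.min (normc D / 2) (e * normc D ^+ 3 / (4 * (K + 1))))).
  by rewrite !lt_min dl0 !divr_gt0 // !mulr_gt0 // exprn_gt0.
move=> h; rewrite !lt_min => /and3P[/H h1 h2]; rewrite ltr_pdivlMr ?mulr_gt0 // => h3.
have nDh : normc D / 2 <= normc (D + h).
  have := normcB (D + h) h; rewrite addrK; lra.
have nDh0 : 0 < normc (D + h) by apply: lt_le_trans nDh; rewrite divr_gt0.
have Dh0 : D + h != 0 by rewrite -normc_eq0 gt_eqF.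
set E := f (w + h) - f w - d * h in h1.
have -> : w + h - z = D + h by rewrite /D addrAC.
have -> : f (w + h) / (D + h) - f w / D - (d - f w / D) / D * h =
   E / (D + h) + (f w - d * D) * h ^+ 2 / (D ^+ 2 * (D + h)).
  by rewrite /E; field; rewrite D0 Dh0.
apply: le_trans (normcD _ _) _; rewrite !Normc.normcM !Normc.normcV Normc.normcM !normcX -/K.
have hh := normc_ge0 h.
have V1 : normc E / normc (D + h) <= e / 2 * normc h.
  rewrite ler_pdivrMr //; apply: le_trans h1 _.
  rewrite (_ : e / 2 * _ * _ = (e * normc h / 2) * normc (D + h)); last by ring.
  rewrite (_ : e * normc D / 4 * normc h = (e * normc h / 2) * (normc D / 2)); last by field.
  by rewrite ler_wpM2l // divr_ge0 // mulr_ge0 // ltW.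
have V2 : K * normc h ^+ 2 / (normc D ^+ 2 * normc (D + h)) <= e / 2 * normc h.
  rewrite ler_pdivrMr; last by rewrite mulr_gt0 // exprn_gt0.
  have X : K * normc h <= e * normc D ^+ 3 / 4.
    have : K * normc h <= (K + 1) * normc h by rewrite ler_wpM2r // lerDl.
    lra.
  rewrite expr2 mulrA.
  rewrite (_ : e / 2 * _ * _ = (e / 2 * normc D ^+ 2 * normc (D + h)) * normc h); last by ring.
  rewrite ler_wpM2r //; apply: le_trans X _.
  rewrite (_ : e * normc D ^+ 3 / 4 = e / 2 * normc D ^+ 2 * (normc D / 2)); last by field.
  by rewrite ler_wpM2l // mulr_ge0 ?sqr_ge0 // divr_ge0 // ltW.
by rewrite [leRHS](_ : _ = e / 2 * normc h + e / 2 * normc h); [exact: lerD|field].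
Qed.

End ComplexDerivative.

(** * Radial cutoffs *)

Section Green.
Variable R : realType.

(** The primitive is chosen to vanish at b, not at 0: composed with
    |w - z0|^2 it has compact support in the disc. *)
Lemma compact_antiderivative (kap : R -> R) (b : R) : continuous kap -> 0 < b ->
  (forall s, b <= s -> kap s = 0) ->
  exists2 chi : R -> R, (forall s : R, 0 <= s -> is_derive s (1 : R) chi (kap s)) &
    forall s, b <= s -> chi s = 0.
Proof.
move=> ck b0 k0.
pose F (x : R) := (\int[@lebesgue_measure R]_(t in `[(-1)%R, x]) kap t)%R.
have Fb s : b <= s -> F s = F b.
  move=> bs; rewrite /F Rintegral_mkcond [RHS]Rintegral_mkcond.
  congr Rintegral; apply/funext => t; rewrite !patchE.
  case: ifPn => [|]; rewrite ?inE ?notin_setE /= !in_itv /=.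
    move=> /andP[t1 ts]; case: ifPn => //; rewrite notin_setE /= in_itv /= t1 /=.
    by move=> /negP; rewrite -ltNge => /ltW /k0.
  move=> h; case: ifPn => //; rewrite inE /= in_itv /= => /andP[t1 tb].
  by case: h; rewrite t1 /= (le_trans tb).
(* The integral starts at -1 so that 0 is an interior point. *)
exists (fun s => F s - F b) => [s s0|s /Fb ->]; last by rewrite subrr.
have [] := @continuous_FTC1 R kap (BLeft (-1)) s (s + 1).
- by rewrite ltrDl.
- apply: continuous_compact_integrable; first exact: segment_compact.
  by move=> x; apply: continuous_subspaceT.
- by rewrite /= lte_fin (lt_le_trans _ s0) // ltrN10.
- exact: ck.
move=> dF FE.
have dF' : is_derive s (1 : R) F (kap s).
  by apply: DeriveDef; [exact: dF|rewrite -derive1E].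
rewrite -[kap s]subr0; exact: is_deriveB.
Qed.

Definition sqdist (z0 : R[i]) (p : R * R) : R := (p.1 - Re z0) ^+ 2 + (p.2 - Im z0) ^+ 2.

Lemma sqdistE z0 p : sqdist z0 p = normc ((cplx p : R[i]) - z0) ^+ 2.
Proof. by rewrite normc_sqr ReB ImB. Qed.

Lemma sqdist_ge0 z0 p : 0 <= sqdist z0 p.
Proof. by rewrite sqdistE sqr_ge0. Qed.

Lemma sqdist_continuous z0 : continuous (sqdist z0).
Proof.
move=> p; rewrite /sqdist; apply: cvgD.
  apply: (@continuous_comp _ _ _ (fun p : R * R => p.1 - Re z0) (fun x => x ^+ 2)).
    by apply: cvgB; [exact: cvg_fst|exact: cvg_cst].
  exact: exprn_continuous.
apply: (@continuous_comp _ _ _ (fun p : R * R => p.2 - Im z0) (fun x => x ^+ 2)).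
  by apply: cvgB; [exact: cvg_snd|exact: cvg_cst].
exact: exprn_continuous.
Qed.

Lemma is_derive_sqshift (x a c : R) :
  is_derive x (1 : R) (fun t => (t - a) ^+ 2 + c) (2 * (x - a)).
Proof.
apply: is_derive_eps => e e0; exists e => // h he.
rewrite (_ : _ - _ = h * h); last by ring.
by rewrite normrM ler_wpM2r // ltW.
Qed.

Lemma is_derive_near0 (g : R -> R) (x : R) : {near x, cst (0 : R) =1 g} ->
  is_derive x (1 : R) g 0.
Proof.
move=> E; have D : derivable (cst (0 : R)) x (1 : R) by exact: derivable_cst.
apply: DeriveDef; first exact: (near_eq_derivable E D).
by rewrite -(near_eq_derive _ E) derive_cst.
Qed.

Section cutoff.
Variables (z0 : R[i]) (r1 b : R) (kap chi : R -> R).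
Hypotheses (b0 : 0 < b) (br : b < r1 ^+ 2) (ck : continuous kap)
  (k0 : forall s, b <= s -> kap s = 0)
  (dchi : forall s : R, 0 <= s -> is_derive s (1 : R) chi (kap s))
  (chi0 : forall s, b <= s -> chi s = 0).
Variables u u' : R * R -> R.
Hypotheses
  (cu : forall p, sqdist z0 p < r1 ^+ 2 -> {for p, continuous u})
  (cu' : forall p, sqdist z0 p < r1 ^+ 2 -> {for p, continuous u'}).

Lemma near_outside p : ~~ (sqdist z0 p < r1 ^+ 2) -> \forall p' \near p, b < sqdist z0 p'.
Proof.
by rewrite -leNgt => h; apply: (cvgr_gt _ (@sqdist_continuous z0 p)); exact: lt_le_trans br h.
Qed.

Lemma cutoff_continuous (c : R * R -> R) : continuous c ->
  continuous (fun p => c p * kap (sqdist z0 p) * u p + chi (sqdist z0 p) * u' p).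
Proof.
move=> cc p; case: (boolP (sqdist z0 p < r1 ^+ 2)) => hp.
  have chi_c : {for p, continuous (chi \o sqdist z0)}.
    apply: continuous_comp; first exact: sqdist_continuous.
    apply/differentiable_continuous/derivable1_diffP.
    by case: (dchi (sqdist_ge0 z0 p)).
  have kap_c : {for p, continuous (kap \o sqdist z0)}.
    by apply: continuous_comp; [exact: sqdist_continuous|exact: ck].
  apply: cvgD; apply: cvgM.
  - by apply: cvgM; [exact: cc|exact: kap_c].
  - exact: cu.
  - exact: chi_c.
  - exact: cu'.
have /near_outside H := hp.
have E : \forall p' \near p,
    0 = c p' * kap (sqdist z0 p') * u p' + chi (sqdist z0 p') * u' p'.
  apply: filterS H => p' /ltW h; rewrite k0 // chi0 // mulr0 !mul0r addr0 //.
rewrite /continuous_at -(nbhs_singleton E).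
by apply: (cvg_trans (near_eq_cvg E)); exact: cvg_cst.
Qed.

Lemma cutoff_supp (f : R * R -> R) : (forall p, b <= sqdist z0 p -> f p = 0) ->
  compactly_supported f.
Proof.
move=> f0; exists (normc z0 + b + 1) => p hp; apply: f0.
case: (leP b (sqdist z0 p)) => // hb; exfalso; apply: hp; apply/boxP.
have H : normc ((cplx p : R[i]) - z0) < b + 1.
  rewrite -(ltr_sqr) ?nnegrE ?addr_ge0 // ?(ltW b0) // -sqdistE.
  have := b0; have := hb; nra.
have H' : normc (cplx p) <= normc z0 + b + 1.
  have := normcD ((cplx p : R[i]) - z0) z0; rewrite subrK; lra.
by split; apply: le_trans H'; [exact: (Re_le_normc (cplx p))|exact: (Im_le_normc (cplx p))].
Qed.

(** The integrand is the derivative in x of chi(|w - z0|^2) u, a function with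
    compact support even though u is controlled only near the disc. *)
Lemma integral_cutoff_dx :
  (forall p, sqdist z0 p < r1 ^+ 2 -> is_derive p.1 (1 : R) (fun t => u (t, p.2)) (u' p)) ->
  (\int[area R]_p (2 * (p.1 - Re z0) * kap (sqdist z0 p) * u p + chi (sqdist z0 p) * u' p)%:E = 0)%E.
Proof.
move=> du; apply: (@integral_dx_compact_supp R (fun p => chi (sqdist z0 p) * u p)).
- move=> x y /=; case: (boolP (sqdist z0 (x, y) < r1 ^+ 2)) => hp.
    have D0 : is_derive x (1 : R) (fun t : R => sqdist z0 (t, y)) (2 * (x - Re z0)).
      exact: (is_derive_sqshift x (Re z0) ((y - Im z0) ^+ 2)).
    have D1 := @is_derive1_comp _ chi (fun t => sqdist z0 (t, y)) x _ _
      (dchi (sqdist_ge0 z0 (x, y))) D0.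
    have D2 := is_deriveM D1 (du (x, y) hp).
    apply: is_derive_eq D2 _; rewrite /GRing.scale /=; ring.
  have H : \forall t \near x, b < sqdist z0 (t, y).
    have cs : {for x, continuous (fun t => sqdist z0 (t, y))}.
      exact: (continuous_comp (@pair_continuous_l R y x) (@sqdist_continuous z0 _)).
    apply: (cvgr_gt _ cs).
    by apply: lt_le_trans br _; rewrite leNgt.
  have /ltW hb := nbhs_singleton H.
  rewrite k0 // chi0 // mulr0 !mul0r addr0.
  have E : {near x, cst (0 : R) =1 (fun t : R => chi (sqdist z0 (t, y)) * u (t, y))}.
    by apply: filterS H => t /ltW h /=; rewrite chi0 // mul0r.
  exact: is_derive_near0 E.
- apply: cutoff_continuous => p; apply: cvgM; first exact: cvg_cst.
  by apply: cvgB; [exact: cvg_fst|exact: cvg_cst].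
- by apply: cutoff_supp => p h; rewrite chi0 ?mul0r.
- by apply: cutoff_supp => p h; rewrite k0 // chi0 // mulr0 !mul0r addr0.
Qed.

Lemma integral_cutoff_dy :
  (forall p, sqdist z0 p < r1 ^+ 2 -> is_derive p.2 (1 : R) (fun t => u (p.1, t)) (u' p)) ->
  (\int[area R]_p (2 * (p.2 - Im z0) * kap (sqdist z0 p) * u p + chi (sqdist z0 p) * u' p)%:E = 0)%E.
Proof.
move=> du; apply: (@integral_dy_compact_supp R (fun p => chi (sqdist z0 p) * u p)).
- move=> x y /=; case: (boolP (sqdist z0 (x, y) < r1 ^+ 2)) => hp.
    have sE : (fun t => sqdist z0 (x, t)) = (fun t => (t - Im z0) ^+ 2 + (x - Re z0) ^+ 2).
      by apply/funext => t; rewrite /sqdist addrC.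
    have D0 := is_derive_sqshift y (Im z0) ((x - Re z0) ^+ 2); rewrite -sE in D0.
    have D1 := @is_derive1_comp _ chi (fun t => sqdist z0 (x, t)) y _ _
      (dchi (sqdist_ge0 z0 (x, y))) D0.
    have D2 := is_deriveM D1 (du (x, y) hp).
    apply: is_derive_eq D2 _; rewrite /GRing.scale /=; ring.
  have H : \forall t \near y, b < sqdist z0 (x, t).
    have cs : {for y, continuous (fun t => sqdist z0 (x, t))}.
      exact: (continuous_comp (@pair_continuous_r R x y) (@sqdist_continuous z0 _)).
    apply: (cvgr_gt _ cs).
    by apply: lt_le_trans br _; rewrite leNgt.
  have /ltW hb := nbhs_singleton H.
  rewrite k0 // chi0 // mulr0 !mul0r addr0.
  have E : {near y, cst (0 : R) =1 (fun t : R => chi (sqdist z0 (x, t)) * u (x, t))}.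
    by apply: filterS H => t /ltW h /=; rewrite chi0 // mul0r.
  exact: is_derive_near0 E.
- apply: cutoff_continuous => p; apply: cvgM; first exact: cvg_cst.
  by apply: cvgB; [exact: cvg_snd|exact: cvg_cst].
- by apply: cutoff_supp => p h; rewrite chi0 ?mul0r.
- by apply: cutoff_supp => p h; rewrite k0 // chi0 // mulr0 !mul0r addr0.
Qed.

End cutoff.
End Green.

(** * Green's formula with a radial weight *)

Section CauchyGreen.
Variable R : realType.
Local Notation cint := (cintegral (area R) setT).
Local Notation cintable := (cintegrable (area R) setT).

Lemma continuous_supp_integrable (f : R * R -> R) : continuous f ->
  compactly_supported f -> (area R).-integrable setT (EFin \o f).
Proof.
move=> cf [M f0]; have [B fB] := continuous_supp_bounded cf f0.
exact: bounded_supp_integrable (continuous_measurable_plane cf) fB f0.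
Qed.

Lemma ccontZ (g : R[i] -> R[i]) (z c : R[i]) : ccont g z -> ccont (fun w => c * g w) z.
Proof.
move=> gz e e0; have c0 : 0 < normc c + 1 by rewrite ltr_wpDl.
have [dl dl0 H] := gz (e / (normc c + 1)) ltac:(by rewrite divr_gt0).
exists dl => // h /H; rewrite ltr_pdivlMr // => h1.
rewrite -mulrBr Normc.normcM; apply: le_lt_trans h1.
by rewrite mulrC ler_wpM2l // lerDl.
Qed.

Lemma coord_continuous (k : nat) (z0 : R[i]) :
  continuous (fun p : R * R => 2 * ((if k is 0%N then p.1 else p.2) - (if k is 0%N then Re z0 else Im z0))).
Proof.
move=> p; apply: cvgM; first exact: cvg_cst.
by case: k => [|k]; apply: cvgB; [exact: cvg_fst|exact: cvg_cst|exact: cvg_snd|exact: cvg_cst].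
Qed.

(** Let chi be the primitive of kap vanishing beyond b.  By the
    Cauchy-Riemann equations for q, the derivative d/d(conj w) of
    chi(|w - z0|^2) q(w) equals kap(|w - z0|^2) (w - z0) q(w), and the integral
    of a derivative of a compactly supported function is zero.  This is
    Cauchy's theorem on the circles about z0, averaged with weight kap. *)
Lemma annular_green (z0 : R[i]) (r1 b : R) (kap : R -> R) (q q' : R[i] -> R[i]) :
  0 < b -> 0 < r1 -> b < r1 ^+ 2 -> continuous kap -> (forall s, b <= s -> kap s = 0) ->
  (forall w, normc (w - z0) < r1 -> cderiv q w (q' w) /\ ccont q' w) ->
  let h (p : R * R) := (kap (sqdist z0 p))%:C * ((cplx p : R[i]) - z0) * q (cplx p) in
  cintable h /\ cint h = 0.
Proof.
move=> b0 r10 br ck k0 hq h.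
have [chi dchi chi0] := compact_antiderivative ck b0 k0.
have disc p : sqdist z0 p < r1 ^+ 2 -> normc ((cplx p : R[i]) - z0) < r1.
  by rewrite sqdistE ltr_sqr ?nnegrE // ltW.
have D p (hp : sqdist z0 p < r1 ^+ 2) := (hq _ (disc p hp)).1.
have C p (hp : sqdist z0 p < r1 ^+ 2) := (hq _ (disc p hp)).2.
have Cq p (hp : sqdist z0 p < r1 ^+ 2) := cderiv_ccont (D p hp).
pose rq (p : R * R) := Re (q (cplx p)); pose iq (p : R * R) := Im (q (cplx p)).
pose rq' (p : R * R) := Re (q' (cplx p)); pose iq' (p : R * R) := Im (q' (cplx p)).
have crq p (hp : sqdist z0 p < r1 ^+ 2) : {for p, continuous rq}.
  exact: ccont_continuous_Re (Cq p hp).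
have ciq p (hp : sqdist z0 p < r1 ^+ 2) : {for p, continuous iq}.
  exact: ccont_continuous_Im (Cq p hp).
have crq' p (hp : sqdist z0 p < r1 ^+ 2) : {for p, continuous rq'}.
  exact: ccont_continuous_Re (C p hp).
have ciq' p (hp : sqdist z0 p < r1 ^+ 2) : {for p, continuous iq'}.
  exact: ccont_continuous_Im (C p hp).
have cniq' p (hp : sqdist z0 p < r1 ^+ 2) : {for p, continuous (fun p => - iq' p)}.
  by apply: cvgN; exact: ciq'.
pose P (k : nat) u u' (p : R * R) := 2 * ((if k is 0%N then p.1 else p.2) - (if k is 0%N then Re z0 else Im z0)) *
   kap (sqdist z0 p) * u p + chi (sqdist z0 p) * u' p.
have IP k u u' : (forall p, sqdist z0 p < r1 ^+ 2 -> {for p, continuous u}) ->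
  (forall p, sqdist z0 p < r1 ^+ 2 -> {for p, continuous u'}) ->
  (area R).-integrable setT (EFin \o P k u u').
  move=> cu cu'; apply: continuous_supp_integrable.
    exact: (cutoff_continuous br ck k0 dchi chi0 cu cu' (@coord_continuous k z0)).
  apply: (@cutoff_supp _ z0 b) => // p hp.
  by rewrite /P k0 // chi0 // mulr0 !mul0r addr0.
have Z1 : \int[area R]_(p in setT) P 0%N rq rq' p = 0.
  transitivity (fine (0%E : \bar R)) => //; congr fine.
  apply: (integral_cutoff_dx b0 br ck k0 dchi chi0 crq crq') => p hp.
  by have [+ _] := cderiv_dx (D p hp).
have Z2 : \int[area R]_(p in setT) P 1%N iq rq' p = 0.
  transitivity (fine (0%E : \bar R)) => //; congr fine.
  apply: (integral_cutoff_dy b0 br ck k0 dchi chi0 ciq crq') => p hp.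
  by have [_ +] := cderiv_dy (D p hp).
have Z3 : \int[area R]_(p in setT) P 0%N iq iq' p = 0.
  transitivity (fine (0%E : \bar R)) => //; congr fine.
  apply: (integral_cutoff_dx b0 br ck k0 dchi chi0 ciq ciq') => p hp.
  by have [_ +] := cderiv_dx (D p hp).
have Z4 : \int[area R]_(p in setT) P 1%N rq (fun p => - iq' p) p = 0.
  transitivity (fine (0%E : \bar R)) => //; congr fine.
  apply: (integral_cutoff_dy b0 br ck k0 dchi chi0 crq cniq') => p hp.
  by have [+ _] := cderiv_dy (D p hp).
have I1 := IP 0%N _ _ crq crq'; have I2 := IP 1%N _ _ ciq crq'.
have I3 := IP 0%N _ _ ciq ciq'; have I4 := IP 1%N _ _ crq cniq'.
have Reh : (fun p => Re (h p)) = (fun p => 2^-1 * (P 0%N rq rq' p - P 1%N iq rq' p)).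
  apply/funext => p; rewrite /h -mulrA ReM /= mul0r subr0 ReM ReB ImB /P /=.
  by rewrite /rq /iq; field.
have Imh : (fun p => Im (h p)) = (fun p => 2^-1 * (P 0%N iq iq' p + P 1%N rq (fun p => - iq' p) p)).
  apply/funext => p; rewrite /h -mulrA ImM /= mul0r addr0 ImM ReB ImB /P /=.
  by rewrite /rq /iq; field.
have J1 : (area R).-integrable setT (EFin \o (fun p => P 0%N rq rq' p - P 1%N iq rq' p)).
  exact: (integrableB measurableT I1 I2).
have J2 : (area R).-integrable setT (EFin \o (fun p => P 0%N iq iq' p + P 1%N rq (fun p => - iq' p) p)).
  exact: (integrableD measurableT I3 I4).
split.
  split.
    have := integrableZl measurableT 2^-1 J1.
    by rewrite (_ : (fun p => (Re (h p))%:E) = EFin \o (fun p => Re (h p))) // Reh.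
  have := integrableZl measurableT 2^-1 J2.
  by rewrite (_ : (fun p => (Im (h p))%:E) = EFin \o (fun p => Im (h p))) // Imh.
rewrite /cintegral Reh Imh !RintegralZl //.
have E1 := RintegralB measurableT I1 I2; have E2 := RintegralD measurableT I3 I4.
rewrite [X in _ = X - _]Z1 [X in _ = _ - X]Z2 subr0 in E1.
rewrite [X in _ = X + _]Z3 [X in _ = _ + X]Z4 addr0 in E2.
by rewrite [X in _ * X +i* _]E1 [X in _ +i* (_ * X)]E2 mulr0.
Qed.


Lemma continuous_maxl (c : R) (f : R -> R) (x : R) : {for x, continuous f} ->
  {for x, continuous (fun y => Num.max c (f y))}.
Proof.
move=> cf; rewrite (_ : (fun y => _) = (fun y => (c + f y + `|c - f y|) / 2)); last first.
  by apply/funext => y; rewrite maxr_absE.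
apply: cvgM; last exact: cvg_cst.
apply: cvgD; first by apply: cvgD; [exact: cvg_cst|exact: cf].
by apply: cvg_norm; apply: cvgB; [exact: cvg_cst|exact: cf].
Qed.

(** Used at x = |w - z0|^2, where it is continuous, supported in the annulus
    s <= |w - z0| <= t and positive inside.  It vanishes near z0, so kernels
    1/(w - z) with z close to z0 are bounded on its support. *)
Definition annulus_weight (s t x : R) : R := Num.max 0 ((x - s ^+ 2) * (t ^+ 2 - x)).

Section AnnulusWeight.
Variables s t : R.
Hypotheses (s0 : 0 < s) (st : s < t).

Let t0 : 0 < t. Proof. exact: lt_trans st. Qed.

Lemma annulus_weight_ge0 x : 0 <= annulus_weight s t x.
Proof. by rewrite /annulus_weight le_max lexx. Qed.

Lemma annulus_weight_outer0 x : t ^+ 2 <= x -> annulus_weight s t x = 0.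
Proof.
move=> h; rewrite /annulus_weight; apply/eqP; rewrite eq_maxl.
have h1 : s ^+ 2 <= t ^+ 2 by rewrite lerXn2r ?nnegrE // ltW.
by rewrite mulr_ge0_le0 // ?subr_ge0 ?subr_le0 // (le_trans h1).
Qed.

Lemma annulus_weight_inner0 x : x <= s ^+ 2 -> annulus_weight s t x = 0.
Proof.
move=> h; rewrite /annulus_weight; apply/eqP; rewrite eq_maxl.
have h1 : s ^+ 2 <= t ^+ 2 by rewrite lerXn2r ?nnegrE // ltW.
by rewrite mulr_le0_ge0 // ?subr_ge0 ?subr_le0 // (le_trans h).
Qed.

Lemma annulus_weight_le x : annulus_weight s t x <= t ^+ 4.
Proof.
rewrite /annulus_weight ge_max exprn_ge0 ?(ltW t0) //=.
case: (leP (t ^+ 2) x) => h.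
  apply: (@le_trans _ _ 0); last by rewrite exprn_ge0 // ltW.
  have h1 : s ^+ 2 <= t ^+ 2 by rewrite lerXn2r ?nnegrE // ltW.
  by rewrite mulr_ge0_le0 // ?subr_ge0 ?subr_le0 // (le_trans h1).
case: (leP x (s ^+ 2)) => h'.
  apply: (@le_trans _ _ 0); last by rewrite exprn_ge0 // ltW.
  by rewrite mulr_le0_ge0 // ?subr_ge0 ?subr_le0 // ltW.
have a1 : x - s ^+ 2 <= t ^+ 2 by have := sqr_ge0 s; lra.
have a2 : t ^+ 2 - x <= t ^+ 2 by have := sqr_ge0 s; lra.
rewrite (_ : t ^+ 4 = t ^+ 2 * t ^+ 2); last by rewrite -exprD.
by apply: ler_pM => //; rewrite subr_ge0 ltW.
Qed.

Lemma annulus_weight_continuous : continuous (annulus_weight s t).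
Proof.
move=> x; apply: (@continuous_maxl 0 (fun x => (x - s ^+ 2) * (t ^+ 2 - x)) x).
apply: cvgM; first by apply: cvgB; [exact: cvg_id|exact: cvg_cst].
by apply: cvgB; [exact: cvg_cst|exact: cvg_id].
Qed.

Lemma annulus_weight_neq0 z0 p : annulus_weight s t (sqdist z0 p) != 0 ->
  s < normc ((cplx p : R[i]) - z0) < t.
Proof.
move=> h; apply/andP; split.
  rewrite -ltr_sqr ?nnegrE ?(ltW s0) // -sqdistE ltNge.
  by apply: contra h => /annulus_weight_inner0 ->.
rewrite -ltr_sqr ?nnegrE ?(ltW t0) // -sqdistE ltNge.
by apply: contra h => /annulus_weight_outer0 ->.
Qed.

(** w^(-j) is |w|^(-2j) times the conjugate of w^j, and the radial factor
    |w|^(-2j) can be absorbed in the weight; [annular_green] then applies to a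
    positive power. *)
Lemma annulus_weight_moment z0 j : (0 < j)%N ->
  cint (fun p => (annulus_weight s t (sqdist z0 p))%:C * ((cplx p : R[i]) - z0) ^- j) = 0.
Proof.
case: j => // j _.
(* On the support x >= s^2, so the maximum is x; it keeps the quotient
   continuous at 0. *)
pose kap (x : R) := annulus_weight s t x / (Num.max (s ^+ 2) x) ^+ j.+1.
have m0 x : 0 < Num.max (s ^+ 2) x by rewrite lt_max exprn_gt0.
have ck : continuous kap.
  move=> x; apply: cvgM; first exact: annulus_weight_continuous.
  apply: cvgV; first by rewrite expf_neq0 // gt_eqF.
  apply: (@continuous_comp _ _ _ (fun x => Num.max (s ^+ 2) x) (fun x => x ^+ j.+1)).
    by apply: (@continuous_maxl (s ^+ 2) (fun x => x) x); exact: cvg_id.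
  exact: exprn_continuous.
have k0 x : t ^+ 2 <= x -> kap x = 0 by move=> h; rewrite /kap annulus_weight_outer0 ?mul0r.
have [ih h0] := @annular_green z0 (t + 1) (t ^+ 2) kap (fun w => (w - z0) ^+ j)
  (fun w => j%:R * (w - z0) ^+ j.-1) ltac:(by rewrite exprn_gt0) ltac:(by rewrite addr_gt0)
  ltac:(by rewrite ltr_sqr ?nnegrE ?addr_ge0 ?(ltW t0) // ltrDl) ck k0
  (fun w _ => conj (cderiv_monomial z0 w j)
     (ccontZ _ (cderiv_ccont (cderiv_monomial z0 w j.-1)))).
have := cintegral_conj measurableT ih; rewrite h0 rmorph0 => <-.
congr cintegral; apply/funext => p; set w := _ - z0.
have [k00|kN0] := eqVneq (annulus_weight s t (sqdist z0 p)) 0.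
  have C0 : (0 : R)%:C = 0 :> R[i] by [].
  have K0 : kap (sqdist z0 p) = 0 by rewrite /kap k00 mul0r.
  by rewrite K0 k00 !C0 !mul0r rmorph0.
have /andP[sw _] := annulus_weight_neq0 kN0.
have w0 : 0 < normc w by apply: lt_trans sw.
have wN0 : w != 0 by rewrite -normc_eq0 gt_eqF.
rewrite -mulrA -exprS /kap real_div_conj ?expf_neq0 // normcX.
have -> // : Num.max (s ^+ 2) (sqdist z0 p) = normc w ^+ 2.
  rewrite -sqdistE; apply/max_idPr; rewrite sqdistE lerXn2r ?nnegrE ?(ltW s0) ?(ltW sw) //.
by rewrite -!exprM mulnC.
Qed.

End AnnulusWeight.
End CauchyGreen.

(** * Cauchy transforms of functions vanishing near the centre *)

Section MeasurableInverse.
Context d (T : measurableType d) (R : realType) (D : set T).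

Lemma cmeasurableV (f : T -> R[i]) : measurable D -> cmeasurable D f ->
  cmeasurable D (fun x => (f x)^-1).
Proof.
move=> mD mf.
have mn : measurable_fun D (fun x => (normc (f x) ^+ 2)^-1).
  rewrite (_ : (fun x => _) = (fun x => (normc (f x) ^+ 2) `^ (-1))); last first.
    by apply/funext => x; rewrite powR_inv1 // sqr_ge0.
  apply: (measurableT_comp (@measurable_powR R (-1))).
  by apply: measurable_funX; exact: cmeasurable_normc.
have E x : (f x)^-1 = ((normc (f x) ^+ 2)^-1)%:C * (f x)^*.
  have [->|f0] := eqVneq (f x) 0; first by rewrite invr0 rmorph0 mulr0.
  have n0 : normc (f x) ^+ 2 != 0 by rewrite expf_neq0 // gt_eqF // normc_gt0.
  apply: (mulIf f0); rewrite mulVf // -mulrA [_^* * _]mulrC mulc_conj.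
  by rewrite -rmorphM mulVf // rmorph1.
rewrite (_ : (fun x => _) = (fun x => ((normc (f x) ^+ 2)^-1)%:C * (f x)^*)).
  apply: cmeasurableM; last exact: cmeasurable_conj.
  by split => //=; exact: measurable_cst.
by apply/funext => x; exact: E.
Qed.

End MeasurableInverse.

Section CauchyTransform.
Variable R : realType.
Local Notation cint := (cintegral (area R) setT).
Local Notation cintable := (cintegrable (area R) setT).
Variables (z0 : R[i]) (s : R).
Hypothesis s0 : 0 < s.
Let w (p : R * R) : R[i] := (cplx p : R[i]) - z0.

Lemma cmeasurable_shift z : cmeasurable setT (fun p : R * R => (cplx p : R[i]) - z).
Proof.
split.
  rewrite (_ : (fun p => _) = (fun p : R * R => p.1 - Re z)).
    by apply: measurable_funB => //; exact: measurable_fst.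
  by apply/funext => p; rewrite ReB.
rewrite (_ : (fun p => _) = (fun p : R * R => p.2 - Im z)).
  by apply: measurable_funB => //; exact: measurable_snd.
by apply/funext => p; rewrite ImB.
Qed.

Lemma cmeasurableX (f : R * R -> R[i]) n : cmeasurable setT f ->
  cmeasurable setT (fun p => f p ^+ n).
Proof.
move=> mf; elim: n => [|n ih].
  by under eq_fun do rewrite expr0; exact: cmeasurable_cst.
by under eq_fun do rewrite exprS; exact: cmeasurableM.
Qed.

Variable h : R * R -> R[i].
Hypotheses (ih : cintable h) (h0 : forall p, normc (w p) < s -> h p = 0).

Lemma cauchy_kernel_integrable (k : R * R -> R[i]) (C : R) :
  cmeasurable setT k -> (forall p, s <= normc (w p) -> normc (k p) <= C) ->
  cintable (fun p => h p * k p) /\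
  normc (cint (fun p => h p * k p)) <= C * \int[area R]_(p in setT) normc (h p).
Proof.
move=> mk kC.
have hk p : normc (h p * k p) <= C * normc (h p).
  rewrite Normc.normcM mulrC; have [hp|hp] := ltP (normc (w p)) s.
    by rewrite h0 // Normc.normc0 !mulr0.
  by rewrite ler_wpM2r // kC.
have inh := cintegrable_normc measurableT ih.
have inC : (area R).-integrable setT (EFin \o (fun p => C * normc (h p))).
  exact: (integrableZl measurableT C inh).
have I : cintable (fun p => h p * k p).
  apply: (cintegrable_dominated measurableT _ inC) => //.
  by apply: cmeasurableM => //; exact: cintegrable_measurable ih.
split => //; apply: le_trans (normc_cintegral_le measurableT I) _.
rewrite -RintegralZl //; apply: le_Rintegral => //.
exact: cintegrable_normc.
Qed.

(** Geometric expansion of 1/(w - u).  Since h vanishes for |w| < s, the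
    remainder after N terms is at most a multiple of (|u| / s)^N. *)
Lemma cauchy_transform_series u : normc u < s ->
  (fun N => \sum_(j < N) cint (fun p => h p * (w p) ^- j.+1) * u ^+ j : R[i]^o) @ \oo -->
  (cint (fun p => h p * (w p - u)^-1) : R[i]^o).
Proof.
move=> us; set I := \int[area R]_(p in setT) normc (h p).
have mw : cmeasurable setT w by exact: cmeasurable_shift.
have mwu : cmeasurable setT (fun p => (w p - u)^-1).
  by apply: cmeasurableV => //; apply: cmeasurableB => //; exact: cmeasurable_cst.
have mwn n : cmeasurable setT (fun p => (w p) ^- n).
  by apply: cmeasurableV => //; exact: cmeasurableX.
have wu p : s <= normc (w p) -> s - normc u <= normc (w p - u).
  by move=> sw; apply: le_trans (normc_B_ge _ _); rewrite lerD2r.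
have su0 : 0 < s - normc u by rewrite subr_gt0.
have kn n p : s <= normc (w p) -> normc ((w p) ^- n) <= s ^- n.
  move=> sw; rewrite Normc.normcV normcX lef_pV2 ?posrE ?exprn_gt0 //; last exact: lt_le_trans sw.
  by rewrite lerXn2r ?nnegrE // ltW.
have kwu p : s <= normc (w p) -> normc ((w p - u)^-1) <= (s - normc u)^-1.
  by move=> sw; rewrite Normc.normcV lef_pV2 ?posrE // ?wu //; exact: lt_le_trans (wu _ sw).
have In n : cintable (fun p => h p * (w p) ^- n) := (cauchy_kernel_integrable (mwn n) (kn n)).1.
have Iwu : cintable (fun p => h p * (w p - u)^-1) := (cauchy_kernel_integrable mwu kwu).1.
have E N : cint (fun p => h p * (w p - u)^-1) -
    \sum_(j < N) cint (fun p => h p * (w p) ^- j.+1) * u ^+ j =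
    cint (fun p => h p * ((w p - u)^-1 * (u ^+ N * (w p) ^- N))).
  have -> : \sum_(j < N) cint (fun p => h p * (w p) ^- j.+1) * u ^+ j =
      cint (fun p => \sum_(j < N) u ^+ j * (h p * (w p) ^- j.+1)).
    rewrite (@cintegral_sum _ _ _ _ _ measurableT (fun j p => u ^+ j * (h p * (w p) ^- j.+1))).
      by apply: eq_bigr => j _; rewrite cintegralZ // mulrC.
    by move=> j; exact: cintegrableZ.
  rewrite -cintegralB //; last first.
    apply: (@cintegrable_sum _ _ _ _ _ measurableT (fun j p => u ^+ j * (h p * (w p) ^- j.+1))).
    by move=> j; exact: cintegrableZ.
  apply: eq_cintegral => p _.
  have [hp|hp] := ltP (normc (w p)) s.
    by rewrite h0 // !mul0r big1 ?subr0 // => j _; rewrite mul0r mulr0.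
  have w0 : w p != 0 by rewrite -normc_eq0 gt_eqF // (lt_le_trans s0).
  have wu0 : w p - u != 0 by rewrite -normc_eq0 gt_eqF // (lt_le_trans su0) // wu.
  under eq_bigr do rewrite mulrCA; rewrite -mulr_sumr -mulrBr; congr (_ * _).
  have -> : \sum_(j < N) u ^+ j / w p ^+ j.+1 = (w p)^-1 * \sum_(j < N) (u / w p) ^+ j.
    rewrite mulr_sumr; apply: eq_bigr => j _.
    by rewrite expr_div_n exprS invfM; ring.
  apply: (mulfI wu0); rewrite mulrBr mulfV // mulVKf // mulrA.
  have -> : (w p - u) / w p = - (u / w p - 1) by rewrite mulrBl divff // opprB.
  by rewrite mulNr opprK -subrX1 expr_div_n addrC subrK.
pose q := normc u / s.
have q01 : 0 <= q < 1 by rewrite /q divr_ge0 ?(ltW s0) //= ltr_pdivrMr // mul1r.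
apply/cvgC_normc0P.
have B N : normc (\sum_(j < N) cint (fun p => h p * (w p) ^- j.+1) * u ^+ j -
   cint (fun p => h p * (w p - u)^-1)) <= q ^+ N * ((s - normc u)^-1 * I).
  rewrite normcBC E.
  have [] := @cauchy_kernel_integrable (fun p => (w p - u)^-1 * (u ^+ N * (w p) ^- N))
     ((s - normc u)^-1 * (q ^+ N)).
  - apply: cmeasurableM => //; apply: cmeasurableM => //; exact: cmeasurable_cst.
  - move=> p sw; rewrite Normc.normcM; apply: ler_pM => //; first exact: kwu.
    rewrite Normc.normcM normcX /q expr_div_n ler_wpM2l ?exprn_ge0 //; exact: kn.
  - by move=> _; rewrite -/I mulrAC mulrC.
apply: (@squeeze_cvgr _ _ _ _ (fun=> 0) (fun N => q ^+ N * ((s - normc u)^-1 * I))).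
- by apply: nearW => N; rewrite normc_ge0 B.
- exact: cvg_cst.
- rewrite -[X in _ --> X](mul0r ((s - normc u)^-1 * I)).
  apply: cvgM; last exact: cvg_cst.
  apply: cvg_expr; case/andP: q01 => q0 q1; rewrite ger0_norm //.
Qed.

End CauchyTransform.

(** * Cauchy's formula averaged over an annulus *)

Section CauchyFormula.
Variable R : realType.
Local Notation cint := (cintegral (area R) setT).
Local Notation cintable := (cintegrable (area R) setT).
Variables (z0 : R[i]) (s t : R).
Hypotheses (s0 : 0 < s) (st : s < t).
Let w (p : R * R) : R[i] := (cplx p : R[i]) - z0.
Let kap (p : R * R) : R := annulus_weight s t (sqdist z0 p).
Let t0 : 0 < t. Proof. exact: lt_trans st. Qed.

Definition annulus_mass := (\int[area R]_(p in setT) annulus_weight s t (sqdist z0 p))%R.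

Lemma annulus_weight_supp (f : R * R -> R[i]) p : normc (w p) < s ->
  (kap p)%:C * w p * f p = 0.
Proof.
move=> h; have [k0|/(annulus_weight_neq0 s0 st)/andP[h1 _]] := eqVneq (kap p) 0.
  by have C0 : (0 : R)%:C = 0 :> R[i] by []; rewrite k0 !C0 !mul0r.
by move: (lt_trans h1 h); rewrite ltxx.
Qed.

Lemma annulus_weight_green (r1 : R) (q q' : R[i] -> R[i]) : t < r1 ->
  (forall v, normc (v - z0) < r1 -> cderiv q v (q' v) /\ ccont q' v) ->
  let h p := (kap p)%:C * w p * q (cplx p) in cintable h /\ cint h = 0.
Proof.
move=> tr; apply: (@annular_green _ _ _ (t ^+ 2)).
- by rewrite exprn_gt0.
- exact: lt_trans tr.
- by rewrite ltr_sqr ?nnegrE ?(ltW t0) // (ltW (lt_trans t0 tr)).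
- exact: annulus_weight_continuous.
- exact: annulus_weight_outer0.
Qed.

Lemma annulus_vector_integrable : cintable (fun p => (kap p)%:C * w p).
Proof.
have [|h _] := @annulus_weight_green (t + 1) (fun=> 1) (fun=> 0) ltac:(by rewrite ltrDl).
  move=> v _; split; first exact: cderiv_cst.
  exact: cderiv_ccont (cderiv_cst _ _).
by under eq_fun do rewrite -[_ * w _]mulr1.
Qed.

Lemma annulus_inverse_moment : cint (fun p => (kap p)%:C * w p * (w p)^-1) = (annulus_mass)%:C.
Proof.
rewrite (@eq_cintegral _ _ _ _ _ _ (fun p => (kap p)%:C)) => [|p _]; last first.
  have [k0|/(annulus_weight_neq0 s0 st)/andP[h1 _]] := eqVneq (kap p) 0.
    by have C0 : (0 : R)%:C = 0 :> R[i] by []; rewrite k0 !C0 !mul0r.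
  rewrite mulfK // -normc_eq0 gt_eqF //; exact: lt_trans h1.
rewrite /cintegral /annulus_mass; congr (_ +i* _) => /=.
by rewrite /Rintegral integral0.
Qed.

(** In the expansion of the Cauchy transform all moments of negative order
    vanish, which leaves the term of order 0. *)
Lemma annulus_cauchy_mass u : normc u < s ->
  cint (fun p => (kap p)%:C * w p * (w p - u)^-1) = (annulus_mass)%:C.
Proof.
move=> us.
have h0 p : normc (w p) < s -> (kap p)%:C * w p = 0.
  by move=> h; rewrite -[LHS]mulr1 (@annulus_weight_supp (fun=> 1)).
have /cvgC_shiftS H := cauchy_transform_series s0 annulus_vector_integrable h0 us.
apply: (cvgC_unique H).
rewrite (_ : (fun n => _) = fun=> (annulus_mass)%:C); first exact: cvg_cst.
apply/funext => n; rewrite big_ord_recl /= expr0 mulr1 big1 ?addr0 => [|j _].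
  by rewrite -annulus_inverse_moment.
rewrite (@eq_cintegral _ _ _ _ _ _ (fun p => (kap p)%:C * (w p) ^- j.+1)) => [|p _].
  by rewrite [X in X * _](annulus_weight_moment s0 st z0 (ltn0Sn j)) mul0r.
have [k0|/(annulus_weight_neq0 s0 st)/andP[h1 _]] := eqVneq (kap p) 0.
  by have C0 : (0 : R)%:C = 0 :> R[i] by []; rewrite k0 !C0 !mul0r.
have wN0 : w p != 0 by rewrite -normc_eq0 gt_eqF // (lt_trans s0 h1).
rewrite -mulrA; congr (_ * _).
by rewrite /bump /= add1n -/(w p) [in LHS]exprS invfM mulVKf.
Qed.

Section formula.
Variables (r1 : R) (f : R[i]^o -> R[i]^o).
Hypotheses (tr : t < r1) (af : forall v, normc (v - z0) < r1 -> analytic_at f v).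

Lemma annulus_fun_integrable : cintable (fun p => (kap p)%:C * w p * f (cplx p)).
Proof.
apply: (annulus_weight_green (q := f) (q' := derive1 f) tr _).1 => v vr; split.
  exact: analytic_cderiv (af vr).
apply: cderiv_ccont; apply: analytic_cderiv.
exact: (analytic_derive1n 1 (af vr)).
Qed.

(** The value at the removable singularity is the derivative, which makes the
    quotient analytic there. *)
Definition difference_quotient (z v : R[i]) : R[i] :=
  if v == z then derive1 f z else ((f v : R[i]) - f z) / (v - z).

Lemma difference_quotient_analytic z : analytic_at f z ->
  analytic_at (difference_quotient z : R[i]^o -> R[i]^o) z.
Proof.
move=> [a [r [r0 fa]]]; exists (fun j => a j.+1), r; split; first exact: r0.
move=> v vr.
have [->|vz] := eqVneq v z.
  rewrite /difference_quotient eqxx (power_series_center r0 (power_series_derive1 fa)) mul1r.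
  rewrite -(cvg_shiftS (fun n => _ : R[i]^o)) /=.
  rewrite (_ : (fun n => _) = (fun=> (a 1%N : R[i]^o))); first exact: cvg_cst.
  apply/funext => n; rewrite subrr big_ord_recl expr0 mulr1 big1 ?addr0 // => j _.
  by rewrite exprS mul0r mulr0.
rewrite /difference_quotient (negbTE vz) (power_series_center r0 fa).
have vz0 : v - z != 0 by rewrite subr_eq0.
have H : (fun n => ((\sum_(j < n.+1) a j * (v - z) ^+ j) - a 0%N) * (v - z)^-1 : R[i]^o) @ \oo -->
   (((f v : R[i]) - a 0%N) * (v - z)^-1 : R[i]^o).
  apply: cvgC_mulr; apply: cvgC_sub; last exact: cvg_cst.
  exact: (cvgC_shiftS (fa v vr)).
apply: cvg_trans H; apply: near_eq_cvg; apply: nearW => n.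
rewrite big_ord_recl expr0 mulr1 [a 0%N + _]addrC addrK mulr_suml.
by apply: eq_bigr => j _; rewrite lift0 exprSr mulrA mulfK.
Qed.

Lemma cderiv_near g1 g2 (v d : R[i]) (r : R) : 0 < r ->
  (forall v', normc (v' - v) < r -> g1 v' = g2 v') -> cderiv g1 v d -> cderiv g2 v d.
Proof.
move=> r0 E H e e0; have [dl dl0 Hd] := H e e0.
exists (Num.min dl r); first by rewrite lt_min dl0.
move=> h; rewrite lt_min => /andP[h1 h2].
by rewrite -!E; [exact: Hd|rewrite subrr Normc.normc0|rewrite addrC addKr].
Qed.

(** At z the quotient is a power series; elsewhere the quotient rule applies
    twice, because derivatives of analytic functions are analytic. *)
Lemma difference_quotient_C1 z v : normc (z - z0) < r1 -> normc (v - z0) < r1 ->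
  cderiv (difference_quotient z) v (derive1 (difference_quotient z : R[i]^o -> R[i]^o) v) /\
  ccont (derive1 (difference_quotient z : R[i]^o -> R[i]^o)) v.
Proof.
move=> zr vr; have [->|vz] := eqVneq v z.
  have A := difference_quotient_analytic (af zr); split; first exact: analytic_cderiv.
  apply: cderiv_ccont; apply: analytic_cderiv; exact: (analytic_derive1n 1 A).
pose q := difference_quotient z.
have Dq v' : normc (v' - z0) < r1 -> v' != z ->
    cderiv q v' ((derive1 f v' - q v') / (v' - z)).
  move=> v'r v'z; rewrite {2}/q /difference_quotient (negbTE v'z).
  have n0 : 0 < normc (v' - z) by rewrite normc_gt0 // subr_eq0.
  apply: (@cderiv_near (fun u => ((f u : R[i]) - f z) / (u - z)) _ _ _ _ n0).
    move=> v'' h; rewrite /q /difference_quotient; case: eqVneq => // E.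
    by move: h; rewrite E normcBC ltxx.
  apply: (cderiv_quotient _ v'z); rewrite -[X in cderiv _ _ X]subr0.
  by apply: cderivB; [exact: analytic_cderiv (af v'r)|exact: cderiv_cst].
have E v' : normc (v' - z0) < r1 -> v' != z ->
    derive1 (q : R[i]^o -> R[i]^o) v' = (derive1 f v' - q v') / (v' - z).
  by move=> h1 h2; apply: cderiv_derive1; exact: Dq.
split; first by rewrite E //; exact: Dq.
pose r := Num.min (r1 - normc (v - z0)) (normc (v - z)).
have r0 : 0 < r by rewrite lt_min subr_gt0 vr /= normc_gt0 // subr_eq0.
apply: cderiv_ccont.
apply: (@cderiv_near (fun u => ((derive1 f u : R[i]) - q u) / (u - z)) _ v _ r r0).
  move=> v'; rewrite lt_min => /andP[h1 h2]; rewrite -E //.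
    have := normcD (v' - v) (v - z0); rewrite addrA subrK; lra.
  by apply/eqP => vE; move: h2; rewrite vE normcBC ltxx.
apply: (cderiv_quotient _ vz); apply: cderivB; last exact: Dq.
by apply: analytic_cderiv; exact: (analytic_derive1n 1 (af vr)).
Qed.

(** Write f(w) = f(z) + (w - z) q(w) with q the difference quotient.  Against
    the kernel 1/(w - z), the constant contributes f(z) times the mass by
    [annulus_cauchy_mass] and the second term contributes the integral of the
    weight times (w - z0) q, which is zero by [annular_green]. *)
Lemma cauchy_formula z : normc (z - z0) < s ->
  cint (fun p => (kap p)%:C * w p * f (cplx p) * (w p - (z - z0))^-1) =
  f z * (annulus_mass)%:C.
Proof.
move=> zs; have zr : normc (z - z0) < r1 by rewrite (lt_trans zs) // (lt_trans st).
have [_ H] := annulus_weight_green tr (fun v vr => difference_quotient_C1 zr vr).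
rewrite -(annulus_cauchy_mass zs).
have h0 p : normc (w p) < s -> (kap p)%:C * w p = 0.
  by move=> h; rewrite -[LHS]mulr1 (@annulus_weight_supp (fun=> 1)).
have su0 : 0 < s - normc (z - z0) by rewrite subr_gt0.
have wu p : s <= normc (w p) -> s - normc (z - z0) <= normc (w p - (z - z0)).
  by move=> sw; apply: le_trans (normc_B_ge _ _); rewrite lerD2r.
have mwu : cmeasurable setT (fun p => (w p - (z - z0))^-1).
  apply: cmeasurableV => //; apply: cmeasurableB; last exact: cmeasurable_cst.
  exact: cmeasurable_shift.
have kwu p : s <= normc (w p) -> normc ((w p - (z - z0))^-1) <= (s - normc (z - z0))^-1.
  by move=> sw; rewrite Normc.normcV lef_pV2 ?posrE // ?wu //; exact: lt_le_trans (wu _ sw).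
have I1 := (cauchy_kernel_integrable annulus_vector_integrable h0 mwu kwu).1.
have I2 := (cauchy_kernel_integrable annulus_fun_integrable (@annulus_weight_supp (f \o @cplx R)) mwu kwu).1.
rewrite -cintegralZ //; apply/eqP; rewrite -subr_eq0 -cintegralB //; last exact: cintegrableZ.
rewrite -[X in _ == X]H; apply/eqP; apply: eq_cintegral => p _.
have [hp|hp] := ltP (normc (w p)) s.
  by rewrite !h0 // !mul0r mulr0 subr0.
have wuE : w p - (z - z0) = (cplx p : R[i]) - z by rewrite /w opprB addrA subrK.
have pz : (cplx p : R[i]) - z != 0 by rewrite -wuE -normc_eq0 gt_eqF // (lt_le_trans su0) // wu.
rewrite wuE /difference_quotient -subr_eq0 (negbTE pz); ring.
Qed.

End formula.
End CauchyFormula.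

(** * Power series expansion and kernel bounds *)

Section CauchySchwarz.
Context d (T : measurableType d) (R : realType) (mu : {measure set T -> \bar R}).

(** Cauchy-Schwarz against the constant 1, obtained by integrating
    (g - m)^2 >= 0 with m = A^(-1) times the integral of g. *)
Lemma square_integral_le (D : set T) (A : R) (g : T -> R) : measurable D ->
  0 < A -> (mu D <= A%:E)%E -> measurable_fun D g ->
  mu.-integrable D (EFin \o (fun x => g x ^+ 2)) ->
  mu.-integrable D (EFin \o g) /\
  (\int[mu]_(x in D) g x) ^+ 2 <= A * \int[mu]_(x in D) (g x ^+ 2).
Proof.
move=> mD A0 DA mg ig2.
have Dfin : (mu D < +oo)%E by apply: le_lt_trans DA (ltry _).
have i1 c : mu.-integrable D (EFin \o (fun=> c : R)).
  apply: measurable_bounded_integrable => //.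
  exists `|c|; split; first by rewrite num_real.
  by move=> x cx p _; exact: ltW.
have ig : mu.-integrable D (EFin \o g).
  apply: (le_integrable mD _ _ (integrableD mD (i1 1) ig2)).
    exact/measurable_EFinP.
  move=> x Dx /=; rewrite lee_fin; apply: le_trans (ler_norm _).
  have := sqr_ge0 (`|g x| - 1); rewrite -[g x ^+ 2]real_normK ?num_real //.
  have := sqr_ge0 (`|g x|); have := normr_ge0 (g x); nra.
split => //.
set X := (\int[mu]_(x in D) g x); set E := \int[mu]_(x in D) (g x ^+ 2).
(* If D has measure exactly A, this is the mean of g. *)
pose m := X / A.
have muD : fine (mu D) <= A by rewrite -lee_fin fineK // ge0_fin_numE.
have i2 : mu.-integrable D (EFin \o (fun x => 2 * m * g x)).
  exact: (integrableZl mD (2 * m) ig).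
have i3 : mu.-integrable D (EFin \o (fun x => g x ^+ 2 - 2 * m * g x)).
  exact: (integrableB mD ig2 i2).
have : 0 <= \int[mu]_(x in D) ((g x ^+ 2 - 2 * m * g x) + m ^+ 2).
  apply: Rintegral_ge0 => x _.
  by rewrite (_ : _ + _ = (g x - m) ^+ 2) ?sqr_ge0 //; ring.
rewrite RintegralD // RintegralB // RintegralZl // Rintegral_cst // -/X -/E => H.
have m2 : m ^+ 2 * fine (mu D) <= m ^+ 2 * A by rewrite ler_wpM2l // sqr_ge0.
have H2 : 0 <= E - 2 * m * X + m ^+ 2 * A by apply: le_trans H _; rewrite lerD2l.
have XA : X = m * A by rewrite /m divfK // gt_eqF.
rewrite XA in H2 *.
have -> : (m * A) ^+ 2 = A * (m ^+ 2 * A) by ring.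
rewrite ler_pM2l //.
have -> : m ^+ 2 * A = 2 * m * (m * A) - m ^+ 2 * A by ring.
lra.
Qed.

End CauchySchwarz.

Section CauchyEstimates.
Variable R : realType.
Local Notation cint := (cintegral (area R) setT).
Local Notation cintable := (cintegrable (area R) setT).

Definition disc (z0 : R[i]) (t : R) : set (R * R) := [set p | sqdist z0 p < t ^+ 2].

Lemma disc_open z0 t : open (disc z0 t).
Proof.
apply: (@open_comp _ _ (sqdist z0) [set x | x < t ^+ 2]); last exact: open_lt.
by move=> p _; exact: sqdist_continuous.
Qed.

Lemma measurable_disc z0 t : measurable (disc z0 t).
Proof. by apply: open_measurable_plane; exact: disc_open. Qed.

Lemma disc_normc z0 t p : 0 < t -> disc z0 t p <-> normc ((cplx p : R[i]) - z0) < t.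
Proof. by move=> t0; rewrite /disc /= sqdistE ltr_sqr // nnegrE // ltW. Qed.

Lemma area_disc_le z0 t : 0 < t -> (area R (disc z0 t) <= (4 * t ^+ 2)%:E)%E.
Proof.
move=> t0.
have mb : measurable (`[Re z0 - t, Re z0 + t] `*` `[Im z0 - t, Im z0 + t] : set (R * R)).
  by apply: measurableX; exact: measurable_itv.
apply: (@le_trans _ _ (area R (`[Re z0 - t, Re z0 + t] `*` `[Im z0 - t, Im z0 + t]))).
  apply: le_measure; rewrite ?inE //; first exact: measurable_disc.
  move=> p /(disc_normc _ _ t0) h.
  have h1 := le_lt_trans (Re_le_normc _) h; have h2 := le_lt_trans (Im_le_normc _) h.
  rewrite ReB ltr_norml /= in h1; rewrite ImB ltr_norml /= in h2.
  by split; rewrite /= in_itv /=; lra.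
rewrite area_box; [|lra|lra].
by rewrite lee_fin le_eqVlt; apply/orP; left; apply/eqP; ring.
Qed.

Section estimates.
Variables (z0 : R[i]) (t : R).
Hypothesis t0 : 0 < t.
Let s := t / 4.
Let s0 : 0 < s. Proof. by rewrite /s divr_gt0. Qed.
Let st : s < t. Proof. by rewrite /s; have := t0; lra. Qed.
Let w (p : R * R) : R[i] := (cplx p : R[i]) - z0.
Let kap (p : R * R) : R := annulus_weight s t (sqdist z0 p).
Let c := annulus_mass z0 s t.

Lemma annulus_weight_integrable : (area R).-integrable setT (EFin \o kap).
Proof.
apply: continuous_supp_integrable.
  move=> p; apply: (continuous_comp (@sqdist_continuous _ z0 p)); exact: annulus_weight_continuous.
apply: (@cutoff_supp _ z0 (t ^+ 2)) => [|p h]; first by rewrite exprn_gt0.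
by rewrite /kap annulus_weight_outer0.
Qed.

(** The inner radius is t / 4.  On a box of area t^2 / 16 in the middle of the
    annulus the weight is at least (3/16) (6/16) t^4 = 9/128 t^4. *)
Lemma annulus_mass_ge : 9 / 2048 * t ^+ 6 <= c.
Proof.
pose B : set (R * R) := `[Re z0 + t / 2, Re z0 + 3 / 4 * t] `*` `[Im z0, Im z0 + t / 4].
have mB : measurable B by apply: measurableX; exact: measurable_itv.
have aB : area R B = (t ^+ 2 / 16)%:E.
  have h := t0; rewrite /B area_box; [|lra|lra].
  by congr EFin; field.
apply: (@le_trans _ _ (\int[area R]_(p in B) (9 / 128 * t ^+ 4))).
  rewrite Rintegral_cst //= aB /= le_eqVlt; apply/orP; left; apply/eqP.
  by rewrite !exprS; field.
have Boo : (area R B < +oo)%E by rewrite aB ltry.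
have iB : (area R).-integrable B (EFin \o (fun=> 9 / 128 * t ^+ 4)).
  apply: measurable_bounded_integrable => //.
  exists `|9 / 128 * t ^+ 4|; split; first by rewrite num_real.
  by move=> x cx p _; exact: ltW.
apply: (@le_trans _ _ (\int[area R]_(p in B) kap p)).
  apply: le_Rintegral => //; first exact: (integrableS measurableT mB _ annulus_weight_integrable).
  move=> p [/=]; rewrite !in_itv /= => /andP[a1 a2] /andP[b1 b2].
  rewrite /kap /annulus_weight le_max; apply/orP; right.
  have q1 : t ^+ 2 / 4 <= sqdist z0 p.
    rewrite /sqdist; have := sqr_ge0 (p.2 - Im z0).
    have : t / 2 * (t / 2) <= (p.1 - Re z0) * (p.1 - Re z0).
      by apply: ler_pM; have := t0; lra.
    rewrite -!expr2; lra.
  have q2 : sqdist z0 p <= 10 / 16 * t ^+ 2.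
    rewrite /sqdist.
    have : (p.1 - Re z0) * (p.1 - Re z0) <= 3 / 4 * t * (3 / 4 * t).
      by apply: ler_pM; have := t0; lra.
    have : (p.2 - Im z0) * (p.2 - Im z0) <= t / 4 * (t / 4).
      by apply: ler_pM; have := t0; lra.
    rewrite -!expr2; lra.
  have t20 : 0 < t ^+ 2 by rewrite exprn_gt0.
  have : (3 / 16 * t ^+ 2) * (6 / 16 * t ^+ 2) <= (sqdist z0 p - s ^+ 2) * (t ^+ 2 - sqdist z0 p).
    apply: ler_pM.
    - by rewrite mulr_ge0 // ltW.
    - by rewrite mulr_ge0 // ltW.
    - by rewrite /s expr_div_n; lra.
    - lra.
  apply: le_trans; rewrite le_eqVlt; apply/orP; left; apply/eqP.
  by rewrite (_ : t ^+ 4 = t ^+ 2 * t ^+ 2); [field|rewrite -exprD].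
rewrite /c /annulus_mass; rewrite [leLHS]Rintegral_mkcond; apply: le_Rintegral => //.
- have := (integrable_mkcond _ mB).1 (integrableS measurableT mB (@subsetT _ _) annulus_weight_integrable).
  by apply: eq_integrable => // p _; rewrite /= !patchE; case: ifP.
- exact: annulus_weight_integrable.
- by move=> p _; rewrite patchE; case: ifP => // _; exact: annulus_weight_ge0.
Qed.

Lemma annulus_mass_gt0 : 0 < c.
Proof.
have h := annulus_mass_ge; have h6 : 0 < t ^+ 6 by rewrite exprn_gt0.
lra.
Qed.

(** The hypothesis is the averaged Cauchy formula.  It determines f from its
    values on the annulus, which are integrated against powers of 1/w. *)
Lemma cauchy_power_series (f : R[i] -> R[i]) :
  cintable (fun p => (kap p)%:C * w p * f (cplx p)) ->
  (forall z, normc (z - z0) < s ->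
    cint (fun p => (kap p)%:C * w p * f (cplx p) * (w p - (z - z0))^-1) = f z * c%:C) ->
  power_series_on f z0 s
    (fun j => c%:C^-1 * cint (fun p => (kap p)%:C * w p * f (cplx p) * (w p) ^- j.+1)).
Proof.
move=> If H z zs.
have h0 p : normc (w p) < s -> (kap p)%:C * w p * f (cplx p) = 0.
  by move=> h; exact: (annulus_weight_supp s0 st (fun p => f (cplx p)) h).
have L := cauchy_transform_series s0 If h0 zs; have Hz := H z zs.
have cN0 : c%:C != 0 by rewrite -normc_eq0 normc_real normr_eq0 gt_eqF // annulus_mass_gt0.
have -> : f z = c%:C^-1 * (f z * c%:C) by rewrite mulrC mulfK.
rewrite -Hz.
apply: (cvg_trans _ (cvgC_mull L)); apply: near_eq_cvg; apply: nearW => n.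
by rewrite mulr_sumr; apply: eq_bigr => j _; rewrite mulrA.
Qed.

(** The weight is at most t^4 and is supported in the disc of radius t. *)
Lemma annulus_kernel_bound (f k : R * R -> R[i]) (C : R) : 0 <= C ->
  cintable (fun p => (kap p)%:C * w p * f p) -> cmeasurable setT k ->
  (area R).-integrable (disc z0 t) (EFin \o (fun p => normc (f p))) ->
  (forall p, s < normc (w p) -> normc (w p * k p) <= C) ->
  normc (cint (fun p => (kap p)%:C * w p * f p * k p)) <=
  t ^+ 4 * C * \int[area R]_(p in disc z0 t) normc (f p).
Proof.
move=> C0 If mk inf kC.
have E p : (kap p)%:C * w p * f p * k p = (kap p)%:C * (w p * k p) * f p by ring.
have B p : normc ((kap p)%:C * w p * f p * k p) <=
    ((fun p => t ^+ 4 * C * normc (f p)) \_ (disc z0 t)) p.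
  rewrite patchE; have [k0|kN0] := eqVneq (kap p) 0.
    have C00 : (0 : R)%:C = 0 :> R[i] by [].
    rewrite k0 C00 !mul0r Normc.normc0; case: ifP => // _.
    by apply: mulr_ge0 => //; apply: mulr_ge0 => //; apply: exprn_ge0; exact: ltW.
  have /andP[h1 h2] := annulus_weight_neq0 s0 st kN0.
  rewrite ifT ?inE; last exact/disc_normc.
  rewrite E Normc.normcM ler_wpM2r // Normc.normcM normc_real ger0_norm ?annulus_weight_ge0 //.
  apply: ler_pM => //; [exact: annulus_weight_ge0|exact: annulus_weight_le|exact: kC].
have inB : (area R).-integrable (disc z0 t) (EFin \o (fun p => t ^+ 4 * C * normc (f p))).
  exact: (integrableZl (measurable_disc z0 t) (t ^+ 4 * C) inf).
have inB' : (area R).-integrable setT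
    (EFin \o ((fun p => t ^+ 4 * C * normc (f p)) \_ (disc z0 t))).
  have := (integrable_mkcond _ (measurable_disc z0 t)).1 inB.
  by apply: eq_integrable => // p _; rewrite /= !patchE; case: ifP.
have I : cintable (fun p => (kap p)%:C * w p * f p * k p).
  apply: (cintegrable_dominated measurableT _ inB') => //.
  by apply: cmeasurableM => //; exact: cintegrable_measurable If.
apply: le_trans (normc_cintegral_le measurableT I) _.
rewrite -RintegralZl //; last exact: measurable_disc.
rewrite [leRHS]Rintegral_mkcond; apply: le_Rintegral => //.
exact: cintegrable_normc.
Qed.

End estimates.
End CauchyEstimates.

(** * Estimates on a disc by the L2 norm *)

Lemma ler_sqr_mono (R : realType) (a b : R) : 0 <= a -> a <= b -> a ^+ 2 <= b ^+ 2.
Proof. by move=> a0 ab; rewrite lerXn2r ?nnegrE // (le_trans a0). Qed.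

Section DiscEstimates.
Variable R : realType.
Local Notation cint := (cintegral (area R) setT).
Local Notation cintable := (cintegrable (area R) setT).
Variables (z0 : R[i]) (t r1 : R).
Hypotheses (t0 : 0 < t) (tr : t < r1).
Let s := t / 4.
Let s0 : 0 < s. Proof. by rewrite /s divr_gt0. Qed.
Let st : s < t. Proof. by rewrite /s; have := t0; lra. Qed.
Let w (p : R * R) : R[i] := (cplx p : R[i]) - z0.
Let kap (p : R * R) : R := annulus_weight s t (sqdist z0 p).
Let c := annulus_mass z0 s t.
Let c0 : 0 < c. Proof. exact: annulus_mass_gt0. Qed.
Let cge : 9 / 2048 * t ^+ 6 <= c. Proof. exact: annulus_mass_ge. Qed.

(** The squared L2 norm of f on D. *)
Definition square_integral (D : set (R * R)) (f : R[i] -> R[i]) : R :=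
  \int[area R]_(p in D) (normc (f (cplx p)) ^+ 2).

Section analytic.
Variable f : R[i]^o -> R[i]^o.
Hypothesis (af : forall v, normc (v - z0) < r1 -> analytic_at f v).
Hypothesis (f2 : (area R).-integrable (disc z0 t)
  (EFin \o (fun p => normc (f (cplx p)) ^+ 2))).

Lemma disc_cmeasurable : cmeasurable (disc z0 t) (fun p => f (cplx p)).
Proof.
have H p : p \in disc z0 t -> ccont f (cplx p).
  rewrite inE => /(disc_normc _ _ t0) h; apply: cderiv_ccont.
  by apply: analytic_cderiv; apply: af; apply: lt_trans tr.
split; apply: open_continuous_measurable_plane; try exact: disc_open.
  by move=> p /H; exact: ccont_continuous_Re.
by move=> p /H; exact: ccont_continuous_Im.
Qed.

Let X := \int[area R]_(p in disc z0 t) normc (f (cplx p)).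

Lemma disc_L1 : (area R).-integrable (disc z0 t) (EFin \o (fun p => normc (f (cplx p)))) /\
  X ^+ 2 <= 4 * t ^+ 2 * square_integral (disc z0 t) f.
Proof.
apply: square_integral_le.
- exact: measurable_disc.
- by rewrite mulr_gt0 // exprn_gt0.
- exact: area_disc_le.
- by apply: cmeasurable_normc; exact: disc_cmeasurable.
- exact: f2.
Qed.

Let X0 : 0 <= X. Proof. by apply: Rintegral_ge0 => p _. Qed.

Let F (p : R * R) := (kap p)%:C * w p * f (cplx p).

Lemma disc_power_series : power_series_on f z0 s
  (fun j => c%:C^-1 * cint (fun p => F p * (w p) ^- j.+1)).
Proof.
apply: cauchy_power_series => //.
  exact: (annulus_fun_integrable s0 st tr af).
by move=> z zs; exact: (cauchy_formula s0 st tr af zs).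
Qed.

Let mw : cmeasurable setT w. Proof. exact: cmeasurable_shift. Qed.
Let iF : cintable F. Proof. exact: (annulus_fun_integrable s0 st tr af). Qed.

Let inv_c (x B : R) : x <= t ^+ 4 * B -> 0 <= B -> c^-1 * x <= 2048 / 9 * B / t ^+ 2.
Proof.
move=> xB B0; rewrite ler_pdivlMr ?exprn_gt0 // -[c^-1 * x * _]mulrA ler_pdivrMl //.
have t20 : 0 <= t ^+ 2 by rewrite exprn_ge0 // ltW.
apply: (@le_trans _ _ (t ^+ 4 * B * t ^+ 2)); first by rewrite ler_wpM2r.
have -> : t ^+ 4 * B * t ^+ 2 = (9 / 2048 * t ^+ 6) * (2048 / 9 * B).
  by rewrite !exprS; field.
have h : 0 <= (2048 / 9 : R) by lra.
exact: (ler_wpM2r (mulr_ge0 h B0) cge).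
Qed.

(** The derivative is n! times a Taylor coefficient, an integral of f against
    w^(-n-1); on the annulus |w| >= t / 4, and the L1 norm of f on the disc is
    at most 2t times its L2 norm. *)
Lemma disc_derivative_estimate n :
  t ^+ (n.+1 * 2) * normc (derive1n n f z0) ^+ 2 <=
  (n`!%:R * 4 ^+ n * (4096 / 9)) ^+ 2 * square_integral (disc z0 t) f.
Proof.
have P := power_series_derive1n (n := n) disc_power_series.
rewrite (power_series_center s0 P) add0n ffactnn.
set I := cint _.
have HI : normc I <= t ^+ 4 * ((4 / t) ^+ n * X).
  rewrite mulrA; apply: annulus_kernel_bound => //.
  - by rewrite exprn_ge0 // divr_ge0 // ltW.
  - by apply: cmeasurableV => //; exact: cmeasurableX.
  - exact: disc_L1.1.
  - move=> p sp.
    have wn : 0 < normc (w p) by apply: lt_trans sp.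
    have wN0 : w p != 0 by rewrite -normc_eq0 gt_eqF.
    rewrite exprS invfM mulVKf // Normc.normcV normcX -exprVn.
    apply: lerXn2r; rewrite ?nnegrE ?invr_ge0 ?divr_ge0 ?(ltW t0) //.
    by rewrite -[4 / t]invf_div lef_pV2 ?posrE ?divr_gt0 // ltW.
have B0 : 0 <= (4 / t) ^+ n * X.
  by rewrite mulr_ge0 // exprn_ge0 // divr_ge0 // ltW.
have nf : normc (n`!%:R : R[i]) = n`!%:R.
  by rewrite -(rmorph_nat (real_complex R)) normc_real normr_nat.
rewrite !Normc.normcM Normc.normcV normc_real gtr0_norm // nf.
have H := inv_c HI B0.
have tn0 : 0 < t ^+ n by rewrite exprn_gt0.
have H' : t ^+ n.+1 * (n`!%:R * (c^-1 * normc I)) <=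
    n`!%:R * 4 ^+ n * (2048 / 9) * (X / t).
  rewrite mulrCA.
  apply: (@le_trans _ _ (n`!%:R * (t ^+ n.+1 * (2048 / 9 * ((4 / t) ^+ n * X) / t ^+ 2)))).
    by rewrite ler_wpM2l // ler_wpM2l // exprn_ge0 // ltW.
  rewrite le_eqVlt; apply/orP; left; apply/eqP.
  rewrite expr_div_n exprS; field.
  by rewrite !gt_eqF.
have L0 : 0 <= t ^+ n.+1 * (n`!%:R * (c^-1 * normc I)).
  by rewrite !mulr_ge0 // ?invr_ge0 ?(ltW c0) // exprn_ge0 // ltW.
have -> : t ^+ (n.+1 * 2) * (n`!%:R * (c^-1 * normc I)) ^+ 2 =
   (t ^+ n.+1 * (n`!%:R * (c^-1 * normc I))) ^+ 2 by rewrite [RHS]exprMn -exprM.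
apply: (@le_trans _ _ ((n`!%:R * 4 ^+ n * (2048 / 9) * (X / t)) ^+ 2)).
  exact: ler_sqr_mono L0 H'.
rewrite exprMn expr_div_n.
have Xt : X ^+ 2 / t ^+ 2 <= 4 * square_integral (disc z0 t) f.
  by rewrite ler_pdivrMr ?exprn_gt0 // mulrAC; exact: disc_L1.2.
apply: (le_trans (ler_wpM2l (sqr_ge0 _) Xt)).
rewrite le_eqVlt; apply/orP; left; apply/eqP.
by field.
Qed.

(** The difference of the Cauchy kernels for z and z0 is u / (w (w - u)) with
    u = z - z0, and |w - u| >= t / 8 on the annulus because |u| <= t / 8. *)
Lemma disc_lipschitz_estimate z : normc (z - z0) <= t / 8 ->
  t ^+ 4 * normc (f z - f z0) ^+ 2 <=
  (2048 / 9 * 16) ^+ 2 * normc (z - z0) ^+ 2 * square_integral (disc z0 t) f.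
Proof.
move=> zt; set u := z - z0 in zt *.
have us : normc u < s by apply: le_lt_trans zt _; rewrite /s; have := t0; lra.
have E1 := cauchy_formula s0 st tr af us.
have E0 := @cauchy_formula R z0 s t s0 st r1 f tr af z0.
rewrite subrr Normc.normc0 in E0; have {}E0 := E0 s0.
have mk (v : R[i]) : cmeasurable setT (fun p => (w p - v)^-1).
  by apply: cmeasurableV => //; apply: cmeasurableB => //; exact: cmeasurable_cst.
have h0 p : normc (w p) < s -> F p = 0.
  by move=> h; exact: (annulus_weight_supp s0 st (fun p => f (cplx p)) h).
have ik (v : R[i]) : normc v < s -> cintable (fun p => F p * (w p - v)^-1).
  move=> vs; apply: (@cauchy_kernel_integrable _ z0 s F iF h0 _ ((s - normc v)^-1) (mk v) _).1.
  move=> p sw; rewrite Normc.normcV.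
  have h1 : s - normc v <= normc (w p - v).
    by apply: le_trans (normc_B_ge _ _); rewrite lerD2r.
  by rewrite lef_pV2 ?posrE ?subr_gt0 // (lt_le_trans _ h1) // subr_gt0.
have s00 : normc (0 : R[i]) < s by rewrite Normc.normc0.
pose k p := (w p - u)^-1 - (w p - 0)^-1.
have E : (f z - f z0) * c%:C = cint (fun p => F p * k p).
  rewrite mulrBl -E1 -E0 -cintegralB //; [|exact: ik|exact: ik].
  by apply: eq_cintegral => p _; exact: (esym (mulrBr (F p) (w p - u)^-1 (w p - 0)^-1)).
have HI : normc (cint (fun p => F p * k p)) <= t ^+ 4 * (8 * normc u / t * X).
  rewrite mulrA; apply: annulus_kernel_bound => //.
  - by rewrite divr_ge0 ?mulr_ge0 // ltW.
  - exact: cmeasurableB.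
  - exact: disc_L1.1.
  - move=> p sp.
    have wn : 0 < normc (w p) by apply: lt_trans sp.
    have wN0 : w p != 0 by rewrite -normc_eq0 gt_eqF.
    have h1 : s / 2 <= normc (w p - u).
      apply: le_trans (normc_B_ge _ _); move: sp zt; rewrite -/(w p) /s; lra.
    have h2 : 0 < normc (w p - u) by apply: lt_le_trans h1; rewrite divr_gt0.
    have wuN0 : w p - u != 0 by rewrite -normc_eq0 gt_eqF.
    have -> : w p * k p = u / (w p - u).
      by rewrite /k subr0; field; rewrite wN0 wuN0.
    rewrite Normc.normcM Normc.normcV ler_pdivrMr // mulrAC ler_pdivlMr //.
    rewrite mulrAC [leRHS]mulrC ler_wpM2l //; move: h1; rewrite /s; lra.
have B0 : 0 <= 8 * normc u / t * X.
  by rewrite mulr_ge0 // divr_ge0 ?mulr_ge0 // ltW.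
have H := inv_c HI B0.
have nE : normc (f z - f z0) = c^-1 * normc (cint (fun p => F p * k p)).
  rewrite -E Normc.normcM normc_real gtr0_norm // mulrCA mulVf ?mulr1 //.
  by rewrite gt_eqF.
have tN0 : t != 0 by rewrite gt_eqF.
have H' : t ^+ 2 * normc (f z - f z0) <= 2048 / 9 * 8 * normc u * (X / t).
  rewrite nE; apply: (le_trans (ler_wpM2l (ltW (exprn_gt0 2 t0)) H)).
  by rewrite le_eqVlt; apply/orP; left; apply/eqP; field.
have -> : t ^+ 4 * normc (f z - f z0) ^+ 2 = (t ^+ 2 * normc (f z - f z0)) ^+ 2.
  by rewrite exprMn -exprM.
have L0 : 0 <= t ^+ 2 * normc (f z - f z0) by rewrite mulr_ge0 // exprn_ge0 // ltW.
apply: (@le_trans _ _ ((2048 / 9 * 8 * normc u * (X / t)) ^+ 2)).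
  exact: ler_sqr_mono L0 H'.
rewrite exprMn expr_div_n.
have Xt : X ^+ 2 / t ^+ 2 <= 4 * square_integral (disc z0 t) f.
  by rewrite ler_pdivrMr ?exprn_gt0 // mulrAC; exact: disc_L1.2.
apply: (le_trans (ler_wpM2l (sqr_ge0 _) Xt)).
rewrite le_eqVlt; apply/orP; left; apply/eqP.
by field.
Qed.

End analytic.

(** The averaged Cauchy formula passes to the limit by dominated convergence,
    and a function that satisfies it is a power series. *)
Lemma disc_limit_analytic (u : nat -> R[i]^o -> R[i]^o) (g : R[i]^o -> R[i]^o) (M : R) :
  (forall n v, normc (v - z0) < r1 -> analytic_at (u n) v) ->
  (forall n v, normc (v - z0) < t -> normc (u n v) <= M) ->
  (forall v, normc (v - z0) < t -> (fun n => u n v : R[i]^o) @ \oo --> (g v : R[i]^o)) ->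
  analytic_at g z0.
Proof.
move=> au uM ug.
have M0 : 0 <= M.
  by apply: le_trans (uM 0%N z0 _) => //; rewrite subrr Normc.normc0.
pose F n (p : R * R) := (kap p)%:C * w p * u n (cplx p).
pose G (p : R * R) := (kap p)%:C * w p * g (cplx p).
have iF n : cintable (F n) by exact: (annulus_fun_integrable s0 st tr (au n)).
have FG p : (fun n => F n p : R[i]^o) @ \oo --> (G p : R[i]^o).
  have [k0|/(annulus_weight_neq0 s0 st)/andP[_ h1]] := eqVneq (kap p) 0.
    have C0 : (0 : R)%:C = 0 :> R[i] by [].
    rewrite /F /G k0 C0 !mul0r; under eq_fun do rewrite !mul0r.
    exact: cvg_cst.
  by apply: cvgC_mull; exact: ug.
have FB n p : normc (F n p) <= t * M * kap p.
  rewrite /F !Normc.normcM normc_real ger0_norm ?annulus_weight_ge0 //.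
  have [->|/(annulus_weight_neq0 s0 st)/andP[_ h1]] := eqVneq (kap p) 0.
    by rewrite !mul0r mulr0.
  rewrite -mulrA mulrC ler_wpM2r ?annulus_weight_ge0 //.
  by apply: ler_pM => //; [exact: ltW|exact: uM].
have iK : (area R).-integrable setT (EFin \o (fun p => t * M * kap p)).
  exact: (integrableZl measurableT (t * M) (annulus_weight_integrable z0 t0)).
have mF n : cmeasurable setT (F n) by exact: cintegrable_measurable (iF n).
have mG : cmeasurable setT G.
  by apply: cmeasurable_cvg mF _ => p _; exact: FG.
have iG : cintable G.
  apply: (cintegrable_dominated measurableT mG iK) => p _.
  by apply: (cvgC_le (FG p)); apply: nearW => n; exact: FB.
eexists; exists s; split; first exact: s0.
apply: (cauchy_power_series t0 iG) => z zs.
have su0 : 0 < s - normc (z - z0) by rewrite subr_gt0.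
pose k p := (w p - (z - z0))^-1.
have mk : cmeasurable setT k.
  apply: cmeasurableV => //; apply: cmeasurableB; last exact: cmeasurable_cst.
  exact: cmeasurable_shift.
have kB p : s <= normc (w p) -> normc (k p) <= (s - normc (z - z0))^-1.
  move=> sw; rewrite Normc.normcV.
  have h1 : s - normc (z - z0) <= normc (w p - (z - z0)).
    by apply: le_trans (normc_B_ge _ _); rewrite lerD2r.
  by rewrite lef_pV2 ?posrE // (lt_le_trans _ h1).
have L : (fun n => cint (fun p => F n p * k p) : R[i]^o) @ \oo -->
    (cint (fun p => G p * k p) : R[i]^o).
  apply: (cintegral_dominated_cvg measurableT (g := fun p => (s - normc (z - z0))^-1 * (t * M * kap p))).
  - by move=> n; exact: cmeasurableM.
  - exact: (integrableZl measurableT ((s - normc (z - z0))^-1) iK).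
  - move=> n p _; rewrite Normc.normcM mulrC.
    have [hp|hp] := ltP (normc (w p)) s.
      have -> : F n p = 0 by exact: (annulus_weight_supp s0 st (fun p => u n (cplx p)) hp).
      rewrite Normc.normc0 mulr0.
      by rewrite mulr_ge0 ?invr_ge0 ?(ltW su0) // !mulr_ge0 // ?(ltW t0) // annulus_weight_ge0.
    by apply: ler_pM => //; exact: kB.
  - by move=> p _; apply: cvgC_mulr; exact: FG.
apply: (cvgC_unique L).
have E n : cint (fun p => F n p * k p) = u n z * c%:C.
  exact: (cauchy_formula s0 st tr (au n) zs).
rewrite (_ : (fun n => _) = (fun n => u n z * c%:C)); last by apply/funext => n; exact: E.
by apply: cvgC_mulr; apply: ug; exact: lt_trans zs st.
Qed.

End DiscEstimates.

(** * The Bergman space of the half-plane *)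

Section BergmanSpace.
Variable R : realType.
Local Notation cfun := (R[i]^o -> R[i]^o).
Implicit Types f g : cfun.
Local Notation Pi := (halfplane R).

Lemma halfplane_open : open Pi.
Proof.
apply: (@open_comp _ _ (fun p : R * R => p.2) [set x | 0 < x]); last exact: open_gt.
by move=> p _; exact: cvg_snd.
Qed.

Lemma measurable_halfplane : measurable Pi.
Proof. by apply: open_measurable_plane; exact: halfplane_open. Qed.
Local Notation mPi := measurable_halfplane.

Lemma near_halfplane (p : R * R) (v : R[i]) (t : R) :
  normc (v - cplx p) < t -> p.2 - t < Im v < p.2 + t.
Proof.
move=> h; have := le_lt_trans (Im_le_normc _) h; rewrite ImB /= ltr_norml; lra.
Qed.

Lemma disc_halfplane (p : R * R) (t : R) : 0 < t -> t <= p.2 -> disc (cplx p) t `<=` Pi.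
Proof.
move=> t0 tp q /(disc_normc _ _ t0) /near_halfplane /=; rewrite /halfplane /=; lra.
Qed.

Lemma bergman_analytic_disc f (p : R * R) : bergman f ->
  forall v, normc (v - cplx p) < p.2 -> analytic_at f v.
Proof. by move=> [af _ _] v /near_halfplane; rewrite subrr => /andP[h _]; exact: af. Qed.

Lemma bergman_ccont f (p : R * R) n : bergman f -> Pi p -> ccont (derive1n n f) (cplx p).
Proof.
move=> [af _ _] hp; apply: cderiv_ccont; apply: analytic_cderiv.
by apply: analytic_derive1n; exact: af.
Qed.

Lemma bergman_derive_cmeasurable f n : bergman f -> cmeasurable Pi (fun p => derive1n n f (cplx p)).
Proof.
move=> bf; split; apply: open_continuous_measurable_plane; try exact: halfplane_open.
  by move=> p; rewrite inE => hp; apply: ccont_continuous_Re; exact: bergman_ccont.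
by move=> p; rewrite inE => hp; apply: ccont_continuous_Im; exact: bergman_ccont.
Qed.

Lemma bergman_cmeasurable f : bergman f -> cmeasurable Pi (fun p => f (cplx p)).
Proof. by move/(bergman_derive_cmeasurable 0). Qed.

Lemma measurable_sqr_normc f : bergman f ->
  measurable_fun Pi (fun p => normc (f (cplx p)) ^+ 2).
Proof. by move=> bf; apply: measurable_funX; apply: cmeasurable_normc; exact: bergman_cmeasurable. Qed.

Lemma bergman_L2 f : bergman f ->
  (area R).-integrable Pi (EFin \o (fun p => normc (f (cplx p)) ^+ 2)).
Proof.
move=> bf; have mf : measurable_fun Pi (fun p => (normc (f (cplx p)) ^+ 2)%:E).
  by apply/measurable_EFinP; exact: measurable_sqr_normc.
apply/integrableP; split; first exact: mf.
case: bf => _ _; apply: le_lt_trans; apply: ge0_le_integral => //; first exact: mPi.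
- exact: measurableT_comp.
- by move=> p _; rewrite /= ger0_norm // sqr_ge0.
Qed.

(** The squared Bergman norm. *)
Definition bergman_sq f : R := square_integral Pi f.

Lemma bergman_sq_ge0 f : 0 <= bergman_sq f.
Proof. by apply: Rintegral_ge0 => p _; exact: sqr_ge0. Qed.

Lemma square_integral_le_bergman_sq f (D : set (R * R)) : bergman f -> measurable D -> D `<=` Pi ->
  square_integral D f <= bergman_sq f.
Proof.
move=> bf mD DP; rewrite /bergman_sq /square_integral /Rintegral fine_le //.
- apply: integrable_fin_num => //; exact: integrableS mPi mD DP (bergman_L2 bf).
- by apply: integrable_fin_num; [exact: mPi|exact: bergman_L2].
- apply: ge0_subset_integral => //; first exact: mPi.
    by apply/measurable_EFinP; exact: measurable_sqr_normc.
  by move=> p _; rewrite lee_fin sqr_ge0.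
Qed.

Lemma bergman_innerE f g : bergman_inner f g =
  cintegral (area R) Pi (fun p => f (cplx p) * (g (cplx p))^*).
Proof. by []. Qed.

Lemma inner_integrable f g : bergman f -> bergman g ->
  cintegrable (area R) Pi (fun p => f (cplx p) * (g (cplx p))^*).
Proof.
move=> bf bg.
apply: (cintegrable_dominated mPi _ (integrableD mPi (bergman_L2 bf) (bergman_L2 bg))).
  apply: cmeasurableM; first exact: bergman_cmeasurable.
  by apply: cmeasurable_conj; exact: bergman_cmeasurable.
move=> p _ /=; rewrite Normc.normcM normc_conj.
have h := sqr_ge0 (normc (f (cplx p)) - normc (g (cplx p))).
have h1 := normc_ge0 (f (cplx p)); have h2 := normc_ge0 (g (cplx p)).
set x := normc _ in h h1 *; set y := normc _ in h h2 *.
have xy : 0 <= x * y by rewrite mulr_ge0.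
rewrite sqrrB in h; lra.
Qed.

Lemma power_series_lin (a : R[i]) f g v r r' c d :
  power_series_on f v r c -> power_series_on g v r' d ->
  power_series_on (a *: f + g : cfun) v (Num.min r r') (fun j => a * c j + d j).
Proof.
move=> fc gd z; rewrite lt_min => /andP[zr zr'].
have H := cvgC_add (cvgC_mull (c := a) (fc z zr)) (gd z zr').
rewrite (_ : (fun n => _) = (fun n => a * (\sum_(j < n) c j * (z - v) ^+ j) +
   \sum_(j < n) d j * (z - v) ^+ j)); first exact: H.
apply/funext => n; rewrite mulr_sumr -big_split /=; apply: eq_bigr => j _.
by rewrite mulrDl mulrA.
Qed.

Lemma analytic_lin (a : R[i]) f g v : analytic_at f v -> analytic_at g v ->
  analytic_at (a *: f + g) v.
Proof.
move=> [c [r [r0 fc]]] [d [r' [r'0 gd]]].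
exists (fun j => a * c j + d j), (Num.min r r'); split.
  by rewrite lt_min; apply/andP; split.
exact: power_series_lin fc gd.
Qed.

Lemma derive1n_lin (a : R[i]) f g v n : analytic_at f v -> analytic_at g v ->
  derive1n n (a *: f + g : cfun) v = a * derive1n n f v + derive1n n g v.
Proof.
move=> [c [r [r0 fc]]] [d [r' [r'0 gd]]].
have m0 : 0 < Num.min r r' by rewrite lt_min; apply/andP; split.
rewrite (power_series_center m0 (power_series_derive1n (n := n) (power_series_lin (a := a) fc gd))).
rewrite (power_series_center r0 (power_series_derive1n (n := n) fc)).
rewrite (power_series_center r'0 (power_series_derive1n (n := n) gd)).
by rewrite mulrDr mulrCA.
Qed.

Lemma bergman_lin (a : R[i]) f g : bergman f -> bergman g -> bergman (a *: f + g).
Proof.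
move=> bf bg; have [af zf _] := bf; have [ag zg _] := bg; split.
- by move=> z hz; apply: analytic_lin; [exact: af|exact: ag].
- move=> z hz; have -> : (a *: f + g) z = a * f z + g z by [].
  by rewrite zf // zg // mulr0 addr0.
- have i1 := integrableZl mPi (2 * normc a ^+ 2) (bergman_L2 bf).
  have i2 := integrableZl mPi 2 (bergman_L2 bg).
  have := integrable_lty mPi (integrableD mPi i1 i2); apply: le_lt_trans.
  apply: ge0_le_integral => //; first exact: mPi.
  + by move=> p _; rewrite lee_fin sqr_ge0.
  + apply/measurable_EFinP; apply: measurable_funX; apply: cmeasurable_normc.
    apply: (@cmeasurableD _ _ _ _ (fun p => a * f (cplx p)) (fun p => g (cplx p))).
      by apply: cmeasurableM; [exact: cmeasurable_cst|exact: bergman_cmeasurable].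
    exact: bergman_cmeasurable.
  + exact: (measurable_int _ (integrableD mPi i1 i2)).
  move=> p _ /=; rewrite lee_fin.
  have -> : (a *: f + g) (cplx p) = a * f (cplx p) + g (cplx p) by [].
  apply: (@le_trans _ _ ((normc (a * f (cplx p)) + normc (g (cplx p))) ^+ 2)).
    by apply: ler_sqr_mono => //; exact: normcD.
  rewrite Normc.normcM -mulrA -exprMn.
  have := sqr_ge0 (normc a * normc (f (cplx p)) - normc (g (cplx p))).
  by rewrite sqrrB sqrrD; lra.
Qed.

Lemma bergman0 : bergman (0 : cfun).
Proof.
split => // [z _|].
  exists (fun=> 0), 1; split; first exact: ltr01.
  move=> v _; rewrite (_ : (fun n => _) = (fun=> (0 : R[i]^o))); first exact: cvg_cst.
  by apply/funext => n; rewrite big1 // => j _; rewrite mul0r.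
rewrite integral0_eq ?ltry // => p _.
by have -> : (0 : cfun) (cplx p) = 0 by []; rewrite Normc.normc0 expr0n.
Qed.

Lemma bergmanZ (a : R[i]) f : bergman f -> bergman (a *: f).
Proof. by move=> bf; rewrite -[_ *: _]addr0; exact: bergman_lin bf bergman0. Qed.

Lemma bergmanD f g : bergman f -> bergman g -> bergman (f + g).
Proof. by move=> bf bg; rewrite -[f]scale1r; exact: bergman_lin. Qed.

Lemma bergmanN f : bergman f -> bergman (- f).
Proof. by move=> bf; rewrite -scaleN1r; exact: bergmanZ. Qed.

Lemma bergmanB f g : bergman f -> bergman g -> bergman (f - g).
Proof. by move=> bf /bergmanN; exact: bergmanD. Qed.

Lemma inner_linl (a : R[i]) f g h : bergman f -> bergman g -> bergman h ->
  bergman_inner (a *: f + g) h = a * bergman_inner f h + bergman_inner g h.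
Proof.
move=> bf bg bh; rewrite !bergman_innerE.
have i1 := inner_integrable bf bh; have i2 := inner_integrable bg bh.
rewrite -cintegralZ //; last exact: mPi.
rewrite -cintegralD //; [|exact: mPi|by apply: cintegrableZ => //; exact: mPi].
apply: eq_cintegral => p _.
have -> : (a *: f + g) (cplx p) = a * f (cplx p) + g (cplx p) by [].
by rewrite mulrDl mulrA.
Qed.

Lemma inner_conj f g : bergman f -> bergman g ->
  bergman_inner g f = (bergman_inner f g)^*.
Proof.
move=> bf bg; rewrite !bergman_innerE -cintegral_conj //; [|exact: mPi|exact: inner_integrable].
by apply: eq_cintegral => p _; rewrite conjcM conjCK mulrC.
Qed.

Lemma inner_bergman_sq f : bergman f -> bergman_inner f f = (bergman_sq f)%:C.
Proof.
move=> bf; rewrite bergman_innerE /cintegral /bergman_sq /square_integral.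
congr (_ +i* _).
  by apply: eq_Rintegral => p _; rewrite mulc_conj.
by rewrite /Rintegral integral0_eq // => p _; rewrite mulc_conj.
Qed.

Lemma bergman_normE f : bergman f -> bergman_norm f = Num.sqrt (bergman_sq f).
Proof. by move=> bf; rewrite /bergman_norm inner_bergman_sq. Qed.

(** The constant of [disc_derivative_estimate]. *)
Definition derivative_const (n : nat) : R := (n`!%:R * 4 ^+ n * (4096 / 9)) ^+ 2.

Lemma derivative_const_ge0 n : 0 <= derivative_const n.
Proof. exact: sqr_ge0. Qed.

Lemma bergman_disc_L2 f (p : R * R) t : bergman f -> 0 < t -> t <= p.2 ->
  (area R).-integrable (disc (cplx p) t) (EFin \o (fun q => normc (f (cplx q)) ^+ 2)).
Proof.
move=> bf t0 tp; apply: integrableS (bergman_L2 bf) => //; first exact: mPi.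
  exact: measurable_disc.
exact: disc_halfplane.
Qed.

Lemma bergman_derivative_estimate f n (p : R * R) t : bergman f -> 0 < t -> t < p.2 ->
  t ^+ (n.+1 * 2) * normc (derive1n n f (cplx p)) ^+ 2 <=
  derivative_const n * square_integral (disc (cplx p) t) f.
Proof.
move=> bf t0 tp; apply: (disc_derivative_estimate t0 tp (bergman_analytic_disc bf)).
exact: bergman_disc_L2 bf t0 (ltW tp).
Qed.

Lemma bergman_point_estimate f (p : R * R) t : bergman f -> 0 < t -> t < p.2 ->
  t ^+ 2 * normc (f (cplx p)) ^+ 2 <= derivative_const 0 * bergman_sq f.
Proof.
move=> bf t0 tp; apply: le_trans (bergman_derivative_estimate 0 bf t0 tp) _.
apply: (ler_wpM2l (derivative_const_ge0 0)); apply: square_integral_le_bergman_sq => //.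
  exact: measurable_disc.
exact: disc_halfplane t0 (ltW tp).
Qed.

(** Values at points are bounded by the norm. *)
Lemma bergman_sq_eq0 f : bergman f -> bergman_sq f = 0 -> f = 0.
Proof.
move=> bf f0; apply/funext => v; have [_ zf _] := bf.
have [hv|hv] := leP (Im v) 0; first exact: zf.
have t0 : 0 < Im v / 2 by rewrite divr_gt0.
have tv : Im v / 2 < (Re v, Im v).2 by rewrite /=; lra.
have := bergman_point_estimate bf t0 tv; rewrite f0 mulr0.
have -> : cplx (Re v, Im v) = v by case: (v).
move=> h; have : normc (f v) ^+ 2 = 0.
  apply/eqP; rewrite eq_le sqr_ge0 andbT.
  by move: h; rewrite pmulr_rle0 // exprn_gt0.
by move/eqP; rewrite expf_eq0 /= normc_eq0 => /eqP.
Qed.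

(** A bound on the norms is a uniform bound on the values away from the real
    axis, so the limit is analytic by [disc_limit_analytic]; its norm is bounded
    by Fatou's lemma. *)
Lemma bergman_pointwise_limit (u : nat -> cfun) (l : cfun) (B : R) :
  (forall n, bergman (u n)) -> (forall n, bergman_sq (u n) <= B) ->
  (forall v : R[i], Im v <= 0 -> l v = 0) ->
  (forall v : R[i], 0 < Im v -> (fun n => u n v : R[i]^o) @ \oo --> (l v : R[i]^o)) ->
  bergman l /\ bergman_sq l <= B.
Proof.
move=> bu uB l0 ul.
have al v : 0 < Im v -> analytic_at l v.
  move=> hv; pose p := (Re v, Im v); have pv : cplx p = v by rewrite /p; case: (v).
  pose t := Im v / 4; have t0 : 0 < t by rewrite divr_gt0.
  have tv : t < Im v by rewrite /t; lra.
  apply: (@disc_limit_analytic _ v t (Im v) t0 tv u l (Num.sqrt (derivative_const 0 * B / t ^+ 2))).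
  - by move=> n z; rewrite -pv => hz; apply: bergman_analytic_disc (bu n) z hz.
  - move=> n z hz; rewrite -pv in hz; have := near_halfplane hz => /= /andP[hz1 _].
    pose q := (Re z, Im z); have qz : cplx q = z by rewrite /q; case: (z).
    have tq : t < q.2 by rewrite /= /t in hz1 *; lra.
    have := bergman_point_estimate (bu n) t0 tq; rewrite qz => H.
    rewrite -[normc _]ger0_norm // -sqrtr_sqr ler_wsqrtr // ler_pdivlMr ?exprn_gt0 // mulrC.
    apply: le_trans H _; exact: (ler_wpM2l (derivative_const_ge0 0)).
  - move=> z hz; apply: ul; rewrite -pv in hz.
    by have := near_halfplane hz => /= /andP[hz1 _]; rewrite /t in hz1; lra.
have upl p : Pi p -> (fun n => u n (cplx p) : R[i]^o) @ \oo --> (l (cplx p) : R[i]^o).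
  by move=> hp; exact: ul.
have F : (\int[area R]_(p in Pi) (normc (l (cplx p)) ^+ 2)%:E <= B%:E)%E.
  have mu_ n : measurable_fun Pi (fun p => (normc (u n (cplx p)) ^+ 2)%:E).
    by apply/measurable_EFinP; exact: measurable_sqr_normc.
  have f0 n p : Pi p -> (0 <= (normc (u n (cplx p)) ^+ 2)%:E)%E.
    by move=> _; rewrite lee_fin sqr_ge0.
  have := fatou (area R) mPi mu_ f0.
  rewrite (eq_integral (fun p => (normc (l (cplx p)) ^+ 2)%:E)); last first.
    move=> p; rewrite inE => hp.
    have H : (normc (u n (cplx p)) ^+ 2)%:E @[n --> \oo] --> (normc (l (cplx p)) ^+ 2)%:E.
      apply: cvg_EFin; first by apply: nearW.
      have h : normc (u n (cplx p)) @[n --> \oo] --> normc (l (cplx p)).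
        by apply: cvgC_normc; exact: upl.
      exact: (cvgM h h).
    by rewrite (cvg_limn_einf_sup H).1.
  move/le_trans; apply; rewrite limn_einf_lim.
  apply: lime_le; first exact: is_cvg_einfs.
  apply: nearW => n; apply: (@le_trans _ _ (\int[area R]_(p in Pi) (normc (u n (cplx p)) ^+ 2)%:E)%E).
    by apply: ereal_inf_lbound; exists n => /=.
  rewrite -[leLHS]fineK ?lee_fin; first exact: uB.
  by apply: integrable_fin_num; [exact: mPi|exact: bergman_L2].
have bl : bergman l by split => //; exact: le_lt_trans F (ltry _).
split => //; rewrite -lee_fin /bergman_sq /square_integral /Rintegral fineK //.
by apply: integrable_fin_num; [exact: mPi|exact: bergman_L2].
Qed.

End BergmanSpace.

(** * Compactness of bounded sequences *)

Section SequentialCompactness.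
Variable R : realType.

Lemma strictly_increasing_ge_id (phi : nat -> nat) : {homo phi : m n / (m < n)%N} -> forall n, (n <= phi n)%N.
Proof.
by move=> hphi; elim=> [//|n ih]; exact: leq_ltn_trans ih (hphi _ _ (ltnSn n)).
Qed.

Lemma real_cauchy_cvg (u : nat -> R) :
  (forall e : R, 0 < e -> exists N, forall n, (N <= n)%N -> `|u N - u n| < e) ->
  exists l : R, u @ \oo --> l.
Proof.
move=> h; have : cauchy (u @ \oo).
  apply: cauchy_exP => e e0; have [N hN] := h e e0; exists (u N).
  by exists N => // n Nn; rewrite -ball_normE /=; exact: hN.
by move/cauchy_cvg => hc; exists (lim (u @ \oo)).
Qed.

Lemma invS_small (e : R) : 0 < e -> exists N, forall n, (N <= n)%N -> n.+1%:R^-1 < e.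
Proof.
move=> e0; exists (Num.truncn e^-1) => n hn.
rewrite -ltf_pV2 ?posrE ?invr_gt0 ?ltr0n // invrK.
by apply: (lt_le_trans (truncnS_gt _)); rewrite ler_nat ltnS.
Qed.

(** The terms lie in a product of segments, compact by Tychonoff's theorem, so
    they cluster at some c; the k-th index is chosen so that the first k + 1
    coordinates are within 1/(k+1) of those of c. *)
Lemma diagonal_subsequence (x : nat -> nat -> R) (B : nat -> R) :
  (forall n i, `|x n i| <= B i) ->
  exists phi : nat -> nat, {homo phi : m n / (m < n)%N} /\
    exists c : nat -> R, forall i, (fun n => x (phi n) i) @ \oo --> c i.
Proof.
move=> xB; pose A i : set R := `[- B i, B i]%classic.
have cA := @tychonoff nat (fun=> R : topologicalType) A (fun i => @segment_compact R (- B i) (B i)).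
have xA : \forall n \near \oo, [set f : nat -> R | forall i, A i (f i)] (x n).
  by apply: nearW => n i; rewrite /A /= in_itv /= -ler_norml.
have [c [_ clc]] := cA ((x : nat -> prod_topology (fun _ : nat => R)) @ \oo) _ xA.
pose V k := [set f : prod_topology (fun _ : nat => R) | forall i, (i <= k)%N -> `|f i - c i| < k.+1%:R^-1].
have pc i (e : R) : 0 < e -> nbhs (c : prod_topology (fun _ : nat => R)) [set f : nat -> R | `|c i - f i| < e].
  move=> e0; have h := @proj_continuous nat (fun _ : nat => (R : topologicalType)) i c.
  have b : nbhs (c i) (ball (c i) e) by exact: nbhsx_ballx.
  have hb := h _ b.
  refine (@filterS _ (nbhs (c : prod_topology (fun _ : nat => R))) _ _ _ _ hb).
  move=> f hf; have : ball (c i) e (f i) by exact: hf.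
  by rewrite -ball_normE.
have FF : Filter (nbhs (c : prod_topology (fun _ : nat => R))) by exact: nbhs_filter.
have nbV k : nbhs (c : prod_topology (fun _ : nat => R)) (V k).
  have k0 : 0 < k.+1%:R^-1 :> R by rewrite invr_gt0 ltr0n.
  rewrite /V; move: (k.+1%:R^-1 : R) k0 => m m0.
  elim: k => [|k ih].
    move: (pc 0%N m m0).
    apply: filterS => f /= hf i; rewrite leqn0 => /eqP ->; by rewrite distrC.
  move: ih (pc k.+1 m m0); apply: filterS2 => f ih hf i; rewrite leq_eqVlt => /orP[/eqP ->|].
    by rewrite distrC.
  exact: ih.
have ext (Nk : nat * nat) : exists n, (Nk.1 < n)%N /\ V Nk.2 (x n).
  have [] := clc (x @` [set n | (Nk.1 < n)%N]) (V Nk.2) _ (nbV _).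
    by exists Nk.1.+1 => // n /= hn; exists n.
  by move=> f [[n /= hn <-] hV]; exists n.
have [g hg] := choice ext.
pose phi := fix phi k := if k is k'.+1 then g (phi k', k'.+1) else g (0%N, 0%N).
have hphi k : V k (x (phi k)) by case: k => [|k]; [exact: (hg (0%N, 0%N)).2|exact: (hg (phi k, k.+1)).2].
exists phi; split.
  by apply: homo_ltn; [exact: ltn_trans|move=> k; exact: (hg (phi k, k.+1)).1].
exists c => i; apply/cvgrPdist_lt => e e0; have [N hN] := invS_small e0.
exists (maxn N i) => // k /= hk; rewrite distrC; apply: (lt_trans (hphi k i _)).
  exact: leq_trans (leq_maxr _ _) hk.
by apply: hN; exact: leq_trans (leq_maxl _ _) hk.
Qed.

End SequentialCompactness.

Section Montel.
Variable R : realType.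
Local Notation cfun := (R[i]^o -> R[i]^o).

Definition rational_point (q : rat * rat) : R * R := (ratr q.1, ratr q.2).

(** Lists the real and imaginary parts of the values of f at all rational
    points in one sequence, the form [diagonal_subsequence] takes. *)
Definition rational_value (f : cfun) (i : nat) : R :=
  if unpickle i is Some (q, b) then
    if (b : bool) then Re (f (cplx (rational_point q))) else Im (f (cplx (rational_point q)))
  else 0.

Lemma rational_value_Re f q : rational_value f (pickle (q : rat * rat, true)) = Re (f (cplx (rational_point q))).
Proof. by rewrite /rational_value pickleK. Qed.

Lemma rational_value_Im f q : rational_value f (pickle (q : rat * rat, false)) = Im (f (cplx (rational_point q))).
Proof. by rewrite /rational_value pickleK. Qed.

Lemma bergman_value_bounded (v : R[i]) (B : R) : exists M : R, forall f : cfun,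
  bergman f -> bergman_sq f <= B -> normc (f v) <= M.
Proof.
have [hv|hv] := leP (Im v) 0.
  by exists 0 => f [_ zf _] _; rewrite zf // Normc.normc0.
pose t := Im v / 2; have t0 : 0 < t by rewrite divr_gt0.
exists (Num.sqrt (derivative_const R 0 * B / t ^+ 2)) => f bf fB.
have tv : t < (Re v, Im v).2 by rewrite /t /=; lra.
have := bergman_point_estimate bf t0 tv.
have -> : cplx (Re v, Im v) = v by case: (v).
move=> H; rewrite -[normc _]ger0_norm // -sqrtr_sqr ler_wsqrtr // ler_pdivlMr ?exprn_gt0 // mulrC.
apply: le_trans H _; exact: (ler_wpM2l (derivative_const_ge0 R 0)).
Qed.

Lemma rational_value_bounded (B : R) i : exists M : R, forall f : cfun,
  bergman f -> bergman_sq f <= B -> `|rational_value f i| <= M.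
Proof.
rewrite /rational_value; case: (unpickle i) => [[q b]|]; last by exists 0 => f _ _; rewrite normr0.
have [M hM] := bergman_value_bounded (cplx (rational_point q)) B.
exists M => f bf fB; case: b; [apply: le_trans (Re_le_normc _) _|apply: le_trans (Im_le_normc _) _];
  exact: hM.
Qed.

Lemma bergman_equicontinuous (v : R[i]) (B e : R) : 0 < Im v -> 0 < e ->
  exists d : R, 0 < d /\ forall (f : cfun) z, bergman f -> bergman_sq f <= B ->
    normc (z - v) < d -> normc (f z - f v) < e.
Proof.
move=> hv e0; pose t := Im v / 2; have t0 : 0 < t by rewrite divr_gt0.
have tv : t < (Re v, Im v).2 by rewrite /t /=; lra.
have pv : cplx (Re v, Im v) = v by case: (v).
pose C := (2048 / 9 * 16) ^+ 2 * (`|B| + 1) / t ^+ 4.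
have C0 : 0 < C.
  apply: divr_gt0; last exact: exprn_gt0.
  by apply: mulr_gt0; [apply: exprn_gt0; lra|rewrite ltr_wpDl].
pose d := Num.min (t / 8) (e / Num.sqrt C).
exists d; split; first by rewrite lt_min divr_gt0 //= divr_gt0 // sqrtr_gt0.
move=> f z bf fB; rewrite lt_min => /andP[zt ze].
have := disc_lipschitz_estimate t0 tv (bergman_analytic_disc (p := (Re v, Im v)) bf)
  (bergman_disc_L2 bf t0 (ltW tv)) (z := z).
rewrite pv => /(_ (ltW zt)) H.
have sB : square_integral (disc v t) f <= `|B| + 1.
  apply: le_trans (_ : bergman_sq f <= _).
    apply: square_integral_le_bergman_sq => //; first exact: measurable_disc.
    by rewrite -pv; exact: disc_halfplane t0 (ltW tv).
  by apply: (le_trans fB); apply: (le_trans (ler_norm _)); rewrite lerDl.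
have H2 : normc (f z - f v) ^+ 2 <= C * normc (z - v) ^+ 2.
  rewrite /C mulrAC ler_pdivlMr ?exprn_gt0 // [leLHS]mulrC; apply: (le_trans H).
  rewrite [leRHS]mulrAC; apply: ler_wpM2l; last exact: sB.
  by rewrite -exprMn; exact: sqr_ge0.
rewrite -[ltLHS]ger0_norm // -sqrtr_sqr; apply: (le_lt_trans (ler_wsqrtr H2)).
rewrite sqrtrM ?(ltW C0) // sqrtr_sqr ger0_norm // mulrC -ltr_pdivlMr //.
by rewrite sqrtr_gt0.
Qed.

Lemma rational_dense (v : R[i]) (d : R) : 0 < d ->
  exists q : rat * rat, normc ((cplx (rational_point q) : R[i]) - v) < d.
Proof.
move=> d0; have h (x : R) : exists q : rat, `|ratr q - x| < d / 2.
  have [q] : exists q, ratr q \in `]x - d / 2, x + d / 2[ by apply: rat_in_itvoo; lra.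
  by rewrite in_itv /= => /andP[h1 h2]; exists q; rewrite ltr_norml; apply/andP; split; lra.
have [a ha] := h (Re v); have [b hb] := h (Im v); exists (a, b).
by apply: le_lt_trans (normc_le_ReIm _) _; rewrite ReB ImB /=; lra.
Qed.

(** A diagonal subsequence converges at the rational points.  By
    equicontinuity its values at every point are then Cauchy, and the limit is
    in the space by [bergman_pointwise_limit]. *)
Lemma bergman_montel (u : nat -> cfun) (B : R) :
  (forall n, bergman (u n)) -> (forall n, bergman_sq (u n) <= B) ->
  exists (phi : nat -> nat) (l : cfun), [/\ {homo phi : m n / (m < n)%N},
    bergman l, bergman_sq l <= B &
    forall v : R[i], 0 < Im v ->
      (fun n => u (phi n) v : R[i]^o) @ \oo --> (l v : R[i]^o)].
Proof.
move=> bu uB; have [M hM] := choice (rational_value_bounded B).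
have [phi [hphi [c hc]]] := diagonal_subsequence (fun n i => hM i (u n) (bu n) (uB n)).
have cau v : 0 < Im v -> forall e : R, 0 < e -> exists N, forall n, (N <= n)%N ->
    normc (u (phi N) v - u (phi n) v) < e.
  move=> hv e e0; have e8 : 0 < e / 8 by rewrite divr_gt0.
  have [d [d0 hd]] := bergman_equicontinuous B hv e8.
  have [q hq] := rational_dense v d0.
  have /cvgrPdist_lt/(_ _ e8)[N1 _ h1] := hc (pickle (q, true)).
  have /cvgrPdist_lt/(_ _ e8)[N2 _ h2] := hc (pickle (q, false)).
  exists (maxn N1 N2) => n hn; set N := maxn N1 N2 in hn *.
  have g m : (N <= m)%N -> normc (u (phi m) v - (c (pickle (q, true)) +i* c (pickle (q, false)))) < 3 * (e / 8).
    move=> hm; set z := cplx (rational_point q) in hq.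
    have k1 := hd _ _ (bu (phi m)) (uB _) hq.
    have k2 := h1 m (leq_trans (leq_maxl _ _) hm).
    have k3 := h2 m (leq_trans (leq_maxr _ _) hm).
    rewrite /= rational_value_Re distrC in k2; rewrite /= rational_value_Im distrC in k3.
    have -> : u (phi m) v - (c (pickle (q, true)) +i* c (pickle (q, false))) =
      (u (phi m) v - u (phi m) z) + (u (phi m) z - (c (pickle (q, true)) +i* c (pickle (q, false)))).
      by rewrite addrA subrK.
    apply: (le_lt_trans (normcD _ _)); rewrite normcBC.
    have := normc_le_ReIm (u (phi m) z - (c (pickle (q, true)) +i* c (pickle (q, false)))).
    rewrite ReB ImB /= => k4; rewrite -/z in k2 k3; move: k1 k2 k3 k4; clear; lra.
  have g1 := g N (leqnn _); have g2 := g n hn.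
  set w := _ +i* _ in g1 g2.
  have -> : u (phi N) v - u (phi n) v = (u (phi N) v - w) - (u (phi n) v - w).
    by rewrite opprB addrA subrK.
  by apply: (le_lt_trans (normcB _ _)); lra.
have lim v : exists l : R[i]^o, (0 < Im v -> (fun n => u (phi n) v : R[i]^o) @ \oo --> l) /\
    (Im v <= 0 -> l = 0).
  have [hv|hv] := leP (Im v) 0; first by exists 0.
  have [a ha] : exists a : R, Re (u (phi n) v) @[n --> \oo] --> a.
    apply: real_cauchy_cvg => e e0; have [N hN] := cau v hv e e0; exists N => n /hN.
    by apply: le_lt_trans; rewrite -ReB; exact: Re_le_normc.
  have [b hb] : exists b : R, Im (u (phi n) v) @[n --> \oo] --> b.
    apply: real_cauchy_cvg => e e0; have [N hN] := cau v hv e e0; exists N => n /hN.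
    by apply: le_lt_trans; rewrite -ImB; exact: Im_le_normc.
  by exists (a +i* b); split => // _; exact: cvgC_ReIm.
have [l hl] := choice lim.
have [bl lB] := bergman_pointwise_limit (fun n => bu (phi n)) (fun n => uB (phi n))
  (fun v => (hl v).2) (fun v => (hl v).1).
by exists phi, l; split => // v; exact: (hl v).1.
Qed.

End Montel.

(** * Riesz representation *)

Lemma cvg_subseq (T : topologicalType) (u : nat -> T) (l : T) (phi : nat -> nat) :
  (forall n, (n <= phi n)%N) -> u @ \oo --> l -> (fun n => u (phi n)) @ \oo --> l.
Proof.
move=> hphi ul; apply: (cvg_comp phi u _ ul) => A [N _ hN].
by exists N => // n /= hn; apply: hN; exact: leq_trans hn (hphi n).
Qed.

Section Riesz.
Variable R : realType.
Local Notation cfun := (R[i]^o -> R[i]^o).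
Implicit Types f g h : cfun.

Definition real_inner f g : R := Re (bergman_inner f g).

Lemma rinnerC f g : bergman f -> bergman g -> real_inner g f = real_inner f g.
Proof. by move=> bf bg; rewrite /real_inner (inner_conj bf bg) Re_conj. Qed.

Lemma real_inner_lin (t : R) f g h : bergman f -> bergman g -> bergman h ->
  real_inner (t%:C *: f + g) h = t * real_inner f h + real_inner g h.
Proof.
by move=> bf bg bh; rewrite /real_inner inner_linl // ReD ReM /= mul0r subr0.
Qed.

Lemma real_inner_sub f g h : bergman f -> bergman g -> bergman h ->
  real_inner (f - g) h = real_inner f h - real_inner g h.
Proof.
move=> bf bg bh; have -> : f - g = (-1)%:C *: g + f.
  by rewrite rmorphN1 scaleN1r addrC.
by rewrite real_inner_lin // mulN1r addrC.
Qed.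

Lemma real_inner_bergman_sq f : bergman f -> real_inner f f = bergman_sq f.
Proof. by move=> bf; rewrite /real_inner inner_bergman_sq. Qed.

Lemma bergman_sq_lin (t : R) f g : bergman f -> bergman g ->
  bergman_sq (f + t%:C *: g) = bergman_sq f + 2 * t * real_inner f g + t ^+ 2 * bergman_sq g.
Proof.
move=> bf bg; have bh : bergman (t%:C *: g + f) by exact: bergman_lin.
rewrite addrC -(real_inner_bergman_sq bh) real_inner_lin // (rinnerC bh bg) (rinnerC bh bf).
rewrite !real_inner_lin // !real_inner_bergman_sq // (rinnerC bf bg); ring.
Qed.

Lemma bergman_sq_sub f g : bergman f -> bergman g ->
  bergman_sq (f - g) = bergman_sq f - 2 * real_inner f g + bergman_sq g.
Proof.
move=> bf bg; have := bergman_sq_lin (-1) bf bg.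
by rewrite rmorphN1 scaleN1r => ->; ring.
Qed.

Lemma bergman_sq_mid f g : bergman f -> bergman g ->
  bergman_sq ((2^-1)%:C *: (f + g)) = (bergman_sq f + 2 * real_inner f g + bergman_sq g) / 4.
Proof.
move=> bf bg; have bfg := bergmanD bf bg.
have := bergman_sq_lin 2^-1 (bergman0 R) bfg.
have := bergman_sq_lin 1 bf bg; rewrite rmorph1 scale1r => ->.
have -> : bergman_sq (0 : cfun) = 0.
  have := bergman_sq_lin 1 (bergman0 R) (bergman0 R); have := bergman_sq_lin 2 (bergman0 R) (bergman0 R).
  rewrite rmorph1 scale1r !scaler0 !addr0; lra.
have -> : real_inner (0 : cfun) (f + g) = 0.
  have := @real_inner_lin 1 0 0 (f + g) (bergman0 R) (bergman0 R) bfg.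
  by rewrite scaler0 addr0; lra.
by rewrite add0r => ->; field.
Qed.

(** Take t = A / (b + 1). *)
Lemma quadratic_vanish (A b : R) : 0 <= b ->
  (forall t : R, t * A <= t ^+ 2 * b) -> A = 0.
Proof.
move=> b0 h; have b1 : 0 < b + 1 by lra.
have := h (A / (b + 1)); rewrite mulrAC expr_div_n.
have -> : A * A / (b + 1) = A ^+ 2 * (b + 1) / (b + 1) ^+ 2 by field; rewrite gt_eqF.
rewrite [leRHS]mulrAC ler_pM2r ?invr_gt0 ?exprn_gt0 // => h2.
have A0 : A ^+ 2 <= 0 by lra.
by apply/eqP; rewrite -sqrf_eq0 eq_le A0 sqr_ge0.
Qed.

(** Minimise J(f) = |f|^2 - 2 G(f).  By the parallelogram identity a minimising
    sequence u_n satisfies |u_m - u_n|^2 <= 2/(n+1) + 2/(m+1).  Montel's theorem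
    provides a pointwise limit h of a subsequence, and
    [bergman_pointwise_limit] applied to m |-> u_m - u_n turns the Cauchy
    estimate into |h - u_n|^2 <= 4/(n+1).  Comparing J(u_n + t g) with the infimum for every real t gives the
    representation.

    The bound on G with a free parameter t expresses G(f)^2 <= C |f|^2 without
    square roots. *)
Lemma bergman_riesz_real (G : cfun -> R) (C : R) :
  (forall (t : R) f g, bergman f -> bergman g ->
     G (t%:C *: f + g) = t * G f + G g) ->
  (forall (t : R) f, 0 < t -> bergman f -> 2 * G f <= t * C + bergman_sq f / t) ->
  exists h, bergman h /\ forall g, bergman g -> real_inner h g = G g.
Proof.
move=> Glin Gbd; pose J f := bergman_sq f - 2 * G f.
(* The bound with t = 1 bounds J below; with t = 2 it bounds a minimising
   sequence in norm. *)
pose E := [set J f | f in [set f : cfun | bergman f]].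
have lbE : lbound E (- C).
  move=> _ [f /= bf <-]; have := Gbd 1 f ltr01 bf.
  by rewrite mul1r divr1 /J; lra.
have hiE : has_inf E by split; [exists (J 0); exists 0 => //; exact: bergman0|exists (- C)].
pose m := inf E.
have mJ f : bergman f -> m <= J f by move=> bf; apply: (ge_inf hiE.2); exists f.
have /choice[u hu] n : exists f, bergman f /\ J f < m + n.+1%:R^-1.
  have n0 : 0 < n.+1%:R^-1 :> R by rewrite invr_gt0 ltr0n.
  by have [_ [f /= bf <-] hf] := inf_adherent n0 hiE; exists f.
have bu n := (hu n).1; have uJ n := (hu n).2.
have n1 n : n.+1%:R^-1 <= 1 :> R by rewrite invf_le1 ?ltr0n // ler1n.
have uB n : bergman_sq (u n) <= 2 * (m + 1 + 2 * C).
  have := Gbd 2 (u n) (ltr0n R 2) (bu n); have := uJ n; have := n1 n; rewrite /J; move: (bergman_sq _) (G _) (n.+1%:R^-1 : R) => a b c; clear; lra.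
have par n k : bergman_sq (u k - u n) <= 2 * n.+1%:R^-1 + 2 * k.+1%:R^-1.
  have bm : bergman ((2^-1)%:C *: (u k + u n)) by apply: bergmanZ; exact: bergmanD.
  have := mJ _ bm; rewrite /J bergman_sq_mid // bergman_sq_sub //.
  have -> : (2^-1)%:C *: (u k + u n) = (2^-1)%:C *: u k + ((2^-1)%:C *: u n + 0).
    by rewrite addr0 scalerDr.
  have -> : G ((2^-1)%:C *: u k + ((2^-1)%:C *: u n + 0)) = 2^-1 * G (u k) + (2^-1 * G (u n) + G 0).
    by rewrite !Glin //; [exact: bergman0|apply: bergman_lin => //; exact: bergman0].
  have -> : G 0 = 0.
    by have := Glin 1 0 0 (bergman0 R) (bergman0 R); rewrite scaler0 addr0; lra.
  have := uJ n; have := uJ k; rewrite /J.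
  move: (n.+1%:R^-1 : R) (k.+1%:R^-1 : R) => a b; lra.
have [phi [h [hphi bh _ hlim]]] := bergman_montel bu uB.
have phi_inv n k : (n <= k)%N -> (phi k).+1%:R^-1 <= n.+1%:R^-1 :> R.
  move=> nk; rewrite lef_pV2 ?posrE ?ltr0n // ler_nat ltnS.
  exact: leq_trans nk (strictly_increasing_ge_id hphi k).
have hd n : bergman_sq (h - u (phi n)) <= 4 * n.+1%:R^-1.
  pose w (k : nat) : cfun := u (phi (k + n)%N) - u (phi n).
  have bw k : bergman (w k) by exact: bergmanB.
  have wB k : bergman_sq (w k) <= 4 * n.+1%:R^-1.
    apply: (le_trans (par _ _)).
    have := phi_inv n n (leqnn n); have := phi_inv n (k + n)%N (leq_addl k n).
    move: ((phi n).+1%:R^-1 : R) ((phi (k + n)%N).+1%:R^-1 : R) (n.+1%:R^-1 : R) => a b c; lra.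
  have z0 (v : R[i]) : Im v <= 0 -> (h - u (phi n)) v = 0.
    move=> hv; have [_ zh _] := bh; have [_ zu _] := bu (phi n).
    have -> : (h - u (phi n)) v = h v - u (phi n) v by [].
    by rewrite zh // zu // subrr.
  have wl (v : R[i]) : 0 < Im v -> (fun k => w k v : R[i]^o) @ \oo --> ((h - u (phi n)) v : R[i]^o).
    move=> hv.
    have h1 : (fun k => u (phi (k + n)%N) v : R[i]^o) @ \oo --> (h v : R[i]^o).
      exact: (@cvg_subseq R[i]^o (fun k => u (phi k) v) (h v) (fun k => (k + n)%N) (fun k => leq_addr n k) (hlim v hv)).
    have h2 : (fun k : nat => u (phi n) v : R[i]^o) @ \oo --> (u (phi n) v : R[i]^o) by exact: cvg_cst.
    exact: cvgC_sub h1 h2.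
  exact: (bergman_pointwise_limit bw wB z0 wl).2.
exists h; split => // g bg.
have D n (t : R) : 2 * t * (G g - real_inner h g) <= 6 * n.+1%:R^-1 + 2 * (t ^+ 2 * bergman_sq g).
  have b1 : bergman (t%:C *: g + u (phi n)) by exact: bergman_lin.
  have := mJ _ b1; rewrite /J Glin // (addrC (t%:C *: g)) bergman_sq_lin //.
  have := bergman_sq_ge0 ((h - u (phi n)) + t%:C *: g).
  rewrite bergman_sq_lin //; last exact: bergmanB.
  rewrite real_inner_sub //; have := hd n; have := uJ (phi n); have := phi_inv n n (leqnn n).
  have i0 : 0 <= n.+1%:R^-1 :> R by rewrite invr_ge0.
  rewrite /J; move: i0; move: ((phi n).+1%:R^-1 : R) (n.+1%:R^-1 : R) => a b; lra.
apply/esym/eqP; rewrite -subr_eq0; apply/eqP; apply: (@quadratic_vanish _ (bergman_sq g)); first exact: bergman_sq_ge0.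
move=> t; rewrite -(ler_pM2l (ltr0n R 2)) mulrA; apply/ler_addgt0Pl => e e0.
have e6 : 0 < e / 6 by rewrite divr_gt0.
have [n hn] := invS_small e6; have := D n t; have := hn n (leqnn n); move: (n.+1%:R^-1 : R) => a; lra.
Qed.

(** The real theorem for Re F gives the real parts; replacing g by i g gives
    the imaginary parts. *)
Lemma bergman_riesz (F : cfun -> R[i]) (C : R) :
  (forall (a : R[i]) f g, bergman f -> bergman g -> F (a *: f + g) = (a^*)%C * F f + F g) ->
  (forall (t : R) f, 0 < t -> bergman f -> 2 * normc (F f) <= t * C + bergman_sq f / t) ->
  exists h, bergman h /\ forall g, bergman g -> bergman_inner h g = F g.
Proof.
move=> Flin Fbd.
have [t f g bf bg|t f t0 bf|h [bh hh]] := @bergman_riesz_real (fun f => Re (F f)) C.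
- by rewrite Flin // conjc_realE ReD ReM /= mul0r subr0.
- apply: le_trans (Fbd t f t0 bf); rewrite ler_pM2l //.
  exact: le_trans (ler_norm _) (Re_le_normc _).
exists h; split => // g bg; apply: complex_eqP; first exact: hh.
have big : bergman ('i%C *: g : cfun) by exact: bergmanZ.
have := hh _ big.
rewrite /real_inner (inner_conj big bh) -[('i%C *: g : cfun)]addr0.
rewrite inner_linl //; [|exact: bergman0].
have F0 : F 0 = 0.
  have := Flin 1 0 0 (bergman0 R) (bergman0 R).
  by rewrite scaler0 addr0 conjc1 mul1r => /esym/eqP; rewrite -subr_eq0 addrK => /eqP.
have i0 : bergman_inner (0 : cfun) h = 0.
  have := inner_linl 1 (bergman0 R) (bergman0 R) bh.
  by rewrite scaler0 addr0 mul1r => /esym/eqP; rewrite -subr_eq0 addrK => /eqP.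
rewrite i0 Flin //; [|exact: bergman0].
by rewrite F0 !addr0 (inner_conj bh bg); case: (bergman_inner h g) (F g) => a b [c d] /=; lra.
Qed.

End Riesz.

(** * Variation and Jordan parts of a complex measure *)

Section HalfplaneBox.
Variable R : realType.

Definition halfplane_box (r : R) : set (R * R) := (`[- r, r] `*` `[r^-1, r])%classic.

Lemma halfplane_box_compact r : compact (halfplane_box r).
Proof. by apply: compact_setX; exact: segment_compact. Qed.

Lemma halfplane_boxS r : (0 < r) -> halfplane_box r `<=` halfplane R.
Proof.
move=> r0 [x y] [_ /=]; rewrite in_itv /= => /andP[h _].
by apply: lt_le_trans h; rewrite invr_gt0.
Qed.

Lemma measurable_halfplane_box r : measurable (halfplane_box r).
Proof. by apply: measurableX; exact: measurable_itv. Qed.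

Lemma cvg_sum_ord (F : nat -> nat -> R) (l : nat -> R) n :
  (forall i, F i @ \oo --> l i) ->
  (fun N => \sum_(i < n) F i N) @ \oo --> \sum_(i < n) l i.
Proof.
move=> h; elim: n => [|n ih].
  rewrite big_ord0 (_ : (fun N => _) = (fun=> 0)); first exact: cvg_cst.
  by apply/funext => N; rewrite big_ord0.
rewrite big_ord_recr /= (_ : (fun N => _) = (fun N => \sum_(i < n) F i N + F n N)).
  exact: (cvgD ih (h n)).
by apply/funext => N; rewrite big_ord_recr.
Qed.

End HalfplaneBox.

Section SetFunctions.
Variable R : realType.
Local Open Scope ereal_scope.

Lemma ereal_sup_add_le (S T : set (\bar R)) (c : \bar R) :
  (forall s, S s -> s \is a fin_num) -> (forall t, T t -> t \is a fin_num) ->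
  S 0 -> T 0 -> (forall s t, S s -> T t -> s + t <= c) ->
  ereal_sup S + ereal_sup T <= c.
Proof.
move=> Sf Tf S0 T0 h.
have h1 t : T t -> ereal_sup S + t <= c.
  move=> Tt; rewrite -leeBrDr ?Tf //; apply: ge_ereal_sup => s Ss.
  by rewrite leeBrDr ?Tf //; exact: h.
have S0' : 0 <= ereal_sup S by exact: ereal_sup_ubound.
have [Soo|Soo] := eqVneq (ereal_sup S) +oo.
  by have := h1 0 T0; rewrite Soo adde0 leye_eq => /eqP ->; rewrite leey.
have Sfin : ereal_sup S \is a fin_num by rewrite ge0_fin_numE // ltey.
rewrite addeC -leeBrDr //; apply: ge_ereal_sup => t Tt.
by rewrite leeBrDr // addeC; exact: h1.
Qed.

(** For set functions defined as suprema, countable subadditivity and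
    superadditivity on two sets are the natural facts; monotonicity upgrades
    the latter to the missing inequality for series. *)
Lemma superadditive_measure d (T : measurableType d) (m : set T -> \bar R) :
  m set0 = 0 -> (forall A, 0 <= m A) ->
  (forall A B, A `<=` B -> m A <= m B) ->
  (forall A B, measurable A -> measurable B -> A `&` B = set0 ->
     m A + m B <= m (A `|` B)) ->
  (forall F : nat -> set T, (forall i, measurable (F i)) -> trivIset setT F ->
     m (\bigcup_i F i) <= \sum_(0 <= i <oo) m (F i)) ->
  semi_sigma_additive m.
Proof.
move=> m0 mge0 mle msup msub F mF tF _.
have fin n : \sum_(0 <= i < n) m (F i) <= m (\big[setU/set0]_(i < n) F i).
  elim: n => [|n ih]; first by rewrite big_geq // big_ord0 m0.
  rewrite big_nat_recr //= big_ord_recr /=.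
  apply: le_trans (msup _ _ _ _ _) => //; first exact: leeD2r.
    by apply: bigsetU_measurable => i _; exact: mF.
  apply/seteqP; split => // x [/=].
  rewrite -bigcup_mkord => -[i /= ilt Fi] Fn.
  by have := tF i n I I (ex_intro _ x (conj Fi Fn)) => e; rewrite e ltnn in ilt.
have -> : m (\bigcup_n F n) = \sum_(0 <= i <oo) m (F i).
  apply/eqP; rewrite eq_le msub //=.
  apply: lime_le; first by apply: is_cvg_nneseries.
  apply: nearW => n; apply: (le_trans (fin n)); apply: mle.
  by rewrite -bigcup_mkord; apply: bigcup_sub => i _; exact: bigcup_sup.
exact: is_cvg_nneseries.
Qed.

Local Notation rcb := (@relcompact_borel R).

Lemma relcompact_borelS A B : rcb A -> measurable B -> B `<=` A -> rcb B.
Proof. by move=> [_ [K [cK KP AK]]] mB BA; split=> //; exists K; split=> // x /BA /AK. Qed.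

Lemma relcompact_borelU A B : rcb A -> rcb B -> rcb (A `|` B).
Proof.
move=> [mA [K [cK KP AK]]] [mB [L [cL LP BL]]]; split; first exact: measurableU.
exists (K `|` L); split; first exact: compactU.
- by move=> x [/KP|/LP].
- by move=> x [/AK|/BL]; [left|right].
Qed.

Lemma relcompact_borel0 : rcb set0.
Proof. by split=> //; exists set0; split => //; exact: compact0. Qed.

(** What the real and imaginary parts of a complex measure satisfy; only
    relatively compact unions are constrained. *)
Definition signed_additive (nu : set (R * R) -> R) : Prop :=
  forall F : nat -> set (R * R), (forall i, measurable (F i)) -> trivIset setT F ->
    rcb (\bigcup_i F i) ->
    (fun n => (\sum_(i < n) nu (F i))%R) @ \oo --> nu (\bigcup_i F i).

Lemma signed_additiveN nu : signed_additive nu -> signed_additive (fun B => - nu B)%R.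
Proof.
move=> h F mF tF rF; have H := h F mF tF rF.
rewrite (_ : (fun n => _) = (fun n => (- \sum_(i < n) nu (F i))%R)); first exact: (cvgN H).
by apply/funext => n; rewrite sumrN.
Qed.

Section JordanPart.
Variable nu : set (R * R) -> R.
Hypothesis nu_add : signed_additive nu.

Lemma signed_additive0 : nu set0 = 0%R.
Proof.
have E : \bigcup_(i : nat) (set0 : set (R * R)) = set0 by exact: bigcup0.
have := @nu_add (fun=> set0) (fun=> measurable0).
rewrite E => /(_ _ relcompact_borel0) h.
have {}h : (fun n => (\sum_(i < n) nu set0)%R) @ \oo --> nu set0.
  by apply: h; apply/trivIsetP => i j _ _ _; rewrite set0I.
have h' : (fun n => (\sum_(i < n.+1) nu set0)%R) @ \oo --> nu set0.
  by rewrite (cvg_shiftS (fun n => (\sum_(i < n) nu set0)%R)).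
have : (fun n : nat => nu set0) @ \oo --> (nu set0 - nu set0)%R.
  rewrite (_ : (fun n => _) = (fun n => (\sum_(i < n.+1) nu set0 - \sum_(i < n) nu set0)%R)).
    exact: (cvgB h' h).
  by apply/funext => n; rewrite big_ord_recr /= addrAC subrr add0r.
rewrite subrr => h0; exact: (cvg_unique _ (cvg_cst _) h0).
Qed.

Lemma signed_additive2 A B : rcb A -> rcb B -> A `&` B = set0 ->
  nu (A `|` B) = (nu A + nu B)%R.
Proof.
move=> rA rB AB; have := @nu_add (bigcup2 A B).
rewrite bigcup2E -trivIset_bigcup2 => /(_ _ AB (relcompact_borelU rA rB)) h.
have {}h : (fun n => (\sum_(i < n) nu (bigcup2 A B i))%R) @ \oo --> nu (A `|` B).
  apply: h => i; case: i => [|[|i]] /=; [exact: rA.1|exact: rB.1|exact: measurable0].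
have h2 : (fun n => (\sum_(i < n.+2) nu (bigcup2 A B i))%R) @ \oo --> nu (A `|` B).
  rewrite (cvg_shiftS (fun n => (\sum_(i < n.+1) nu (bigcup2 A B i))%R)).
  by rewrite (cvg_shiftS (fun n => (\sum_(i < n) nu (bigcup2 A B i))%R)).
have h3 : (fun n => (\sum_(i < n.+2) nu (bigcup2 A B i))%R) @ \oo --> (nu A + nu B)%R.
  rewrite (_ : (fun n => _) = (fun=> nu A + nu B)%R); first exact: cvg_cst.
  apply/funext => n; rewrite !big_ord_recl /= big1 ?addr0 // => i _.
  exact: signed_additive0.
exact: (cvg_unique _ h2 h3).
Qed.

Local Notation P := (jordan_part nu).

Lemma jordan_part_ubound A B : rcb B -> B `<=` A -> (nu B)%:E <= P A.
Proof. by move=> rB BA; apply: ereal_sup_ubound; exists B. Qed.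

Lemma jordan_part_ge0 A : (0%:E <= P A)%E.
Proof. have := @jordan_part_ubound A set0 relcompact_borel0 (@sub0set _ A).
by rewrite signed_additive0. Qed.

Lemma jordan_part0 : P set0 = 0.
Proof.
apply/eqP; rewrite eq_le jordan_part_ge0 andbT; apply: ge_ereal_sup => _ [B [rB B0] <-].
by move: B0; rewrite subset0 => ->; rewrite signed_additive0.
Qed.

(** Any B below the union is the disjoint union of its pieces in the F_i, and
    nu(B) is the limit of the partial sums over the pieces. *)
Lemma jordan_part_sigma_additive : semi_sigma_additive P.
Proof.
apply: superadditive_measure; [exact: jordan_part0|exact: jordan_part_ge0|..].
- by move=> A B AB; apply: ge_ereal_sup => _ [C [rC CA] <-]; apply: jordan_part_ubound => // x /CA /AB.
- move=> A B mA mB AB.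
  have z D : [set (nu B)%:E | B in [set B | rcb B /\ B `<=` D]] 0.
    by exists set0; [split; [exact: relcompact_borel0|]|rewrite signed_additive0].
  apply: ereal_sup_add_le => //; try by move=> _ [? _ <-].
  move=> _ _ [C [rC CA] <-] [D [rD DB] <-].
  have CD : C `&` D = set0 by apply/seteqP; split => // x [/CA Ax /DB Bx]; rewrite -AB.
  rewrite -EFinD -(signed_additive2 rC rD CD); apply: jordan_part_ubound.
    exact: relcompact_borelU.
  by move=> x [/CA|/DB]; [left|right].
- move=> F mF tF; apply: ge_ereal_sup => _ [B [rB BF] <-].
  have BE : \bigcup_i (B `&` F i) = B by rewrite -setI_bigcupr; apply/setIidPl.
  have h := @nu_add (fun i => B `&` F i); rewrite BE in h.
  have {}h : (fun n => (\sum_(i < n) nu (B `&` F i))%R) @ \oo --> nu B.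
    apply: h => //; last exact: trivIset_setIl.
    by move=> i; apply: measurableI => //; exact: rB.1.
  have h2 : (fun n => (\sum_(i < n) nu (B `&` F i))%:E) @ \oo --> (nu B)%:E.
    by apply: cvg_EFin => //; exact: nearW.
  rewrite -(cvg_lim _ h2) //; apply: lime_le; first by apply/cvg_ex; exists (nu B)%:E.
  apply: nearW => n; rewrite -sumEFin -(big_mkord xpredT (fun i => (nu (B `&` F i))%:E)).
  apply: le_trans (nneseries_lim_ge n _); last by move=> i _ _; exact: jordan_part_ge0.
  apply: lee_sum => i _; apply: jordan_part_ubound; last exact: subIsetr.
  apply: (relcompact_borelS rB); last exact: subIsetl.
  by apply: measurableI => //; exact: rB.1.
Qed.

End JordanPart.

(** An alias that records additivity of nu, so that the measure structure can
    be attached to it. *)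
Definition jordan_measure nu of signed_additive nu := jordan_part nu.
HB.instance Definition _ nu (h : signed_additive nu) := isMeasure.Build _ _ _ (jordan_measure h)
  (jordan_part0 h) (jordan_part_ge0 h) (jordan_part_sigma_additive h).

Section Variation.
Variable mu : set (R * R) -> R[i].
Hypothesis hmu : complex_measure mu.
Local Notation V := (cvariation mu).

Lemma Re_signed_additive : signed_additive (fun B => Re (mu B)).
Proof.
move=> F mF tF rF.
rewrite (_ : (fun n => _) = (fun n => Re (\sum_(i < n) mu (F i))%R)).
  by apply: cvgC_ReP; exact: (cmeasure_sigma_additive hmu mF tF rF).
by apply/funext => n; rewrite sum_Re.
Qed.

Lemma Im_signed_additive : signed_additive (fun B => Im (mu B)).
Proof.
move=> F mF tF rF.
rewrite (_ : (fun n => _) = (fun n => Im (\sum_(i < n) mu (F i))%R)).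
  by apply: cvgC_ImP; exact: (cmeasure_sigma_additive hmu mF tF rF).
by apply/funext => n; rewrite sum_Im.
Qed.

Lemma cmeasure0 : mu set0 = 0%R.
Proof.
by apply: complex_eqP; [rewrite (signed_additive0 Re_signed_additive)|rewrite (signed_additive0 Im_signed_additive)].
Qed.

Lemma cvariation_family n (B : nat -> set (R * R)) A : trivIset setT B ->
  (forall i, rcb (B i) /\ B i `<=` A) -> (\sum_(i < n) normc (mu (B i)))%:E <= V A.
Proof. by move=> tB hB; apply: ereal_sup_ubound; exists n, B. Qed.

Lemma trivIset_const0 : trivIset setT (fun _ : nat => set0 : set (R * R)).
Proof. by apply/trivIsetP => i j _ _ _; rewrite set0I. Qed.

Lemma cvariation_ge0 A : (0%:E <= V A)%E.
Proof.
have := @cvariation_family 0 (fun=> set0) A trivIset_const0; rewrite big_ord0; apply.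
by move=> i; split => //; exact: relcompact_borel0.
Qed.

Lemma cvariation_le A B : (forall C, rcb C -> C `<=` A -> C `<=` B) -> V A <= V B.
Proof.
move=> AB; apply: ge_ereal_sup => _ [n [F [tF hF ->]]]; apply: cvariation_family => // i.
by have [rF FA] := hF i; split => //; exact: AB.
Qed.

Lemma cvariation0 : V set0 = 0.
Proof.
apply/eqP; rewrite eq_le cvariation_ge0 andbT; apply: ge_ereal_sup => _ [n [F [tF hF ->]]].
rewrite big1 // => i _; have [_ ] := hF i; rewrite subset0 => ->.
by rewrite cmeasure0 Normc.normc0.
Qed.

(** Concatenate a family in A and a family in B. *)
Lemma cvariation_superadditive A B : A `&` B = set0 -> V A + V B <= V (A `|` B).
Proof.
move=> AB.
have z D : [set s | exists (n : nat) (B : nat -> set (R * R)),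
    [/\ trivIset setT B, forall i, rcb (B i) /\ B i `<=` D &
        s = (\sum_(i < n) normc (mu (B i)))%:E]] 0.
  exists 0%N, (fun=> set0); split; [exact: trivIset_const0| |by rewrite big_ord0].
  by move=> i; split => //; exact: relcompact_borel0.
apply: ereal_sup_add_le => //; try by move=> _ [? [? [_ _ ->]]].
move=> _ _ [n [F [tF hF ->]]] [m [G [tG hG ->]]].
pose D i := if (i < n)%N then F i else G (i - n)%N.
have DU i : rcb (D i) /\ D i `<=` A `|` B.
  rewrite /D; case: ifP => _.
    by have [rF FA] := hF i; split => // x /FA; left.
  by have [rG GB] := hG (i - n)%N; split => // x /GB; right.
have tD : trivIset setT D.
  move=> i j _ _ [x []]; rewrite /D.
  case: (ltnP i n) => hi; case: (ltnP j n) => hj Fx Gx.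
  - by apply: tF => //; exists x.
  - by have : set0 x by rewrite -AB; split; [exact: (hF i).2|exact: (hG _).2 _ Gx].
  - by have : set0 x by rewrite -AB; split; [exact: (hF j).2|exact: (hG _).2 _ Fx].
  - have : (i - n = j - n)%N by apply: tG => //; exists x.
    by move/(congr1 (addn n)); rewrite !subnKC.
have := @cvariation_family (n + m) D _ tD DU.
rewrite big_split_ord /= -EFinD; congr (_ <= _); congr (_ + _)%:E; apply: eq_bigr => i _.
  by rewrite /D ltn_ord.
by rewrite /D ltnNge leq_addr /= addKn.
Qed.

(** Each mu(B_i) is the limit in N of the sum of mu(B_i `&` F_j) over j < N,
    and for fixed j the sets B_i `&` F_j form a family in F_j. *)
Lemma cvariation_subadditive (F : nat -> set (R * R)) : (forall i, measurable (F i)) ->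
  trivIset setT F -> V (\bigcup_i F i) <= \sum_(0 <= i <oo) V (F i).
Proof.
move=> mF tF; apply: ge_ereal_sup => _ [n [B [tB hB ->]]].
have rBF i j : rcb (B i `&` F j).
  apply: (relcompact_borelS (hB i).1); last exact: subIsetl.
  by apply: measurableI => //; exact: (hB i).1.1.
have h i : (fun N => \sum_(j < N) mu (B i `&` F j) : R[i]^o)%R @ \oo --> (mu (B i) : R[i]^o).
  have BE : \bigcup_j (B i `&` F j) = B i by rewrite -setI_bigcupr; apply/setIidPl; exact: (hB i).2.
  have := @cmeasure_sigma_additive _ _ hmu (fun j => B i `&` F j); rewrite BE; apply.
  - by move=> j; exact: (rBF i j).1.
  - exact: trivIset_setIl.
  - exact: (hB i).1.
pose s N : R := (\sum_(i < n) normc (\sum_(j < N) mu (B i `&` F j)))%R.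
have hs : s @ \oo --> (\sum_(i < n) normc (mu (B i)))%R.
  by apply: (@cvg_sum_ord R (fun i N => normc (\sum_(j < N) mu (B i `&` F j))%R) (fun i => normc (mu (B i)))) => i; apply: cvgC_normc; exact: h.
have h2 : (fun N => (s N)%:E) @ \oo --> (\sum_(i < n) normc (mu (B i)))%:E.
  by apply: cvg_EFin => //; exact: nearW.
rewrite -(cvg_lim _ h2) //; apply: lime_le; first by apply/cvg_ex; eexists; exact: h2.
apply: nearW => N; apply: le_trans (nneseries_lim_ge N _); last by move=> i _ _; exact: cvariation_ge0.
apply: (@le_trans _ _ (\sum_(i < n) \sum_(j < N) normc (mu (B i `&` F j)))%:E).
  by rewrite lee_fin; apply: ler_sum => i _; exact: normc_sum.
rewrite exchange_big /= -sumEFin big_mkord; apply: lee_sum => j _.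
apply: (@cvariation_family n (fun i => B i `&` F j) (F j)); first exact: trivIset_setIr.
by move=> i; split => //; exact: subIsetr.
Qed.

Lemma cvariation_sigma_additive : semi_sigma_additive V.
Proof.
apply: superadditive_measure; [exact: cvariation0|exact: cvariation_ge0|..].
- by move=> A B AB; apply: cvariation_le => C _ CA x /CA /AB.
- by move=> A B _ _; exact: cvariation_superadditive.
- exact: cvariation_subadditive.
Qed.

(** Relatively compact sets lie in the half-plane, so its complement has no
    variation; it is added to an exhaustion of the half-plane by compact boxes. *)
Lemma cvariation_sigma_finite : sigma_finite setT V.
Proof.
exists (fun n => ~` halfplane R `|` halfplane_box n.+1%:R).
  apply/seteqP; split => // -[x y] _; have [y0|y0] := lerP y 0.
    by exists 0%N => //; left; rewrite /halfplane /=; apply/negP; rewrite -leNgt.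
  pose n := Num.truncn (Num.max `|x| (Num.max y y^-1))%R.
  have := truncnS_gt (Num.max `|x| (Num.max y y^-1))%R; rewrite !gt_max => /and3P[h1 h2 h3].
  exists n => //; right; split => /=; rewrite in_itv /=.
    by rewrite -ler_norml ltW.
  by rewrite (ltW h2) andbT -[leRHS]invrK lef_pV2 ?posrE ?invr_gt0 // ltW.
move=> n; split.
  apply: measurableU; last exact: measurable_halfplane_box.
  by apply: measurableC; exact: measurable_halfplane.
apply: (@le_lt_trans _ _ (V (halfplane_box n.+1%:R))).
  apply: cvariation_le => C [_ [K [_ KP CK]]] CA x Cx.
  by case: (CA x Cx) => // nP; case: nP; exact: KP (CK x Cx).
apply: (cmeasure_locally_finite hmu); first exact: halfplane_box_compact.
exact: halfplane_boxS.
Qed.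

Lemma jordan_le_cvariation nu A : (forall B, (nu B <= normc (mu B))%R) ->
  jordan_part nu A <= V A.
Proof.
move=> hnu; apply: ge_ereal_sup => _ [B [rB BA] <-].
have tF : trivIset setT (fun i : nat => if i is 0%N then B else set0).
  by apply/trivIsetP => -[|i] [|j] //= _ _ _; rewrite ?(set0I, setI0).
have := @cvariation_family 1 _ A tF; rewrite big_ord_recl big_ord0 addr0 /= => H.
apply: le_trans (H _); first by rewrite lee_fin.
by move=> [|i]; split => //; exact: relcompact_borel0.
Qed.

End Variation.

(** An alias that records the hypotheses on mu, so that the measure structure
    can be attached to it. *)
Definition variation_measure (mu : set (R * R) -> R[i]) of complex_measure mu := cvariation mu.
HB.instance Definition _ (mu : set (R * R) -> R[i]) (h : complex_measure mu) := isMeasure.Build _ _ _ (variation_measure h)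
  (cvariation0 h) (cvariation_ge0 mu) (cvariation_sigma_additive h).
HB.instance Definition _ (mu : set (R * R) -> R[i]) (h : complex_measure mu) :=
  Measure_isSigmaFinite.Build _ _ _ (variation_measure h) (cvariation_sigma_finite h).

End SetFunctions.

(** * Integration against a complex measure *)

Section DominatedMeasure.
Context d (T : measurableType d) (R : realType).
Variables (m1 m2 : {measure set T -> \bar R}) (D : set T).
Hypothesis mD : measurable D.
Hypothesis m12 : forall A, measurable A -> (m1 A <= m2 A)%E.

Lemma ge0_integral_dominated_measure (f : T -> R) : measurable_fun D f ->
  (forall x, D x -> 0 <= f x) ->
  (\int[m1]_(x in D) (f x)%:E <= \int[m2]_(x in D) (f x)%:E)%E.
Proof.
move=> mf f0; rewrite integral_mkcond [leRHS]integral_mkcond.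
apply: ge0_le_measure_integral => //.
  by move=> x; apply: erestrict_ge0 => y Dy; rewrite lee_fin f0.
by apply/(measurable_restrictT _ mD); exact/measurable_EFinP.
Qed.

Lemma integrable_dominated_measure (f : T -> R) :
  m2.-integrable D (EFin \o f) -> m1.-integrable D (EFin \o f).
Proof.
move=> /integrableP[mf fi]; apply/integrableP; split; first exact: mf.
apply: le_lt_trans fi; apply: (@ge0_integral_dominated_measure (fun x => `|f x|)) => //.
by apply: measurableT_comp => //; exact/measurable_EFinP.
Qed.

Lemma cintegrable_dominated_measure (h : T -> R[i]) :
  cintegrable m2 D h -> cintegrable m1 D h.
Proof. by move=> [h1 h2]; split; exact: integrable_dominated_measure. Qed.

Lemma normc_cintegral_dominated_measure (h : T -> R[i]) : cintegrable m2 D h ->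
  normc (cintegral m1 D h) <= \int[m2]_(x in D) normc (h x).
Proof.
move=> ih; have ih1 := cintegrable_dominated_measure ih.
apply: (le_trans (normc_cintegral_le mD ih1)); rewrite /Rintegral fine_le //.
- by apply: integrable_fin_num => //; exact: cintegrable_normc.
- by apply: integrable_fin_num => //; exact: cintegrable_normc.
- apply: ge0_integral_dominated_measure => //.
  by apply: cmeasurable_normc => //; exact: (cintegrable_measurable ih).
Qed.

End DominatedMeasure.

Lemma normc_four_le (R : realType) (a b c d : R[i]) (I : R) :
  normc a <= I -> normc b <= I -> normc c <= I -> normc d <= I ->
  normc ((a - b) + 'i%C * (c - d)) <= 4 * I.
Proof.
move=> h1 h2 h3 h4; apply: (le_trans (normcD _ _)); rewrite Normc.normcM.
have -> : normc ('i%C : R[i]) = 1 by have := @normc_i R 1; rewrite normr1.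
have k1 := normcB a b; have k2 := normcB c d; lra.
Qed.

Section ToeplitzForm.
Variable R : realType.
Variable mu : set (R * R) -> R[i].
Hypothesis hmu : complex_measure mu.
Local Notation Pi := (halfplane R).
Local Notation cfun := (R[i]^o -> R[i]^o).
Local Notation V := (variation_measure hmu).
Local Notation mPi := (@measurable_halfplane R).

Local Notation Pr := (jordan_measure (Re_signed_additive hmu)).
Local Notation Nr := (jordan_measure (signed_additiveN (Re_signed_additive hmu))).
Local Notation Pm := (jordan_measure (Im_signed_additive hmu)).
Local Notation Nm := (jordan_measure (signed_additiveN (Im_signed_additive hmu))).

Lemma jordan_Re_le A : measurable A -> (Pr A <= V A)%E.
Proof.
by move=> _; apply: jordan_le_cvariation => B; exact: le_trans (ler_norm _) (Re_le_normc _).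
Qed.

Lemma jordan_ReN_le A : measurable A -> (Nr A <= V A)%E.
Proof.
move=> _; apply: jordan_le_cvariation => B; apply: le_trans (ler_norm _) _.
by rewrite normrN; exact: Re_le_normc.
Qed.

Lemma jordan_Im_le A : measurable A -> (Pm A <= V A)%E.
Proof.
by move=> _; apply: jordan_le_cvariation => B; exact: le_trans (ler_norm _) (Im_le_normc _).
Qed.

Lemma jordan_ImN_le A : measurable A -> (Nm A <= V A)%E.
Proof.
move=> _; apply: jordan_le_cvariation => B; apply: le_trans (ler_norm _) _.
by rewrite normrN; exact: Im_le_normc.
Qed.

(** The four real integrals of each signed part regroup into complex integrals
    against positive measures, for which linearity and bounds are known. *)
Lemma cmeasure_integralE (h : R * R -> R[i]) : cmeasure_integral mu h =
  (cintegral Pr Pi h - cintegral Nr Pi h) + 'i%C * (cintegral Pm Pi h - cintegral Nm Pi h).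
Proof.
rewrite /cmeasure_integral /signed_integral /cintegral /Rintegral.
by apply: complex_eqP; rewrite /= ?(ReD, ImD, ReB, ImB, ReM, ImM) /=; ring.
Qed.

Lemma cmeasure_integral_le (h : R * R -> R[i]) : cintegrable V Pi h ->
  normc (cmeasure_integral mu h) <= 4 * \int[V]_(p in Pi) normc (h p).
Proof.
move=> ih; rewrite cmeasure_integralE.
apply: normc_four_le.
- exact: (normc_cintegral_dominated_measure mPi jordan_Re_le ih).
- exact: (normc_cintegral_dominated_measure mPi jordan_ReN_le ih).
- exact: (normc_cintegral_dominated_measure mPi jordan_Im_le ih).
- exact: (normc_cintegral_dominated_measure mPi jordan_ImN_le ih).
Qed.

Lemma cmeasure_integral_lin (c : R[i]) (f g : R * R -> R[i]) :
  cintegrable V Pi f -> cintegrable V Pi g ->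
  cmeasure_integral mu (fun p => c * f p + g p) =
  c * cmeasure_integral mu f + cmeasure_integral mu g.
Proof.
have lin (m : {measure set (R * R) -> \bar R}) : (forall A, measurable A -> (m A <= V A)%E) ->
    cintegrable V Pi f -> cintegrable V Pi g ->
    cintegral m Pi (fun p => c * f p + g p) = c * cintegral m Pi f + cintegral m Pi g.
  move=> mV iF iG; have iF' := cintegrable_dominated_measure mPi mV iF.
  have iG' := cintegrable_dominated_measure mPi mV iG.
  rewrite cintegralD //; [|exact: mPi|by apply: cintegrableZ => //; exact: mPi].
  by rewrite cintegralZ //; exact: mPi.
move=> iF iG; rewrite !cmeasure_integralE.
rewrite (lin _ jordan_Re_le iF iG) (lin _ jordan_ReN_le iF iG) (lin _ jordan_Im_le iF iG) (lin _ jordan_ImN_le iF iG).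
ring.
Qed.

Lemma eq_cmeasure_integral (f g : R * R -> R[i]) : (forall p, Pi p -> f p = g p) ->
  cmeasure_integral mu f = cmeasure_integral mu g.
Proof. by move=> fg; rewrite !cmeasure_integralE !(@eq_cintegral _ _ _ _ _ f g fg). Qed.

End ToeplitzForm.

(** * Pseudohyperbolic geometry *)

Section PseudohyperbolicGeometry.
Variable R : realType.
Variable gamma : R.
Hypothesis hgamma : 0 < gamma < 1.
Implicit Types z w : R * R.
Local Notation Pi := (halfplane R).
Local Notation D z := (pseudohyperbolic_disk z gamma).

(** The inequality |z - w| < gamma |z - conj w|, squared: a polynomial condition,
    visibly symmetric in z and w. *)
Definition hclose z w : bool :=
  (z.1 - w.1) ^+ 2 + (z.2 - w.2) ^+ 2 <
  gamma ^+ 2 * ((z.1 - w.1) ^+ 2 + (z.2 + w.2) ^+ 2).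

Lemma hcloseC z w : hclose z w = hclose w z.
Proof.
by rewrite /hclose -[z.1 - w.1]opprB -[z.2 - w.2]opprB !sqrrN (addrC z.2).
Qed.

Lemma pseudohyperbolic_diskE z w : Pi z -> D z w <-> Pi w /\ hclose z w.
Proof.
move=> hz; rewrite /pseudohyperbolic_disk /=.
suff H : Pi w -> (normc ((cplx z - cplx w) / (cplx z - (cplx w)^*)) < gamma) = hclose z w.
  by split=> -[h]; rewrite ?H // -?H.
move=> hw; have g0 : 0 < gamma by case/andP: hgamma.
have n1 : normc ((cplx z : R[i]) - cplx w) ^+ 2 = (z.1 - w.1) ^+ 2 + (z.2 - w.2) ^+ 2.
  by rewrite normc_sqr ReB ImB.
have n2 : normc ((cplx z : R[i]) - (cplx w)^*) ^+ 2 = (z.1 - w.1) ^+ 2 + (z.2 + w.2) ^+ 2.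
  by rewrite normc_sqr ReB ImB Im_conj Re_conj /= opprK.
have d0 : 0 < normc ((cplx z : R[i]) - (cplx w)^*).
  rewrite -(@ltr_pXn2r _ 2) ?nnegrE // expr0n /= n2.
  have : 0 < (z.2 + w.2) ^+ 2 by rewrite exprn_gt0 // addr_gt0.
  by have := sqr_ge0 (z.1 - w.1); lra.
rewrite Normc.normcM Normc.normcV ltr_pdivrMr // /hclose -n1 -n2 -exprMn.
by rewrite ltr_pXn2r ?nnegrE // mulr_ge0 // ltW.
Qed.

(** The condition implies |y - v| < gamma (y + v). *)
Lemma hclose_height z w : Pi z -> Pi w -> hclose z w -> z.2 <= (1 + gamma) / (1 - gamma) * w.2.
Proof.
move=> hz hw; have /andP[g0 g1] := hgamma; rewrite /hclose => h.
have s1 := sqr_ge0 (z.1 - w.1).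
have gg : gamma ^+ 2 <= 1 by rewrite expr_le1 // ltW.
have h2 : (z.2 - w.2) ^+ 2 <= (gamma * (z.2 + w.2)) ^+ 2.
  rewrite exprMn; have : 0 <= (1 - gamma ^+ 2) * (z.1 - w.1) ^+ 2 by rewrite mulr_ge0 // subr_ge0.
  by lra.
have h3 : z.2 - w.2 <= gamma * (z.2 + w.2).
  apply: (le_trans (ler_norm _)); rewrite -(@ler_pXn2r _ 2) ?nnegrE //.
    by rewrite real_normK ?num_real.
  by rewrite mulr_ge0 ?ltW // addr_gt0.
by rewrite mulrAC ler_pdivlMr ?subr_gt0 //; lra.
Qed.

(** The condition implies (1 - gamma^2) (x - u)^2 < gamma^2 (y + v)^2. *)
Lemma hclose_width z w : Pi z -> Pi w -> hclose z w ->
  `|z.1 - w.1| <= (z.2 + w.2) / (1 - gamma).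
Proof.
move=> hz hw; have /andP[g0 g1] := hgamma; rewrite /hclose => h.
have s1 := sqr_ge0 (z.2 - w.2).
have h2 : ((1 - gamma) * `|z.1 - w.1|) ^+ 2 <= (z.2 + w.2) ^+ 2.
  rewrite exprMn real_normK ?num_real //.
  have k1 : 0 <= 2 * gamma * (1 - gamma) * (z.1 - w.1) ^+ 2.
    by apply: mulr_ge0; last exact: sqr_ge0; apply: mulr_ge0; lra.
  have k2 : 0 <= (1 - gamma ^+ 2) * (z.2 + w.2) ^+ 2.
    by rewrite mulr_ge0 ?sqr_ge0 // subr_ge0 expr_le1 // ltW.
  have -> : (1 - gamma) ^+ 2 * (z.1 - w.1) ^+ 2 =
    (1 - gamma ^+ 2) * (z.1 - w.1) ^+ 2 - 2 * gamma * (1 - gamma) * (z.1 - w.1) ^+ 2 by ring.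
  move: h k1 k2; lra.
rewrite ler_pdivlMr ?subr_gt0 // mulrC -(@ler_pXn2r _ 2) ?nnegrE //.
  by rewrite mulr_ge0 // subr_ge0 ltW.
by rewrite addr_ge0 // ltW.
Qed.

(** In the half-plane |z - conj w| >= Im z. *)
Lemma disc_hclose z w : Pi z -> Pi w -> disc (cplx z) (gamma * z.2) w -> hclose z w.
Proof.
move=> hz hw; have /andP[g0 g1] := hgamma; rewrite /disc /sqdist /hclose /= => h.
have h2 : gamma ^+ 2 * z.2 ^+ 2 <= gamma ^+ 2 * ((z.1 - w.1) ^+ 2 + (z.2 + w.2) ^+ 2).
  apply: ler_wpM2l; first exact: sqr_ge0.
  have := sqr_ge0 (z.1 - w.1); have : z.2 ^+ 2 <= (z.2 + w.2) ^+ 2.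
    by apply: ler_sqr_mono; [exact: ltW|rewrite lerDl ltW].
  by lra.
rewrite -exprMn in h2; apply: lt_le_trans h2; move: h; rewrite -[w.1 - z.1]opprB -[w.2 - z.2]opprB !sqrrN.
by [].
Qed.

(** Lets local finiteness of mu bound |mu| uniformly on the disks whose centre
    is in a compact box. *)
Lemma pseudohyperbolic_disk_box z (r : R) : 1 <= r -> halfplane_box r z ->
  D z `<=` halfplane_box (r + ((1 + gamma) / (1 - gamma) + 1) * r / (1 - gamma)).
Proof.
move=> r1 bz; have /andP[g0 g1] := hgamma.
have hz : Pi z by apply: (halfplane_boxS _ bz); lra.
move=> w /(pseudohyperbolic_diskE _ hz)[hw c].
have cw := hclose_width hz hw c.
rewrite hcloseC in c; have ch := hclose_height hw hz c.
rewrite hcloseC in c; have ch' := hclose_height hz hw c.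
case: z w hz bz hw cw ch ch' {c} => x y [u v] /= hz [/=].
rewrite !in_itv /= => /andP[x1 x2] /andP[y1 y2] hw cw ch ch'.
rewrite /halfplane /= in hz hw.
set M := (1 + gamma) / (1 - gamma) in ch ch' *.
have M1 : 1 <= M by rewrite /M ler_pdivlMr ?subr_gt0 //; lra.
have i1 : 1 <= (1 - gamma)^-1 by rewrite invf_ge1 ?subr_gt0 //; lra.
have My : M * y <= M * r by rewrite ler_wpM2l //; lra.
have Mr : r <= M * r by rewrite ler_peMl //; lra.
have A : (M + 1) * r <= (M + 1) * r / (1 - gamma).
  by rewrite ler_peMr // mulr_ge0 //; lra.
have B : (y + v) / (1 - gamma) <= (M + 1) * r / (1 - gamma).
  by rewrite ler_pM2r ?invr_gt0 ?subr_gt0 //; lra.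
set T := (M + 1) * r / (1 - gamma) in A B *.
have := ler_norm (x - u); have := ler_norm (u - x); rewrite distrC => k1 k2.
split; rewrite /= in_itv /=; apply/andP; split; try lra.
have rv : r^-1 <= M * v by lra.
have T0 : 0 < r + T by lra.
rewrite -[leRHS]invrK lef_pV2 ?posrE ?invr_gt0 //.
apply: (@le_trans _ _ (M * r)); last by lra.
rewrite -[leRHS]invrK lef_pV2 ?posrE ?invr_gt0 ?mulr_gt0 //; try lra.
rewrite invfM -(@ler_pM2l _ M); last by lra.
by rewrite mulrA divff ?mul1r // gt_eqF //; lra.
Qed.

Lemma hclose_measurable d (T : measurableType d) (f g : T -> R * R) :
  measurable_fun setT f -> measurable_fun setT g ->
  measurable_fun setT (fun x => hclose (f x) (g x)).
Proof.
move=> mf mg.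
have f1 : measurable_fun setT (fun x => (f x).1) by exact: (measurableT_comp measurable_fst mf).
have f2 : measurable_fun setT (fun x => (f x).2) by exact: (measurableT_comp measurable_snd mf).
have g1 : measurable_fun setT (fun x => (g x).1) by exact: (measurableT_comp measurable_fst mg).
have g2 : measurable_fun setT (fun x => (g x).2) by exact: (measurableT_comp measurable_snd mg).
apply: measurable_fun_ltr.
  by apply: measurable_funD; apply: measurable_funX; exact: measurable_funB.
apply: measurable_funM; first exact: measurable_cst.
apply: measurable_funD; apply: measurable_funX; first exact: measurable_funB.
exact: measurable_funD.
Qed.

Lemma measurable_pseudohyperbolic_disk z : Pi z -> measurable (D z).
Proof.
move=> hz; have -> : D z = Pi `&` (fun w => hclose z w) @^-1` [set true].
  by apply/seteqP; split => w; rewrite pseudohyperbolic_diskE.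
apply: measurableI; first exact: measurable_halfplane.
have := hclose_measurable (@measurable_cst _ _ _ _ setT z) (@measurable_id _ _ setT).
by move=> /(_ measurableT [set true]); rewrite setTI; apply.
Qed.

End PseudohyperbolicGeometry.

(** * Carleson embedding *)

Section Carleson.
Variable R : realType.
Variable gamma : R.
Hypothesis hgamma : 0 < gamma < 1.
Variable N : nat.
Variable V : {sigma_finite_measure set (R * R)%type -> \bar R}.
Local Notation cfun := (R[i]^o -> R[i]^o).
Implicit Types (z w : R * R) (f : cfun).
Local Notation Pi := (halfplane R).
Local Notation mPi := (@measurable_halfplane R).
Local Notation D z := (pseudohyperbolic_disk z gamma).

(** The weight y^(-N-2) restricted to the pairs of points of the half-plane that
    lie in each other's disk. *)
Definition carleson_kernel z w : R :=
  if [&& 0 < z.2, 0 < w.2 & hclose gamma z w] then z.2 `^ (- N.+2%:R) else 0.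

(** Comparable to v^(-N-2) V(D(w)) on the half-plane.  As an integral of a kernel in two
    variables it is measurable by Tonelli's theorem. *)
Definition carleson_density w : \bar R := (\int[V]_z (carleson_kernel z w)%:E)%E.

Definition sqnorm f w : R := normc (f (cplx w)) ^+ 2.

Lemma carleson_kernel_ge0 z w : 0 <= carleson_kernel z w.
Proof. by rewrite /carleson_kernel; case: ifP => // _; exact: powR_ge0. Qed.

Lemma carleson_density_ge0 w : (0 <= carleson_density w)%E.
Proof. by apply: integral_ge0 => z _; rewrite lee_fin carleson_kernel_ge0. Qed.

Lemma measurable_carleson_kernel d (T : measurableType d) (f g : T -> R * R) :
  measurable_fun setT f -> measurable_fun setT g ->
  measurable_fun setT (fun x => carleson_kernel (f x) (g x)).
Proof.
move=> mf mg.
have f2 : measurable_fun setT (fun x => (f x).2) by exact: (measurableT_comp measurable_snd mf).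
have g2 : measurable_fun setT (fun x => (g x).2) by exact: (measurableT_comp measurable_snd mg).
apply: measurable_fun_ifT; last exact: measurable_cst.
  apply: measurable_and; first by apply: measurable_fun_ltr.
  apply: measurable_and; first by apply: measurable_fun_ltr.
  exact: hclose_measurable.
exact: (measurableT_comp (@measurable_powR R _) f2).
Qed.

Lemma measurable_sqnorm f : bergman f -> measurable_fun setT (sqnorm f).
Proof.
move=> bf; have -> : sqnorm f = (fun p => normc (f (cplx p)) ^+ 2) \_ Pi.
  apply/funext => p; rewrite patchE; case: ifPn => //.
  rewrite notin_setE /= /halfplane /= => /negP; rewrite -leNgt => hp.
  by have [_ zf _] := bf; rewrite /sqnorm zf // Normc.normc0 expr0n.
by apply/(measurable_restrictT _ mPi); exact: measurable_sqr_normc.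
Qed.

Lemma measurable_carleson_density : measurable_fun setT carleson_density.
Proof.
apply: (@measurable_fun_fubini_tonelli_G _ _ _ _ _ V (fun zw => (carleson_kernel zw.1 zw.2)%:E)).
  by apply/measurable_EFinP; exact: measurable_carleson_kernel.
by move=> zw; rewrite lee_fin carleson_kernel_ge0.
Qed.

Lemma carleson_kernel_le z w : Pi w ->
  carleson_kernel z w <= ((1 + gamma) / (1 - gamma)) `^ N.+2%:R * w.2 `^ (- N.+2%:R).
Proof.
move=> hw; rewrite /carleson_kernel; case: ifPn => [/and3P[z0 _ c]|_]; last first.
  by apply: mulr_ge0; exact: powR_ge0.
have h : w.2 <= (1 + gamma) / (1 - gamma) * z.2.
  by apply: (hclose_height hgamma hw z0); rewrite hcloseC.
have M0 : 0 <= (1 + gamma) / (1 - gamma).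
  by have /andP[g0 g1] := hgamma; apply: divr_ge0; lra.
rewrite /halfplane /= in hw.
rewrite !powRN -[leLHS]mul1r ler_pdivrMr ?powR_gt0 // mulrAC ler_pdivlMr ?powR_gt0 // mul1r.
rewrite -powRM ?(ltW z0) //; apply: ge0_ler_powR => //; rewrite nnegrE.
  exact: ltW.
by apply: mulr_ge0 => //; exact: ltW.
Qed.

(** Points of D(w) have height at least v / M with M = (1 + gamma)/(1 - gamma). *)
Lemma carleson_density_le w : Pi w ->
  (carleson_density w <=
   (((1 + gamma) / (1 - gamma)) `^ N.+2%:R * w.2 `^ (- N.+2%:R))%:E * V (D w))%E.
Proof.
move=> hw; have mD := measurable_pseudohyperbolic_disk hgamma hw.
rewrite -integral_cst //.
have -> : carleson_density w = (\int[V]_(z in D w) (carleson_kernel z w)%:E)%E.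
  rewrite [RHS]integral_mkcond; apply: eq_integral => z _.
  rewrite patchE; case: ifPn => //; rewrite notin_setE => nz.
  rewrite /carleson_kernel ifF //; apply/negP => /and3P[h1 _ h2]; apply: nz.
  by apply/(pseudohyperbolic_diskE hgamma _ hw); split => //; rewrite hcloseC.
apply: ge0_le_integral => //.
- by move=> z _; rewrite lee_fin carleson_kernel_ge0.
- by apply/measurable_EFinP; apply: measurable_funTS; exact: measurable_carleson_kernel.
- by move=> z _; rewrite /= lee_fin; exact: carleson_kernel_le.
Qed.

(** With this normalisation the weights for alpha and beta are inverse to each
    other when N = alpha + beta. *)
Definition derivative_weight n z : R := z.2 ^+ (n * 2) * z.2 `^ (- N%:R).

Definition derivative_energy n f : \bar R :=
  (\int[V]_(z in Pi) (normc (derive1n n f (cplx z)) ^+ 2 * derivative_weight n z)%:E)%E.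

Definition density_energy f : \bar R :=
  (\int[area R]_w ((sqnorm f w)%:E * carleson_density w))%E.

Lemma measurable_derivative_weight n : measurable_fun setT (derivative_weight n).
Proof.
apply: measurable_funM; first by apply: measurable_funX; exact: measurable_snd.
exact: (measurableT_comp (@measurable_powR R _) measurable_snd).
Qed.

Lemma derivative_weight_ge0 n z : Pi z -> 0 <= derivative_weight n z.
Proof. by move=> hz; apply: mulr_ge0; [apply: exprn_ge0; exact: ltW|exact: powR_ge0]. Qed.

(** The derivative estimate on the disc of radius gamma y, which is contained
    in D(z), after division by y^(N+2). *)
Lemma derivative_local_bound f n z : bergman f -> Pi z ->
  ((normc (derive1n n f (cplx z)) ^+ 2 * derivative_weight n z)%:E <=
   (derivative_const R n / gamma ^+ (n.+1 * 2))%:E *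
   \int[area R]_w (carleson_kernel z w * sqnorm f w)%:E)%E.
Proof.
move=> bf hz; have /andP[g0 g1] := hgamma.
have y0 : 0 < z.2 by exact: hz.
have t0 : 0 < gamma * z.2 by rewrite mulr_gt0.
have ty : gamma * z.2 < z.2 by rewrite gtr_pMl.
have est := bergman_derivative_estimate n bf t0 ty.
set B := disc (cplx z) (gamma * z.2) in est.
have BP : B `<=` Pi by exact: disc_halfplane t0 (ltW ty).
have mB : measurable B by exact: measurable_disc.
have mk : measurable_fun setT (fun w => (carleson_kernel z w * sqnorm f w)%:E).
  apply/measurable_EFinP; apply: measurable_funM; last exact: measurable_sqnorm.
  by apply: measurable_carleson_kernel; [exact: measurable_cst|exact: measurable_id].
have k0 w : (0 <= (carleson_kernel z w * sqnorm f w)%:E)%E.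
  by rewrite lee_fin mulr_ge0 ?carleson_kernel_ge0 // sqr_ge0.
have c0 : 0 <= derivative_const R n / gamma ^+ (n.+1 * 2).
  by apply: divr_ge0; [exact: derivative_const_ge0|apply: exprn_ge0; exact: ltW].
have low : ((z.2 `^ (- N.+2%:R) * square_integral B f)%:E <=
    \int[area R]_w (carleson_kernel z w * sqnorm f w)%:E)%E.
  apply: (@le_trans _ _ (\int[area R]_(w in B) (carleson_kernel z w * sqnorm f w)%:E)%E); last first.
    by apply: ge0_subset_integral.
  have -> : (\int[area R]_(w in B) (carleson_kernel z w * sqnorm f w)%:E =
    \int[area R]_(w in B) ((z.2 `^ (- N.+2%:R))%:E * (sqnorm f w)%:E))%E.
    apply: eq_integral => w; rewrite inE => Bw; rewrite -EFinM /carleson_kernel ifT //.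
    apply/and3P; split => //; first exact: BP.
    by apply: (disc_hclose hgamma hz (BP _ Bw)); exact: Bw.
  rewrite ge0_integralZl_EFin ?powR_ge0 //; last 2 first.
  - by move=> w _; rewrite lee_fin sqr_ge0.
  - by apply/measurable_EFinP; apply: measurable_funTS; exact: measurable_sqnorm.
  rewrite EFinM /square_integral /Rintegral fineK //.
  by apply: integrable_fin_num => //; exact: bergman_disc_L2 bf t0 (ltW ty).
apply: (@le_trans _ _ ((derivative_const R n / gamma ^+ (n.+1 * 2))%:E *
    (z.2 `^ (- N.+2%:R) * square_integral B f)%:E)%E); last by apply: lee_wpmul2l; rewrite ?lee_fin.
rewrite -EFinM lee_fin /derivative_weight !powR_invn ?(ltW y0) //.
have yN : z.2 != 0 by rewrite gt_eqF.
have gN : gamma != 0 by rewrite gt_eqF.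
set F := normc _ ^+ 2 in est *; set S := square_integral _ _ in est *.
have -> : F * (z.2 ^+ (n * 2) * z.2 ^- N) =
    ((gamma * z.2) ^+ (n.+1 * 2) * F) / (gamma ^+ (n.+1 * 2) * z.2 ^+ N.+2).
  rewrite exprMn mulSn !exprD [z.2 ^+ N.+2]exprSr [z.2 ^+ N.+1]exprSr expr2.
  field.
  by rewrite !expf_neq0 // gN yN.
have -> : derivative_const R n / gamma ^+ (n.+1 * 2) * (z.2 ^- N.+2 * S) =
    (derivative_const R n * S) / (gamma ^+ (n.+1 * 2) * z.2 ^+ N.+2).
  by field; rewrite !expf_neq0.
by rewrite ler_pM2r // invr_gt0 mulr_gt0 // exprn_gt0.
Qed.

(** Integrate [derivative_local_bound] and exchange the integrals. *)
Lemma carleson_embedding f n : bergman f ->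
  (derivative_energy n f <=
   (derivative_const R n / gamma ^+ (n.+1 * 2))%:E * density_energy f)%E.
Proof.
move=> bf; have /andP[g0 g1] := hgamma.
have c0 : 0 <= derivative_const R n / gamma ^+ (n.+1 * 2).
  by apply: divr_ge0; [exact: derivative_const_ge0|apply: exprn_ge0; exact: ltW].
pose K (zw : (R * R) * (R * R)) := (carleson_kernel zw.1 zw.2 * sqnorm f zw.2)%:E.
have mK : measurable_fun setT K.
  apply/measurable_EFinP; apply: measurable_funM; first exact: measurable_carleson_kernel.
  by apply: (measurableT_comp _ measurable_snd); exact: measurable_sqnorm.
have K0 zw : (0 <= K zw)%E.
  by rewrite lee_fin mulr_ge0 ?carleson_kernel_ge0 // sqr_ge0.
have mF := @measurable_fun_fubini_tonelli_F _ _ _ _ _ (area R) K mK K0.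
have F0 z : (0 <= \int[area R]_w K (z, w))%E by exact: integral_ge0.
have mcF : measurable_fun setT (fun z => (derivative_const R n / gamma ^+ (n.+1 * 2))%:E *
    \int[area R]_w K (z, w))%E by exact: measurable_funeM.
apply: (@le_trans _ _ (\int[V]_(z in Pi) ((derivative_const R n / gamma ^+ (n.+1 * 2))%:E *
    \int[area R]_w K (z, w)))%E).
  apply: ge0_le_integral; first exact: mPi.
  - by move=> z hz; rewrite lee_fin mulr_ge0 ?derivative_weight_ge0 // sqr_ge0.
  - apply/measurable_EFinP; apply: measurable_funM; last by apply: measurable_funTS; exact: measurable_derivative_weight.
    by apply: measurable_funX; apply: cmeasurable_normc; exact: bergman_derive_cmeasurable.
  - exact: measurable_funTS.
  - by move=> z hz; exact: derivative_local_bound.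
apply: (@le_trans _ _ (\int[V]_z ((derivative_const R n / gamma ^+ (n.+1 * 2))%:E *
    \int[area R]_w K (z, w)))%E).
  apply: ge0_subset_integral => //; first exact: mPi.
  by move=> z _; apply: mule_ge0; rewrite ?lee_fin.
rewrite ge0_integralZl_EFin // (@fubini_tonelli _ _ _ _ _ V (area R) K mK K0).
rewrite (_ : (\int[area R]_y _)%E = density_energy f) //.
apply: eq_integral => w _; rewrite muleC -ge0_integralZr ?lee_fin ?sqr_ge0 //.
- apply/measurable_EFinP; apply: measurable_carleson_kernel; first exact: measurable_id.
  exact: measurable_cst.
- by move=> z _; rewrite lee_fin carleson_kernel_ge0.
Qed.

End Carleson.

(** * Decay of the Carleson density *)

Section GammaFunction.
Variable R : realType.

(** For k > 0 raise t / (2k) <= exp(t / (2k)) to the power k. *)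
Lemma powR_expR_bound (k : R) : 0 <= k ->
  exists2 C : R, 0 <= C & forall t : R, 0 < t -> t `^ k <= C * expR (t / 2).
Proof.
rewrite le_eqVlt => /orP[/eqP <-|k0].
  exists 1 => // t t0; rewrite powRr0 mul1r; apply: le_trans (expR_ge1Dx _); lra.
exists ((2 * k) `^ k); first exact: powR_ge0.
move=> t t0; have k2 : 0 < 2 * k by lra.
have e : (2 * k) * (t / (2 * k)) = t by field; rewrite gt_eqF.
rewrite -{1}e powRM; [|exact: ltW|by apply: divr_ge0; exact: ltW].
apply: ler_wpM2l; first exact: powR_ge0.
have -> : expR (t / 2) = (expR (t / (2 * k))) `^ k.
  rewrite /powR gt_eqF ?expR_gt0 // expRK; congr expR; field; by rewrite gt_eqF.
apply: ge0_ler_powR; rewrite ?nnegrE ?expR_ge0 //; [exact: ltW|by apply: divr_ge0; exact: ltW|].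
by apply: le_trans (expR_ge1Dx _); lra.
Qed.

(** The value of a divergent integral would be 0, so positivity requires
    finiteness too: the integrand is dominated by a multiple of the exponential
    density of rate 1/2, and it is at least exp(-2) on [1, 2]. *)
Lemma gamma_function_gt0 (k : R) : 0 <= k -> 0 < gamma_function (k + 1).
Proof.
move=> k0; rewrite /gamma_function addrK.
set D := [set t : R | 0 < t]; pose h (t : R) := t `^ k * expR (- t).
have mD : measurable D.
  by rewrite (_ : D = `]0, +oo[%classic) //; apply/seteqP; split => t; rewrite /D /= in_itv /= andbT.
have mh : measurable_fun setT h.
  apply: measurable_funM; first exact: measurable_powR.
  apply: (measurableT_comp (f := expR)); first exact: measurable_expR.
  exact: measurable_funN.
have h0 t : 0 <= h t by apply: mulr_ge0; [exact: powR_ge0|exact: expR_ge0].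
have [C C0 hC] := powR_expR_bound k0.
have r0 : 0 < 2^-1 :> R by rewrite invr_gt0.
have ih : (@lebesgue_measure R).-integrable D (EFin \o h).
  have ie0 : (@lebesgue_measure R).-integrable setT (EFin \o exponential_pdf (2^-1 : R)).
    exact: integrable_exponential_pdf.
  have ie : (@lebesgue_measure R).-integrable D (EFin \o exponential_pdf (2^-1 : R)).
    by apply: (integrableS _ _ _ ie0); [exact: measurableT|exact: mD|].
  apply: (le_integrable _ _ _ (integrableZl _ (2 * C) ie)); [exact: mD| | |exact: mD].
    by apply/measurable_EFinP; exact: measurable_funTS.
  move=> t; rewrite /D /= => t0; rewrite lee_fin ger0_norm //.
  apply: le_trans (ler_norm _); rewrite exponential_pdfE; last exact: ltW.
  rewrite /h.
  have -> : 2 * C * (2^-1 * expR (- 2^-1 * t)) = (C * expR (t / 2)) * expR (- t).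
    have -> : expR (- 2^-1 * t) = expR (t / 2) * expR (- t) by rewrite -expRD; congr expR; field.
    by field.
  by apply: ler_wpM2r; [exact: expR_ge0|exact: hC].
pose I : set R := `[1, 2]%classic.
have mI : measurable I by exact: measurable_itv.
have low : ((expR (- 2))%:E <= \int[lebesgue_measure]_(t in D) (h t)%:E)%E.
  apply: (@le_trans _ _ (\int[lebesgue_measure]_(t in I) (cst (expR (- 2))%:E) t)%E).
    rewrite integral_cst; last exact: mI.
    rewrite /I /= lebesgue_measure_itv /= lte_fin ltr1n -EFinB -EFinM lee_fin.
    by rewrite (_ : 2 - 1 = 1 :> R) ?mulr1 //; lra.
  apply: (@le_trans _ _ (\int[lebesgue_measure]_(t in I) (h t)%:E)%E).
    apply: ge0_le_integral => //.
    - by move=> t _; rewrite lee_fin expR_ge0.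
    - by apply/measurable_EFinP; exact: measurable_funTS.
    - move=> t; rewrite /I /= in_itv /= => /andP[t1 t2]; rewrite lee_fin /h -[leLHS]mul1r.
      have k1 : 1 <= t `^ k by rewrite -[leLHS](powRr0 t); exact: ler_powR.
      have k2 : expR (- 2) <= expR (- t) by rewrite ler_expR; lra.
      exact: (ler_pM ler01 (expR_ge0 _) k1 k2).
  apply: ge0_subset_integral => //.
    by apply/measurable_EFinP; exact: measurable_funTS.
  - by move=> t _; rewrite lee_fin.
  - by move=> t; rewrite /I /D /= in_itv /= => /andP[t1 _]; lra.
have fin : (\int[lebesgue_measure]_(t in D) (h t)%:E)%E \is a fin_num.
  exact: integrable_fin_num.
rewrite /Rintegral -lte_fin fineK //; apply: lt_le_trans low.
by rewrite lte_fin expR_gt0.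
Qed.

End GammaFunction.

Section DensityDecay.
Variable R : realType.
Variable gamma : R.
Hypothesis hgamma : 0 < gamma < 1.
Variables (k : R) (N : nat).
Hypothesis hN : N%:R = 2 * k.
Variable mu : set (R * R) -> R[i].
Hypothesis hmu : complex_measure mu.
Hypothesis hlim : (fun r : R => ereal_sup
     [set (cvariation mu (pseudohyperbolic_disk z gamma) *
           (z.2 `^ (- (2 * (k + 1))))%:E *
           (gamma_function (k + 1) ^+ 2)%:E *
           (gamma `^ (- (2 * k)))%:E)%E
     | z in halfplane R `\` rectangle r]) @ +oo --> 0%E.
Local Notation Pi := (halfplane R).
Local Notation dens := (carleson_density gamma N (variation_measure hmu)).
Local Notation M := ((1 + gamma) / (1 - gamma)).

(** The constants Gamma(k+1)^2 gamma^(-2k) are positive, so the hypothesis bounds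
    v^(-N-2) |mu|(D(w)) alone. *)
Lemma carleson_density_small (e : R) : 0 < e ->
  exists2 r : R, 1 <= r & forall w, Pi w -> ~ rectangle r w -> (dens w <= e%:E)%E.
Proof.
move=> e0; have /andP[g0 g1] := hgamma.
have k0 : 0 <= k by have := ler0n R N; rewrite hN; lra.
have G0 := gamma_function_gt0 k0.
have P0 : 0 < gamma `^ (- (2 * k)) by exact: powR_gt0.
have M0 : 0 < M by apply: divr_gt0; lra.
have MN0 : 0 < M `^ N.+2%:R by exact: powR_gt0.
pose c := gamma_function (k + 1) ^+ 2 * gamma `^ (- (2 * k)).
have c0 : 0 < c by rewrite /c mulr_gt0 // exprn_gt0.
pose d := e * c / M `^ N.+2%:R.
have d0 : 0 < d by rewrite /d divr_gt0 // mulr_gt0.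
have nb : nbhs (0%E : \bar R) [set x | (x < d%:E)%E].
  by apply: open_ereal_lt'; rewrite lte_fin.
have [r0 [_ hr]] := hlim nb.
exists (Num.max 1 (r0 + 1)); first by rewrite le_max lexx.
move=> w hw nQ; set r := Num.max _ _ in nQ.
have rr : r0 < r by rewrite lt_max; apply/orP; right; lra.
have /= := hr r rr; rewrite -hN => hs.
apply: (le_trans (carleson_density_le hgamma N (variation_measure hmu) hw)).
have hb : (cvariation mu (pseudohyperbolic_disk w gamma) * (w.2 `^ (- N.+2%:R))%:E * c%:E <= d%:E)%E.
  apply: ltW; apply: le_lt_trans hs; apply: ereal_sup_ubound; exists w; first by split.
  have -> : 2 * (k + 1) = N.+2%:R by rewrite mulrDr -hN mulr1 -natrD addn2.
  by rewrite /c -!muleA -!EFinM -hN.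
have : (cvariation mu (pseudohyperbolic_disk w gamma) * (w.2 `^ (- N.+2%:R))%:E <= (d / c)%:E)%E.
  by rewrite EFinM lee_pdivlMr.
move=> h2; rewrite EFinM -muleA.
have -> : e = M `^ N.+2%:R * (d / c).
  by rewrite /d; field; rewrite !gt_eqF.
rewrite [leRHS]EFinM; apply: lee_wpmul2l; first by rewrite lee_fin ltW.
by rewrite muleC.
Qed.

(** Outside a large rectangle by [carleson_density_small]; inside, the disks lie
    in one compact box, whose variation is finite. *)
Lemma carleson_density_bounded : exists2 K : R, 0 <= K &
  forall w, Pi w -> (dens w <= K%:E)%E.
Proof.
have [r r1 hr] := carleson_density_small ltr01.
have /andP[g0 g1] := hgamma.
have M0 : 0 < M by apply: divr_gt0; lra.
pose b := r + (M + 1) * r / (1 - gamma).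
have b0 : 0 < b.
  rewrite /b; apply: addr_gt0; first by lra.
  by apply: divr_gt0; [apply: mulr_gt0; lra|lra].
pose W := cvariation mu (halfplane_box b).
have Wfin : W \is a fin_num.
  rewrite ge0_fin_numE; last exact: cvariation_ge0.
  apply: (cmeasure_locally_finite hmu); first exact: halfplane_box_compact.
  exact: halfplane_boxS.
have W0 : (0 <= W)%E by exact: cvariation_ge0.
pose K := M `^ N.+2%:R * r `^ N.+2%:R * fine W.
have K0 : 0 <= K.
  by apply: mulr_ge0; [apply: mulr_ge0; exact: powR_ge0|exact: fine_ge0].
exists (1 + K); first lra.
move=> w hw; have [Q|nQ] := pselect (rectangle r w); last first.
  by apply: (le_trans (hr w hw nQ)); rewrite lee_fin; lra.
apply: (le_trans (carleson_density_le hgamma N (variation_measure hmu) hw)).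
apply: (@le_trans _ _ K%:E); last by rewrite lee_fin; lra.
have bw : halfplane_box r w.
  by case: Q => /andP[h1 h2] /andP[h3 h4]; split; rewrite /= in_itv /= !ltW.
have VD : (cvariation mu (pseudohyperbolic_disk w gamma) <= W)%E.
  apply: cvariation_le => C _ CD x /CD.
  exact: (pseudohyperbolic_disk_box hgamma r1 bw).
rewrite /K [leRHS]EFinM fineK //; apply: lee_pmul => //.
  by rewrite lee_fin; apply: mulr_ge0; exact: powR_ge0.
rewrite lee_fin; apply: ler_wpM2l; first exact: powR_ge0.
have w0 : 0 < w.2 by exact: hw.
have r0 : 0 < r by lra.
rewrite powR_invn ?(ltW w0) // powR_mulrn ?(ltW r0) // -exprVn.
rewrite lerXn2r ?nnegrE ?invr_ge0 ?(ltW w0) ?(ltW r0) //.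
rewrite -[leRHS]invrK lef_pV2 ?posrE ?invr_gt0 //.
by case: Q => _ /andP[h3 _]; exact: ltW.
Qed.

End DensityDecay.

(** * Energy of sequences converging pointwise to zero *)

Section DensityEnergy.
Variable R : realType.
Local Notation cfun := (R[i]^o -> R[i]^o).
Implicit Types (z w : R * R) (f : cfun).
Local Notation Pi := (halfplane R).
Local Notation mPi := (@measurable_halfplane R).

Lemma bergman_sq_sub_le f g : bergman f -> bergman g -> bergman_sq (f - g) <= 2 * bergman_sq f + 2 * bergman_sq g.
Proof.
move=> bf bg; have := bergman_sq_ge0 (f + 1%:C *: g); rewrite bergman_sq_lin // bergman_sq_sub //.
by rewrite expr1n mul1r mulr1; lra.
Qed.

Variables (gamma : R) (N : nat).
Hypothesis hgamma : 0 < gamma < 1.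
Variable V : {sigma_finite_measure set (R * R)%type -> \bar R}.
Local Notation dens := (carleson_density gamma N V).

Definition partial_energy (D : set (R * R)) f : \bar R :=
  (\int[area R]_(w in D) ((sqnorm f w)%:E * dens w))%E.

Lemma measurable_energy_integrand f : bergman f ->
  measurable_fun setT (fun w => (sqnorm f w)%:E * dens w)%E.
Proof.
move=> bf; apply: emeasurable_funM; last exact: measurable_carleson_density.
by apply/measurable_EFinP; exact: measurable_sqnorm.
Qed.

Lemma energy_integrand_ge0 f w : (0 <= (sqnorm f w)%:E * dens w)%E.
Proof. by apply: mule_ge0; [rewrite lee_fin sqr_ge0|exact: carleson_density_ge0]. Qed.

Lemma density_energyE f : bergman f -> density_energy gamma N V f = partial_energy Pi f.
Proof.
move=> bf; rewrite /density_energy /partial_energy [RHS]integral_mkcond.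
apply: eq_integral => w _; rewrite patchE; case: ifPn => //.
rewrite notin_setE /halfplane /= => /negP; rewrite -leNgt => hw.
by have [_ zf _] := bf; rewrite /sqnorm zf // Normc.normc0 expr0n mul0e.
Qed.

Lemma partial_energy_le D (c : R) f : bergman f -> measurable D -> D `<=` Pi -> 0 <= c ->
  (forall w, D w -> (dens w <= c%:E)%E) -> (partial_energy D f <= (c * square_integral D f)%:E)%E.
Proof.
move=> bf mD DP c0 hc.
have iD := integrableS mPi mD DP (bergman_L2 bf).
have mD2 : measurable_fun D (fun w => (sqnorm f w)%:E).
  by apply/measurable_EFinP; apply: measurable_funTS; exact: measurable_sqnorm.
apply: (@le_trans _ _ (\int[area R]_(w in D) (c%:E * (sqnorm f w)%:E))%E).
  apply: ge0_le_integral => //.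
  - by move=> w _; exact: energy_integrand_ge0.
  - by apply: measurable_funTS; exact: measurable_energy_integrand.
  - exact: measurable_funeM.
  - move=> w Dw; rewrite muleC; apply: lee_wpmul2r; last exact: hc.
    by rewrite lee_fin sqr_ge0.
rewrite ge0_integralZl_EFin //; last by move=> w _; rewrite lee_fin sqr_ge0.
by rewrite EFinM /square_integral /Rintegral fineK //; exact: integrable_fin_num.
Qed.

Lemma partial_energyD D E f : bergman f -> measurable D -> measurable E ->
  [disjoint D & E] -> partial_energy (D `|` E) f = (partial_energy D f + partial_energy E f)%E.
Proof.
move=> bf mD mE DE; apply: ge0_integral_setU => //.
  by apply: measurable_funTS; exact: measurable_energy_integrand.
by move=> w _; exact: energy_integrand_ge0.
Qed.

Lemma measurable_rectangle (r : R) : measurable (rectangle r).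
Proof.
have -> : rectangle r = (`]- r, r[ `*` `]r^-1, r[)%classic.
  by apply/seteqP; split => -[x y]; rewrite /rectangle /setX /= !in_itv.
by apply: measurableX; exact: measurable_itv.
Qed.

Lemma rectangle_halfplane (r : R) : 1 <= r -> rectangle r `<=` Pi.
Proof.
move=> r1 w [_ /andP[h _]]; apply: lt_trans h.
by rewrite invr_gt0; lra.
Qed.

(** Point evaluations are uniformly bounded on the rectangle, so dominated
    convergence applies. *)
Lemma square_integral_rectangle_cvg0 (v : nat -> cfun) (B r : R) : 1 <= r ->
  (forall n, bergman (v n)) -> (forall n, bergman_sq (v n) <= B) ->
  (forall z : R[i], 0 < Im z -> (fun n => v n z : R[i]^o) @ \oo --> (0 : R[i]^o)) ->
  square_integral (rectangle r) (v n) @[n --> \oo] --> (0 : R).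
Proof.
move=> r1 bv vB v0; set Q := rectangle r.
have mQ : measurable Q by exact: measurable_rectangle.
have QP : Q `<=` Pi by exact: rectangle_halfplane.
have r0 : 0 < r by lra.
have ri : 0 < r^-1 by rewrite invr_gt0.
pose t := r^-1 / 2; have t0 : 0 < t by rewrite divr_gt0 ?invr_gt0.
pose G := derivative_const R 0 * B / t ^+ 2.
have bound n w : Q w -> sqnorm (v n) w <= G.
  move=> [_ /andP[h _]]; have tw : t < w.2.
    by apply: lt_trans h; rewrite /t; move: ri; move: (r^-1 : R) => a; lra.
  have H := bergman_point_estimate (bv n) t0 tw.
  rewrite /G ler_pdivlMr ?exprn_gt0 // mulrC; apply: (le_trans H).
  exact: (ler_wpM2l (derivative_const_ge0 R 0)).
have iG : (area R).-integrable Q (EFin \o cst G).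
  apply: (@integrableS _ _ _ _ (box r)) => //; first exact: measurable_box.
    move=> w [/andP[h1 h2] /andP[h3 h4]]; apply/boxP; rewrite !ler_norml !ltW //.
    by apply: lt_trans h3; apply: (@lt_trans _ _ 0); rewrite ?oppr_lt0 ?invr_gt0.
  apply: measurable_bounded_integrable; [exact: measurable_box|exact: area_box_lty|exact: measurable_cst|].
  exists `|G|; split; first by rewrite num_real.
  by move=> x Gx p _; exact: ltW.
rewrite -[X in _ --> X](_ : fine (\int[area R]_(w in Q) cst 0%E w)%E = 0); last by rewrite integral0.
apply: fine_cvg; rewrite fineK; last by rewrite integral0.
apply: (@dominated_cvg _ _ _ (area R) Q mQ _ _ (EFin \o cst G)) => //.
- by move=> n; apply/measurable_EFinP; apply: measurable_funTS; exact: (measurable_sqnorm (bv n)).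
- move=> w Qw; apply: cvg_EFin; first by apply: nearW.
  have h : normc (v n (cplx w)) @[n --> \oo] --> normc (0 : R[i]).
    by apply: cvgC_normc; apply: v0; exact: QP.
  have := cvgM h h; rewrite Normc.normc0 mulr0; exact.
- by move=> n w Qw /=; rewrite lee_fin ger0_norm ?sqr_ge0 //; exact: bound.
Qed.

Variable K : R.
Hypothesis K0 : 0 <= K.
Hypothesis densK : forall w, Pi w -> (dens w <= K%:E)%E.
Hypothesis dens_small : forall e : R, 0 < e -> exists2 r : R, 1 <= r &
  forall w, Pi w -> ~ rectangle r w -> (dens w <= e%:E)%E.

Lemma density_energy_le f : bergman f -> (density_energy gamma N V f <= (K * bergman_sq f)%:E)%E.
Proof. by move=> bf; rewrite density_energyE //; apply: partial_energy_le => //; exact: mPi. Qed.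

Lemma density_energy_ge0 f : (0 <= density_energy gamma N V f)%E.
Proof. by apply: integral_ge0 => w _; exact: energy_integrand_ge0. Qed.

Lemma density_energy_fin f : bergman f -> density_energy gamma N V f \is a fin_num.
Proof.
move=> bf; rewrite ge0_fin_numE; last exact: density_energy_ge0.
by apply: le_lt_trans (density_energy_le bf) _; exact: ltry.
Qed.

(** Off a large rectangle the density is small and the norms are bounded; on
    the rectangle the density is bounded and the L2 norms tend to 0. *)
Lemma density_energy_cvg0 (v : nat -> cfun) (B : R) :
  (forall n, bergman (v n)) -> (forall n, bergman_sq (v n) <= B) ->
  (forall z : R[i], 0 < Im z -> (fun n => v n z : R[i]^o) @ \oo --> (0 : R[i]^o)) ->
  fine (density_energy gamma N V (v n)) @[n --> \oo] --> (0 : R).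
Proof.
move=> bv vB v0; apply/cvgrPdist_lt => /= e e0.
have B0 : 0 <= B by apply: le_trans (vB 0%N); exact: bergman_sq_ge0.
have e1 : 0 < e / 2 / (B + 1) by rewrite !divr_gt0 //; lra.
have [r r1 hr] := dens_small e1.
have K1 : 0 < K + 1 by apply: ltr_wpDl.
have e2 : 0 < e / 2 / (K + 1) by rewrite !divr_gt0.
have /cvgrPdist_lt/(_ _ e2) := square_integral_rectangle_cvg0 r1 bv vB v0.
apply: filterS => n; rewrite !sub0r !normrN.
rewrite ger0_norm; last by apply: Rintegral_ge0 => w _; exact: sqr_ge0.
rewrite ger0_norm; last by apply: fine_ge0; exact: density_energy_ge0.
move=> hn; rewrite -lte_fin fineK; last exact: density_energy_fin.
have mQ := measurable_rectangle r; have QP := rectangle_halfplane r1.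
have mC : measurable (Pi `\` rectangle r) by apply: measurableD; [exact: mPi|].
rewrite density_energyE //.
have -> : Pi = rectangle r `|` (Pi `\` rectangle r) by rewrite setDUK.
rewrite partial_energyD //; last by apply/disj_setPS => x [? []].
have h1 : (partial_energy (rectangle r) (v n) <= (K * square_integral (rectangle r) (v n))%:E)%E.
  by apply: partial_energy_le => // w /QP; exact: densK.
have h2 : (partial_energy (Pi `\` rectangle r) (v n) <=
    (e / 2 / (B + 1) * square_integral (Pi `\` rectangle r) (v n))%:E)%E.
  apply: partial_energy_le; [exact: bv|exact: mC|exact: subDsetl|exact: ltW|].
  by move=> w [hw nQ]; exact: hr.
apply: (le_lt_trans (leeD h1 h2)); rewrite -EFinD lte_fin.
have h3 : square_integral (Pi `\` rectangle r) (v n) <= B.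
  by apply: le_trans (vB n); apply: square_integral_le_bergman_sq => //; exact: subDsetl.
have h4 : e / 2 / (B + 1) * square_integral (Pi `\` rectangle r) (v n) <= e / 2 / (B + 1) * B.
  by apply: ler_wpM2l => //; exact: ltW.
have h5 : e / 2 / (B + 1) * B <= e / 2.
  by rewrite mulrAC ler_pdivrMr; [apply: ler_wpM2l; lra|lra].
have h6 : K * square_integral (rectangle r) (v n) <= K * (e / 2 / (K + 1)).
  by apply: ler_wpM2l => //; exact: ltW.
have h7 : K * (e / 2 / (K + 1)) < e / 2.
  by rewrite mulrA ltr_pdivrMr; [rewrite mulrC ltr_pM2l; lra|lra].
lra.
Qed.

End DensityEnergy.

(** * Toeplitz operators *)

Section ToeplitzOperator.
Variable R : realType.
Variables (gamma : R) (alpha beta : nat) (mu : set (R * R) -> R[i]).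
Hypothesis hgamma : 0 < gamma < 1.
Hypothesis hmu : complex_measure mu.
Local Notation cfun := (R[i]^o -> R[i]^o).
Implicit Types (z w : R * R) (f g : cfun).
Local Notation Pi := (halfplane R).
Local Notation mPi := (@measurable_halfplane R).
Local Notation V := (variation_measure hmu).
Local Notation N := (alpha + beta)%N.
Local Notation dens := (carleson_density gamma N V).
Local Notation denergy := (density_energy gamma N V).

Variable K : R.
Hypothesis K0 : 0 <= K.
Hypothesis densK : forall w, Pi w -> (dens w <= K%:E)%E.

Definition carleson_const n : R := derivative_const R n / gamma ^+ (n.+1 * 2).

Lemma carleson_const_ge0 n : 0 <= carleson_const n.
Proof.
have /andP[g0 g1] := hgamma.
by apply: divr_ge0; [exact: derivative_const_ge0|apply: exprn_ge0; exact: ltW].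
Qed.

Definition weighted_sq n f z : R :=
  normc (derive1n n f (cplx z)) ^+ 2 * derivative_weight N n z.

Definition weighted_energy n f : R := \int[V]_(z in Pi) weighted_sq n f z.

Lemma weighted_sq_ge0 n f z : Pi z -> 0 <= weighted_sq n f z.
Proof. by move=> hz; apply: mulr_ge0; [exact: sqr_ge0|exact: derivative_weight_ge0]. Qed.

Lemma measurable_weighted_sq n f : bergman f -> measurable_fun Pi (weighted_sq n f).
Proof.
move=> bf; apply: measurable_funM; last by apply: measurable_funTS; exact: measurable_derivative_weight.
by apply: measurable_funX; apply: cmeasurable_normc; exact: bergman_derive_cmeasurable.
Qed.

Lemma denergy_fin f : bergman f -> denergy f \is a fin_num.
Proof. by move=> bf; exact: (density_energy_fin K0 densK bf). Qed.

Lemma weighted_integrable n f : bergman f -> V.-integrable Pi (EFin \o weighted_sq n f).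
Proof.
move=> bf; apply/integrableP; split; first by apply/measurable_EFinP; exact: measurable_weighted_sq.
rewrite (eq_integral (fun z => (weighted_sq n f z)%:E)); last first.
  by move=> z; rewrite inE => hz /=; rewrite ger0_norm // weighted_sq_ge0.
apply: (le_lt_trans (carleson_embedding hgamma N V n bf)).
by rewrite -(fineK (denergy_fin bf)) -EFinM ltry.
Qed.

Lemma weighted_energy_le n f : bergman f ->
  weighted_energy n f <= carleson_const n * fine (denergy f).
Proof.
move=> bf; rewrite -lee_fin EFinM (fineK (denergy_fin bf)) /weighted_energy /Rintegral.
have w := integrable_fin_num mPi (weighted_integrable n bf).
by rewrite (fineK w); exact: (carleson_embedding hgamma N V n bf).
Qed.

Lemma derivative_weightM z : Pi z ->
  derivative_weight N alpha z * derivative_weight N beta z = 1.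
Proof.
move=> hz; have y0 : 0 < z.2 by exact: hz.
have yN : z.2 != 0 by rewrite gt_eqF.
rewrite /derivative_weight powR_invn ?(ltW y0) // mulrACA -exprD -mulnDl exprM expr2.
by rewrite mulrACA mulfV ?expf_neq0 // mulr1.
Qed.

(** With a, b the moduli of the derivatives and p q = 1 for the weights, this is
    2 a b <= t p a^2 + q b^2 / t. *)
Lemma toeplitz_integrand_le f g z (t : R) : 0 < t -> Pi z ->
  2 * normc (toeplitz_integrand alpha beta f g z) <=
  t * weighted_sq alpha f z + weighted_sq beta g z / t.
Proof.
move=> t0 hz; rewrite /toeplitz_integrand Normc.normcM normc_conj /weighted_sq.
have pq := derivative_weightM hz; have p0 := derivative_weight_ge0 N alpha hz.
set p := derivative_weight _ alpha _ in pq p0 *.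
set q := derivative_weight _ beta _ in pq *.
set a := normc _; set b := normc _.
have tp : 0 < t * p.
  by rewrite mulr_gt0 // lt_neqAle p0 andbT eq_sym; apply: contra_eq_neq pq => ->; rewrite mul0r eq_sym oner_eq0.
rewrite -(ler_pM2l tp).
have -> : t * p * (t * (a ^+ 2 * p) + b ^+ 2 * q / t) =
   (t * p * a) ^+ 2 + b ^+ 2 * (p * q) by field; rewrite gt_eqF.
rewrite pq mulr1; have := sqr_ge0 (t * p * a - b); rewrite sqrrB.
lra.
Qed.

Lemma toeplitz_cintegrable f g : bergman f -> bergman g ->
  cintegrable V Pi (toeplitz_integrand alpha beta f g).
Proof.
move=> bf bg; apply: (cintegrable_dominated mPi _
  (integrableD mPi (weighted_integrable alpha bf) (weighted_integrable beta bg))).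
  apply: cmeasurableM; first exact: bergman_derive_cmeasurable.
  by apply: cmeasurable_conj; exact: bergman_derive_cmeasurable.
move=> z hz; have := toeplitz_integrand_le f g ltr01 hz; rewrite mul1r divr1 => h.
have := normc_ge0 (toeplitz_integrand alpha beta f g z); rewrite /=; lra.
Qed.

Lemma toeplitz_form_le f g (t : R) : bergman f -> bergman g -> 0 < t ->
  2 * normc (toeplitz_form alpha beta mu f g) <=
  4 * (t * weighted_energy alpha f + weighted_energy beta g / t).
Proof.
move=> bf bg t0; have ih := toeplitz_cintegrable bf bg.
have H : normc (toeplitz_form alpha beta mu f g) <=
    4 * \int[V]_(z in Pi) normc (toeplitz_integrand alpha beta f g z).
  rewrite /toeplitz_form Normc.normcM normcX normcNe Normc.normc1 expr1n mul1r.
  exact: cmeasure_integral_le.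
have ia := weighted_integrable alpha bf; have ib := weighted_integrable beta bg.
have i1 : V.-integrable Pi (EFin \o (fun z => t * weighted_sq alpha f z)).
  exact: (integrableZl mPi t ia).
have i2 : V.-integrable Pi (EFin \o (fun z => weighted_sq beta g z / t)).
  by apply: eq_integrable (integrableZl mPi t^-1 ib); [exact: mPi|move=> z _ /=; rewrite -EFinM mulrC].
have E : \int[V]_(z in Pi) (2 * normc (toeplitz_integrand alpha beta f g z)) <=
    \int[V]_(z in Pi) (t * weighted_sq alpha f z + weighted_sq beta g z / t).
  apply: le_Rintegral.
  - exact: mPi.
  - exact: (integrableZl mPi 2 (cintegrable_normc mPi ih)).
  - exact: (integrableD mPi i1 i2).
  - by move=> z hz; exact: toeplitz_integrand_le.
rewrite RintegralZl in E; [|exact: mPi|exact: (cintegrable_normc mPi ih)].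
rewrite RintegralD in E; [|exact: mPi|exact: i1|exact: i2].
rewrite RintegralZl in E; [|exact: mPi|exact: ia].
rewrite RintegralZr in E; [|exact: mPi|exact: ib].
move: H E; rewrite -/(weighted_energy alpha f) -/(weighted_energy beta g).
move: (normc _) (\int[V]_(z in Pi) normc _) (weighted_energy alpha f) (weighted_energy beta g / t).
by move=> a b c d; lra.
Qed.

Lemma toeplitz_form_antilin (c : R[i]) f g h : bergman f -> bergman g -> bergman h ->
  toeplitz_form alpha beta mu f (c *: g + h) =
  (c^*)%C * toeplitz_form alpha beta mu f g + toeplitz_form alpha beta mu f h.
Proof.
move=> bf bg bh; rewrite /toeplitz_form.
have ig := toeplitz_cintegrable bf bg; have ih := toeplitz_cintegrable bf bh.
rewrite (eq_cmeasure_integral hmu (g := fun p => (c^*)%C * toeplitz_integrand alpha beta f g p +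
   toeplitz_integrand alpha beta f h p)).
  by rewrite (cmeasure_integral_lin _ ig ih); ring.
move=> p hp; rewrite /toeplitz_integrand.
have [ag _ _] := bg; have [ah _ _] := bh.
rewrite derive1n_lin; [|exact: ag|exact: ah].
by rewrite rmorphD rmorphM mulrDr mulrCA.
Qed.

Lemma toeplitz_form_lin (c : R[i]) f g h : bergman f -> bergman g -> bergman h ->
  toeplitz_form alpha beta mu (c *: f + g) h =
  c * toeplitz_form alpha beta mu f h + toeplitz_form alpha beta mu g h.
Proof.
move=> bf bg bh; rewrite /toeplitz_form.
have iF := toeplitz_cintegrable bf bh; have ig := toeplitz_cintegrable bg bh.
rewrite (eq_cmeasure_integral hmu (g := fun p => c * toeplitz_integrand alpha beta f h p +
   toeplitz_integrand alpha beta g h p)).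
  by rewrite (cmeasure_integral_lin _ iF ig); ring.
move=> p hp; rewrite /toeplitz_integrand.
have [af _ _] := bf; have [ag _ _] := bg.
rewrite derive1n_lin; [|exact: af|exact: ag].
by rewrite mulrDl mulrA.
Qed.

Definition form_const : R := 4 * carleson_const beta * K + 1.

Lemma form_const_gt0 : 0 < form_const.
Proof.
rewrite /form_const; apply: ltr_wpDl => //; apply: mulr_ge0 => //.
by apply: mulr_ge0 => //; exact: carleson_const_ge0.
Qed.

(** [toeplitz_form_le] with its parameter scaled by [form_const], so that the
    energy of g is absorbed in its norm. *)
Lemma toeplitz_form_bounded f g (t : R) : bergman f -> bergman g -> 0 < t ->
  2 * normc (toeplitz_form alpha beta mu f g) <=
  t * (4 * form_const * weighted_energy alpha f) + bergman_sq g / t.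
Proof.
move=> bf bg t0; have c0 := form_const_gt0.
(* The parameter form_const * t makes the coefficient of the norm of g at most
   1 / t. *)
have ct : 0 < form_const * t by rewrite mulr_gt0.
apply: (le_trans (toeplitz_form_le bf bg ct)).
have cb := carleson_const_ge0 beta.
have h1 : 4 * weighted_energy beta g <= form_const * bergman_sq g.
  have e1 := weighted_energy_le beta bg.
  have e2 : fine (denergy g) <= K * bergman_sq g.
    rewrite -lee_fin (fineK (denergy_fin bg)); exact: (density_energy_le K0 densK bg).
  have e3 := ler_wpM2l cb e2; have b0 := bergman_sq_ge0 g.
  rewrite /form_const; lra.
have h2 : 4 * weighted_energy beta g / (form_const * t) <= bergman_sq g / t.
  rewrite invfM mulrA ler_pM2r ?invr_gt0 // ler_pdivrMr // mulrC; rewrite mulrC in h1.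
  by rewrite [leRHS]mulrC mulrC; move: h1; rewrite mulrC.
rewrite mulrDr mulrA lerD //; last by rewrite mulrA.
by rewrite le_eqVlt; apply/orP; left; apply/eqP; ring.
Qed.

(** The form is antilinear and bounded in g; choose the Riesz representative for
    each f. *)
Lemma toeplitz_exists : exists T : cfun -> cfun, toeplitz_operator alpha beta mu T.
Proof.
have ex f : exists h, bergman f -> bergman h /\
    forall g, bergman g -> bergman_inner h g = toeplitz_form alpha beta mu f g.
  have [bf|nf] := pselect (bergman f); last by exists 0.
  have [a g h bg bh|t g t0 bg|h hh] := @bergman_riesz R (toeplitz_form alpha beta mu f)
      (4 * form_const * weighted_energy alpha f).
  - exact: toeplitz_form_antilin.
  - exact: toeplitz_form_bounded.
  - by exists h.
have [T hT] := choice ex; exists T; split; first by move=> f bf; exact: (hT f bf).1.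
move=> f g bf bg; split; last exact: (hT f bf).2.
exact: toeplitz_cintegrable.
Qed.

Variable T : cfun -> cfun.
Hypothesis hT : toeplitz_operator alpha beta mu T.

Lemma toeplitz_bergman f : bergman f -> bergman (T f).
Proof. by case: hT => h _; exact: h. Qed.

Lemma toeplitz_innerE f g : bergman f -> bergman g ->
  bergman_inner (T f) g = toeplitz_form alpha beta mu f g.
Proof. by case: hT => _ h bf bg; exact: (h f g bf bg).2. Qed.

(** Test the form against g = T f. *)
Lemma toeplitz_sq_le f : bergman f ->
  bergman_sq (T f) <= 4 * form_const * carleson_const alpha * fine (denergy f).
Proof.
move=> bf; have bT := toeplitz_bergman bf.
have := toeplitz_form_bounded bf bT ltr01.
rewrite -toeplitz_innerE // inner_bergman_sq // normc_real ger0_norm ?bergman_sq_ge0 //.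
have e1 := weighted_energy_le alpha bf; have c0 : 0 <= 4 * form_const.
  by apply: mulr_ge0 => //; exact: ltW form_const_gt0.
by have := ler_wpM2l c0 e1; lra.
Qed.

(** The form is linear in f and the inner product is nondegenerate. *)
Lemma toeplitz_linear (c : R[i]) f g : bergman f -> bergman g ->
  T (c *: f + g) = c *: T f + T g.
Proof.
move=> bf bg; have bfg := bergman_lin c bf bg.
have b1 := toeplitz_bergman bfg; have b2 := toeplitz_bergman bf.
have b3 := toeplitz_bergman bg; have b4 := bergman_lin c b2 b3.
have bd := bergmanB b1 b4.
suff : T (c *: f + g) - (c *: T f + T g) = 0 by move/subr0_eq.
apply: (bergman_sq_eq0 bd); apply: (@complexI R).
rewrite -inner_bergman_sq // {1}(_ : _ - _ = (-1) *: (c *: T f + T g) + T (c *: f + g)).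
  rewrite inner_linl // inner_linl // !toeplitz_innerE // toeplitz_form_lin //.
  by rewrite mulN1r addNr.
by rewrite scaleN1r addrC.
Qed.

Hypothesis dens_small : forall e : R, 0 < e -> exists2 r : R, 1 <= r &
  forall w, Pi w -> ~ rectangle r w -> (dens w <= e%:E)%E.

(** By linearity T u_n - T l = T (u_n - l), and [toeplitz_sq_le] bounds its norm by
    an energy that tends to 0. *)
Lemma toeplitz_compact : compact_operator T.
Proof.
split; [exact: toeplitz_bergman|by move=> a f g; exact: toeplitz_linear|].
move=> u bu [M uM].
have uB n : bergman_sq (u n) <= M ^+ 2.
  have := uM n; rewrite bergman_normE // => h.
  rewrite -[leLHS]sqr_sqrtr ?bergman_sq_ge0 //; apply: ler_sqr_mono => //; exact: sqrtr_ge0.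
have [phi [l [hphi bl lB hl]]] := bergman_montel bu uB.
pose v n : cfun := u (phi n) - l.
have bv n : bergman (v n) by exact: bergmanB.
have vB n : bergman_sq (v n) <= 2 * M ^+ 2 + 2 * bergman_sq l.
  by apply: (le_trans (bergman_sq_sub_le (bu _) bl)); have := uB (phi n); lra.
have v0 (z : R[i]) : 0 < Im z -> (fun n => v n z : R[i]^o) @ \oo --> (0 : R[i]^o).
  move=> hz; have h2 : (fun k : nat => l z : R[i]^o) @ \oo --> (l z : R[i]^o) by exact: cvg_cst.
  have h3 : (fun n => u (phi n) z - l z : R[i]^o) @ \oo --> (l z - l z : R[i]^o).
    exact: cvgC_sub (hl z hz) h2.
  by rewrite subrr in h3; exact: h3.
have e0 := density_energy_cvg0 K0 densK dens_small bv vB v0.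
have Tv n : T (u (phi n)) - T l = T (v n).
  have -> : v n = (-1) *: l + u (phi n) by rewrite scaleN1r addrC.
  by rewrite toeplitz_linear // scaleN1r addrC.
exists phi, (T l); split; [exact: hphi|exact: toeplitz_bergman|].
pose C := 4 * form_const * carleson_const alpha.
have C0 : 0 <= C.
  apply: mulr_ge0; last exact: carleson_const_ge0.
  by apply: mulr_ge0 => //; exact: ltW form_const_gt0.
apply/cvgrPdist_lt => /= e e_gt0.
have e2 : 0 < e ^+ 2 / (C + 1) by rewrite divr_gt0 ?exprn_gt0 // ltr_wpDl.
have /cvgrPdist_lt/(_ _ e2) := e0; apply: filterS => n.
rewrite !sub0r !normrN Tv bergman_normE; last exact: toeplitz_bergman.
rewrite ger0_norm; last by apply: fine_ge0; exact: density_energy_ge0.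
rewrite [`|Num.sqrt _|]ger0_norm ?sqrtr_ge0 // => hn.
rewrite -(ger0_norm (ltW e_gt0)) -sqrtr_sqr ltr_sqrt ?exprn_gt0 //.
apply: (le_lt_trans (toeplitz_sq_le (bv n))); rewrite -/C.
apply: (@le_lt_trans _ _ ((C + 1) * fine (denergy (v n)))).
  by apply: ler_wpM2r; [apply: fine_ge0; exact: density_energy_ge0|rewrite lerDl].
by rewrite mulrC -ltr_pdivlMr // ltr_wpDl.
Qed.

End ToeplitzOperator.

Unset Implicit Arguments.

Theorem theorem3p10 (R : realType) (gamma : R) (hgamma : 0 < gamma < 1)
  (k : R) (hk : exists n : nat, k = n%:R / 2)
  (alpha beta : nat) (halphabeta : (alpha + beta)%:R = 2 * k)
  (mu : set (R * R) -> R[i]) (hmu : complex_measure mu)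
  (hlim : (fun r : R => ereal_sup
     [set (cvariation mu (pseudohyperbolic_disk z gamma) *
           (z.2 `^ (- (2 * (k + 1))))%:E *
           (gamma_function (k + 1) ^+ 2)%:E *
           (gamma `^ (- (2 * k)))%:E)%E
     | z in halfplane R `\` rectangle r]) @ +oo --> 0%E) :
  (exists T : (R[i]^o -> R[i]^o) -> (R[i]^o -> R[i]^o),
     toeplitz_operator alpha beta mu T) /\
  (forall T : (R[i]^o -> R[i]^o) -> (R[i]^o -> R[i]^o),
     toeplitz_operator alpha beta mu T -> compact_operator T).
Proof.
have small := carleson_density_small hgamma halphabeta hmu hlim.
have [K K0 bounded] := carleson_density_bounded hgamma halphabeta hmu hlim.
split; first exact: (toeplitz_exists hgamma K0 bounded).
by move=> T hT; exact: (toeplitz_compact hgamma K0 bounded hT small).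
Qed.
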